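(* Let $E_{\mathcal G}\rightrightarrows E_M$ be a VB-groupoid of rank $(l,k)$ over a Lie groupoid $\mathcal G\rightrightarrows M$, with core $C$, and let $E_{\mathcal G}^*\rightrightarrows C^*$ be its dual VB-groupoid (of rank $(k,l)$, with core $E_M^*$). Then the PB-groupoid $\mathrm{Fr}^{\mathrm{sbis}}(E_{\mathcal G})\rightrightarrows\mathrm{Fr}(C)\times_M\mathrm{Fr}(E_M)$ is canonically isomorphic to the PB-groupoid $\mathrm{Fr}^{\mathrm{sbis}}(E_{\mathcal G}^* )\rightrightarrows\mathrm{Fr}(E_M^* )\times_M\mathrm{Fr}(C^* )$.
   Context: VB-groupoid of rank $(l,k)$ over a Lie groupoid $\mathcal G\rightrightarrows M$ (source $s$, target $t$, product $gh$ defined when $s(g)=t(h)$, units $1_x$): a Lie groupoid $E_{\mathcal G}\rightrightarrows E_M$ with structure maps $\tilde s,\tilde t,\tilde m,\tilde u,\tilde\tau$ (source, target, multiplication, unit, inverse), together with vector bundles $E_{\mathcal G}\to\mathcal G$ of rank $l+k$ and $E_M\to M$ of rank $k$, such that all structure maps are vector bundle morphisms over those of $\mathcal G\rightrightarrows M$. A subscript $g$ denotes restriction to the fibre $(E_{\mathcal G})_g$. Core: $C:=\{e\in(E_{\mathcal G})_{1_x}: x\in M,\ \tilde s(e)=0\}$, a rank $l$ vector bundle over $M$, with core-anchor $\rho:=\tilde t|_C:C\to E_M$. Right translation: $\tilde R_g:=\tilde m(\cdot,0_g):\ker(\tilde s)|_{s^{-1}(t(g))}\to\ker(\tilde s)|_{s^{-1}(s(g))}$.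 Dual VB-groupoid $E_{\mathcal G}^*\rightrightarrows C^*$ over $\mathcal G\rightrightarrows M$: for $\xi_g\in(E_{\mathcal G}^* )_g$, source $\tilde s(\xi_g)(v)=-\xi_g(\tilde m(0_g,\tilde\tau(v)))$ for $v\in C_{s(g)}$, target $\tilde t(\xi_g)(v)=\xi_g(\tilde m(v,0_g))$ for $v\in C_{t(g)}$, and product determined by $(\xi_1\circ\xi_2)(\tilde m(v_1,v_2))=\xi_1(v_1)+\xi_2(v_2)$ for composable $v_1,v_2$. It has rank $(k,l)$ and its core is canonically $E_M^*$. $\mathrm{Fr}(E)$ is the frame bundle (linear isomorphisms $\mathbb R^r\to E_x$) of a rank $r$ vector bundle. For a VB-groupoid of rank $(l,k)$, an $s$-bisection frame is a frame $\phi_g:\mathbb R^l\times\mathbb R^k\to(E_{\mathcal G})_g$ such that (1) $\phi_g(\mathbb R^l\times\{0\})\subseteq\ker(\tilde s_g)$; (2) $H_g:=\phi_g(\{0\}\times\mathbb R^k)$ satisfies $H_g\oplus\ker(\tilde s_g)=(E_{\mathcal G})_g=H_g\oplus\ker(\tilde t_g)$. They form a submanifold $\mathrm{Fr}^{\mathrm{sbis}}(E_{\mathcal G})\subseteq\mathrm{Fr}(E_{\mathcal G})$. With $\mathbf t(\phi_g)^b(v):=\tilde t(\phi_g(0,v))$ and $\mathbf t(\phi_g)^c(w):=\tilde R_{g^{-1}}(\phi_g(w,0))$ (frames of $E_M$ and $C$ at $t(g)$), set $d_{\phi_g}:=(\mathbf t(\phi_g)^b)^{-1}\circ\rho_{t(g)}\circ\mathbf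 t(\phi_g)^c:\mathbb R^l\to\mathbb R^k$. Lie groupoid structure on $\mathrm{Fr}^{\mathrm{sbis}}(E_{\mathcal G})\rightrightarrows\mathrm{Fr}(C)\times_M\mathrm{Fr}(E_M)$: source $\mathbf s(\phi_g)=(\mathbf s(\phi_g)^c,\mathbf s(\phi_g)^b)$ with $\mathbf s(\phi_g)^c(w)=\tilde R_g(\tilde\tau(\phi_g(-w,d_{\phi_g}(w))))$, $\mathbf s(\phi_g)^b(v)=\tilde s(\phi_g(0,v))$; target $\mathbf t(\phi_g)=(\mathbf t(\phi_g)^c,\mathbf t(\phi_g)^b)$; product $\mathbf m(\phi_g,\phi_h)(w,v)=\tilde m(\phi_g(0,v),\phi_h(0,v))+\tilde R_h(\phi_g(w,0))$; unit $\mathbf u(\varphi^c_x,\varphi^b_x)(w,v)=\tilde u(\varphi^b_x(v))+\varphi^c_x(w)$; inverse $\boldsymbol\tau(\phi_g)(w,v)=\tilde\tau(\phi_g(-w,v+d_{\phi_g}(w)))$. It projects to $\mathcal G\rightrightarrows M$ by $\phi_g\mapsto g$, $(\varphi^c_x,\varphi^b_x)\mapsto x$. General linear 2-groupoid $\mathrm{GL}(l,k)$: $\mathrm{GL}(l,k)_0=\mathrm{Hom}(\mathbb R^l,\mathbb R^k)$; $\mathrm{GL}(l,k)_1=\mathrm{Hom}(\mathbb R^l,\mathbb R^k)\times\mathrm{GL}(l)\times\mathrm{GL}(k)$; $\mathrm{GL}(l,k)_2$ is the set of pairs $\left(d,\begin{pmatrix}A&JB\\0&B\end{pmatrix}\right)\in\mathrm{Hom}(\mathbb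 R^l,\mathbb R^k)\times\mathrm{GL}(l+k)$ with $I_l+Jd\in\mathrm{GL}(l)$ and $I_k+dJ\in\mathrm{GL}(k)$, written $(d,A,J,B)$. Then $t_{10}(d,A,B)=d$, $s_{10}(d,A,B)=B^{-1}dA$, with product the matrix products; $t_{20}(d,A,J,B)=d$, $s_{20}(d,A,J,B)=((I+dJ)B)^{-1}dA$, with product over $\mathrm{GL}(l,k)_0$ given by the product of block matrices (keeping the $d$ of the first factor); $t_{21}(d,A,J,B)=(d,A,(I+dJ)B)$, $s_{21}(d,A,J,B)=(d,(I+Jd)^{-1}A,B)$, with product over $\mathrm{GL}(l,k)_1$: $(d,A,J,(I+dJ')B')\circ_{21}(d,(I+Jd)^{-1}A,J',B')=(d,A,JdJ'+J+J',B')$. PB-groupoid structure: $\mathrm{GL}(l,k)$ acts (freely and properly) from the right on $\mathrm{Fr}^{\mathrm{sbis}}(E_{\mathcal G})\rightrightarrows\mathrm{Fr}(C)\times_M\mathrm{Fr}(E_M)$ by $\phi_g\cdot(d_{\phi_g},M)=\phi_g\circ M$ and $(\varphi^c_x,\varphi^b_x)\cdot(d,A,B)=(\varphi^c_x\circ A,\varphi^b_x\circ B)$, with moment maps $\phi_g\mapsto d_{\phi_g}$ and $(\varphi^c_x,\varphi^b_x)\mapsto(\varphi^b_x)^{-1}\circ\rho_x\circ\varphi^c_x$; the quotient is $\mathcal G\rightrightarrows M$. In the same way $\mathrm{Fr}^{\mathrm{sbis}}(E_{\mathcal G}^* )$ is a PB-groupoid over $\mathcal G\rightrightarrows M$ with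 structural Lie 2-groupoid $\mathrm{GL}(k,l)$. An isomorphism between these two PB-groupoids over $\mathcal G\rightrightarrows M$ means a Lie groupoid isomorphism covering the identity of $\mathcal G\rightrightarrows M$, together with an isomorphism of Lie 2-groupoids $\mathrm{GL}(l,k)\to\mathrm{GL}(k,l)$ with respect to which it is equivariant (compatibly with the moment maps). *)

(* Defs.v *)
(* Conventions.
   - Structures (smooth spaces, groupoids, bundles, VB-groupoids, PB-groupoids)
     are records of raw data; the operations are total functions on an ambient
     type and are meaningful only on the carrier (composable pairs, vectors of
     the same fibre, ...).  The axioms are separate predicates.
   - For frames, R^n consists of column vectors and a linear map R^a -> R^b is
     a b x a matrix acting on the left; charts and plots use row vectors. *)
From HB Require Import structures.
From mathcomp Require Import all_boot all_order all_algebra.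
From mathcomp Require Import all_classical all_reals all_analysis.

Set Implicit Arguments.
Unset Strict Implicit.
Unset Printing Implicit Defensive.

Import Order.TTheory GRing.Theory Num.Theory.
Import numFieldNormedType.Exports.

Local Open Scope classical_set_scope.
Local Open Scope ring_scope.

(* "The" element of [A]: used only where [A] is a singleton. *)
Definition the (T : Type) (x0 : T) (A : set T) : T :=
  if pselect (exists x, A x) is left h then projT1 (cid h) else x0.

Section SmoothSpaces.
Context {R : realType}.

Fixpoint Ck (k : nat) (m : nat) (V : normedModType R)
    (U : set 'rV[R]_m) (f : 'rV[R]_m -> V) : Prop :=
  if k is k'.+1 then
    (forall x, U x -> differentiable f x) /\
    (forall v, Ck k' U (fun x => 'D_v f x))
  else forall x, U x -> f @ x --> f x.

Definition Cinfty (m : nat) (V : normedModType R)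
    (U : set 'rV[R]_m) (f : 'rV[R]_m -> V) : Prop :=
  forall k, Ck k U f.

(* A smooth space is a set [scar] with a family of smooth parametrizations
   ("plots") p : U -> scar, U open in some R^m.  A smooth manifold (see
   [is_manifold]) is a smooth space whose plots are exactly the maps that are
   C^infty in the charts of an atlas; plots make sense without further
   construction on embedded submanifolds (plots of the ambient manifold with
   values in the subset), products, fibre products and frame bundles, and a map
   between manifolds is C^infty iff it sends plots to plots. *)
Record sspace := SSpace {
  spt :> Type;
  scar : set spt;
  plot : forall m : nat, set 'rV[R]_m -> ('rV[R]_m -> spt) -> Prop }.

Definition subsp (X : sspace) (A : set X) : sspace :=
  SSpace (scar (s := X) `&` A)
    (fun m U p => plot (s := X) U p /\ forall u, U u -> A (p u)).

Definition prodsp (X Y : sspace) : sspace :=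
  @SSpace (X * Y)%type
    [set z | scar z.1 /\ scar z.2]
    (fun m U p => plot (s := X) U (fun u => (p u).1) /\
                  plot (s := Y) U (fun u => (p u).2)).

Definition mxsp (a b : nat) : sspace :=
  @SSpace 'M[R]_(a, b) setT (fun m U p => open U /\ Cinfty U p).

Definition smooth (X Y : sspace) (f : X -> Y) : Prop :=
  (forall x, scar x -> scar (f x)) /\
  (forall m (U : set 'rV[R]_m) p, plot U p -> plot U (f \o p)).

Definition diffeo (X Y : sspace) (f : X -> Y) : Prop :=
  smooth f /\
  exists g : Y -> X, [/\ smooth g,
    forall x, scar x -> g (f x) = x & forall y, scar y -> f (g y) = y].

(* On a manifold, this is the manifold topology. *)
Definition sopen (X : sspace) (A : set X) : Prop :=
  A `<=` scar (s := X) /\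
  forall m (U : set 'rV[R]_m) p, plot U p -> open (U `&` (p @^-1` A)).

Record chart (T : Type) (n : nat) := Chart {
  cdom : set T;
  cmap : T -> 'rV[R]_n;
  cinv : 'rV[R]_n -> T }.

Definition atlas_open (X : sspace) n (A : set (chart X n)) (O : set X) : Prop :=
  O `<=` scar (s := X) /\
  forall c, A c -> open (cmap c @` (cdom c `&` O)).

(* Set-theoretic atlases: the topology is the one generated by the charts, and
   it is required to be Hausdorff and second countable. *)
Record smooth_atlas (X : sspace) (n : nat) (A : set (chart X n)) : Prop := {
  atlas_dom : forall c, A c -> cdom c `<=` scar (s := X);
  atlas_inv : forall c, A c -> forall x, cdom c x -> cinv c (cmap c x) = x;
  atlas_overlap : forall c c', A c -> A c' ->
    open (cmap c @` (cdom c `&` cdom c')) /\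
    Cinfty (cmap c @` (cdom c `&` cdom c')) (cmap c' \o cinv c);
  atlas_countable_cover : exists D : set (chart X n),
    [/\ countable D, D `<=` A &
        forall x, scar x -> exists2 c, D c & cdom c x];
  atlas_hausdorff : forall x y : X, scar x -> scar y -> x <> y ->
    exists O O', [/\ atlas_open A O, atlas_open A O', O x, O' y &
                     O `&` O' = set0];
  atlas_plots : forall m (U : set 'rV[R]_m) (p : 'rV[R]_m -> X),
    plot U p <->
    (open U /\
     forall u, U u -> exists c W,
       [/\ A c, open W, W u, W `<=` U &
           (forall w, W w -> cdom c (p w)) /\ Cinfty W (cmap c \o p)]) }.

Definition is_manifold (X : sspace) : Prop :=
  exists n (A : set (chart X n)), smooth_atlas A.

(* The differential, read in charts, is onto at every point. *)
Definition submersion (X Y : sspace) (f : X -> Y) : Prop :=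
  smooth f /\
  forall n (A : set (chart X n)) n' (A' : set (chart Y n')),
    smooth_atlas A -> smooth_atlas A' ->
    forall c c' x, A c -> A' c' -> cdom c x -> cdom c' (f x) ->
    forall z, exists y, 'd (cmap c' \o f \o cinv c) (cmap c x) y = z.

End SmoothSpaces.

Section Groupoids.
Context {R : realType}.
Local Notation sspace := (@sspace R).

Record groupoid (A O : sspace) := Groupoid {
  gsrc : A -> O;
  gtgt : A -> O;
  gmul : A -> A -> A; (* [gmul g h] is relevant when [gsrc g = gtgt h] *)
  gunit : O -> A;
  ginv : A -> A }.

Record is_groupoid (A O : sspace) (G : groupoid A O) : Prop := {
  grp_src_car : forall g, scar g -> scar (gsrc G g);
  grp_tgt_car : forall g, scar g -> scar (gtgt G g);
  grp_mul_car : forall g h, scar g -> scar h -> gsrc G g = gtgt G h ->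
    scar (gmul G g h);
  grp_unit_car : forall x, scar x -> scar (gunit G x);
  grp_inv_car : forall g, scar g -> scar (ginv G g);
  grp_src_mul : forall g h, scar g -> scar h -> gsrc G g = gtgt G h ->
    gsrc G (gmul G g h) = gsrc G h;
  grp_tgt_mul : forall g h, scar g -> scar h -> gsrc G g = gtgt G h ->
    gtgt G (gmul G g h) = gtgt G g;
  grp_mulA : forall g h j, scar g -> scar h -> scar j ->
    gsrc G g = gtgt G h -> gsrc G h = gtgt G j ->
    gmul G g (gmul G h j) = gmul G (gmul G g h) j;
  grp_src_unit : forall x, scar x -> gsrc G (gunit G x) = x;
  grp_tgt_unit : forall x, scar x -> gtgt G (gunit G x) = x;
  grp_mul1 : forall g, scar g -> gmul G g (gunit G (gsrc G g)) = g;
  grp_1mul : forall g, scar g -> gmul G (gunit G (gtgt G g)) g = g;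
  grp_src_inv : forall g, scar g -> gsrc G (ginv G g) = gtgt G g;
  grp_tgt_inv : forall g, scar g -> gtgt G (ginv G g) = gsrc G g;
  grp_mulV : forall g, scar g -> gmul G g (ginv G g) = gunit G (gtgt G g);
  grp_Vmul : forall g, scar g -> gmul G (ginv G g) g = gunit G (gsrc G g) }.

Definition composable_space (A O : sspace) (G : groupoid A O) : sspace :=
  subsp (X := prodsp A A) [set z | gsrc G z.1 = gtgt G z.2].

Record is_lie_groupoid (A O : sspace) (G : groupoid A O) : Prop := {
  lie_groupoid : is_groupoid G;
  lie_arr_manifold : is_manifold A;
  lie_obj_manifold : is_manifold O;
  lie_src : submersion (gsrc G);
  lie_tgt : submersion (gtgt G);
  lie_mul : smooth (X := composable_space G) (Y := A)
              (fun z => gmul G z.1 z.2);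
  lie_unit : smooth (gunit G);
  lie_inv : smooth (ginv G) }.

Record groupoid_iso (A O A' O' : sspace)
    (G : groupoid A O) (G' : groupoid A' O')
    (FA : A -> A') (FO : O -> O') : Prop := {
  giso_arr : diffeo FA;
  giso_obj : diffeo FO;
  giso_src : forall g, scar g -> gsrc G' (FA g) = FO (gsrc G g);
  giso_tgt : forall g, scar g -> gtgt G' (FA g) = FO (gtgt G g);
  giso_mul : forall g h, scar g -> scar h -> gsrc G g = gtgt G h ->
    FA (gmul G g h) = gmul G' (FA g) (FA h);
  giso_unit : forall x, scar x -> FA (gunit G x) = gunit G' (FO x);
  giso_inv : forall g, scar g -> FA (ginv G g) = ginv G' (FA g) }.

End Groupoids.

Section Bundles.
Context {R : realType}.
Local Notation sspace := (@sspace R).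

Record bundle (T B : sspace) := Bundle {
  bpr : T -> B;
  bzero : B -> T;
  badd : T -> T -> T;
  bscale : R -> T -> T }.

Definition fibre (T B : sspace) (E : bundle T B) (x : B) : set T :=
  [set e | scar e /\ bpr E e = x].

(* Local triviality.  The vector space axioms on the fibres are not listed,
   since they are transported from R^r by [psi]. *)
Definition local_trivialization (r : nat) (T B : sspace) (E : bundle T B)
    (U : set B) (psi : T -> 'cV[R]_r) : Prop :=
  diffeo (X := subsp [set e | U (bpr E e)]) (Y := prodsp (subsp U) (mxsp r 1))
    (fun e => (bpr E e, psi e)) /\
  forall x, U x ->
    [/\ fibre E x (bzero E x) /\ psi (bzero E x) = 0,
        forall e e', fibre E x e -> fibre E x e' ->
          fibre E x (badd E e e') /\ psi (badd E e e') = psi e + psi e' &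
        forall a e, fibre E x e ->
          fibre E x (bscale E a e) /\ psi (bscale E a e) = a *: psi e].

Definition is_vector_bundle (r : nat) (T B : sspace) (E : bundle T B) : Prop :=
  [/\ is_manifold T, is_manifold B, smooth (bpr E) &
      forall x, scar x -> exists U (psi : T -> 'cV[R]_r),
        [/\ sopen U, U x & local_trivialization E U psi]].

(* [F : E -> E'] is fibrewise linear over [f]. *)
Definition bundle_morphism (T B T' B' : sspace)
    (E : bundle T B) (E' : bundle T' B') (F : T -> T') (f : B -> B') : Prop :=
  [/\ smooth F, smooth f,
      forall e, scar e -> bpr E' (F e) = f (bpr E e),
      forall x e e', fibre E x e -> fibre E x e' ->
        F (badd E e e') = badd E' (F e) (F e') &
      forall a e, scar e -> F (bscale E a e) = bscale E' a (F e)].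

(* A point of the dual bundle over [x] is a pair (x, xi) where [xi] is extended
   by zero outside the fibre over [x].  A family (x_u, xi_u) is smooth iff x_u
   is smooth and <xi_u, q_u> is smooth for every (local) smooth family of
   vectors q_u over x_u; taking for q the elements of a local frame, this says
   that the coordinates of xi_u in dual trivializations are smooth. *)
Definition dual_space (T B : sspace) (E : bundle T B) : sspace :=
  let car := [set z : B * (T -> R) |
    [/\ scar z.1,
        forall e e', fibre E z.1 e -> fibre E z.1 e' ->
          z.2 (badd E e e') = z.2 e + z.2 e',
        forall a e, fibre E z.1 e -> z.2 (bscale E a e) = a * z.2 e &
        forall e, ~ fibre E z.1 e -> z.2 e = 0]] in
  @SSpace R (B * (T -> R))%type car
    (fun m U p =>
      [/\ plot (s := B) U (fun u => (p u).1),
          forall u, U u -> car (p u) &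
          forall W q, W `<=` U -> plot (s := T) W q ->
            (forall w, W w -> bpr E (q w) = (p w).1) ->
            Cinfty W (fun w => (p w).2 (q w) : R^o)]).

Definition dual_bundle (T B : sspace) (E : bundle T B) :
    bundle (dual_space E) B :=
  @Bundle (dual_space E) B
    (fun z => z.1)
    (fun x => (x, fun=> 0))
    (fun z z' => (z.1, fun e => z.2 e + z'.2 e))
    (fun a z => (z.1, fun e => a * z.2 e)).

(* Extension by zero of a functional on the fibre over [x]. *)
Definition functional (T B : sspace) (E : bundle T B) (x : B) (f : T -> R) :
    dual_space E :=
  (x, fun e => if e \in fibre E x then f e else 0).

(* [phi] is a linear isomorphism from [V] onto the fibre over [x]. *)
Definition is_frame (V : lmodType R) (T B : sspace) (E : bundle T B)
    (x : B) (phi : V -> T) : Prop :=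
  [/\ forall v, fibre E x (phi v),
      forall a v v', phi (a *: v + v') = badd E (bscale E a (phi v)) (phi v'),
      injective phi &
      forall e, fibre E x e -> exists v, phi v = e].

Definition frame_base (V : lmodType R) (T B : sspace) (E : bundle T B)
    (phi : V -> T) : B := bpr E (phi 0).

Definition frame_inv (V : lmodType R) (T : Type) (phi : V -> T) (e : T) : V :=
  xget 0 [set v | phi v = e].

(* Fr(E), as a submanifold of the sum of copies of E. *)
Definition frame_space (V : lmodType R) (T B : sspace) (E : bundle T B) :
    sspace :=
  let car := [set phi : V -> T | exists2 x, scar x & is_frame E x phi] in
  @SSpace R (V -> T) car
    (fun m U p => (forall u, U u -> car (p u)) /\
                  forall v, plot (s := T) U (fun u => p u v)).

Definition dot (r : nat) (a b : 'cV[R]_r) : R := (a^T *m b) 0 0.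

(* The dual frame of [phi], i.e. alpha |-> (alpha, phi^-1 -). *)
Definition dual_frame (r : nat) (T B : sspace) (E : bundle T B)
    (phi : 'cV[R]_r -> T) : 'cV[R]_r -> dual_space E :=
  fun alpha => functional E (frame_base E phi)
    (fun e => dot alpha (frame_inv phi e)).

End Bundles.

Section VBGroupoids.
Context {R : realType}.
Local Notation sspace := (@sspace R).

Record vb_groupoid := VBGroupoid {
  vbGA : sspace; vbGO : sspace;            (* G => M *)
  vbEA : sspace; vbEO : sspace;            (* E_G => E_M *)
  vbG : groupoid vbGA vbGO;
  vbE : groupoid vbEA vbEO;
  vbA : bundle vbEA vbGA;                  (* E_G -> G *)
  vbO : bundle vbEO vbGO }.                (* E_M -> M *)

(* The last three fields say that the multiplication is a vector bundle
   morphism from the bundle of composable pairs of E_G, over the manifold of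
   composable pairs of G, to E_G (its smoothness is part of [vb_E_lie]). *)
Record is_vb_groupoid (l k : nat) (V : vb_groupoid) : Prop := {
  vb_G_lie : is_lie_groupoid (vbG V);
  vb_E_lie : is_lie_groupoid (vbE V);
  vb_A_bundle : is_vector_bundle (l + k) (vbA V);
  vb_O_bundle : is_vector_bundle k (vbO V);
  vb_src : bundle_morphism (vbA V) (vbO V) (gsrc (vbE V)) (gsrc (vbG V));
  vb_tgt : bundle_morphism (vbA V) (vbO V) (gtgt (vbE V)) (gtgt (vbG V));
  vb_unit : bundle_morphism (vbO V) (vbA V) (gunit (vbE V)) (gunit (vbG V));
  vb_inv : bundle_morphism (vbA V) (vbA V) (ginv (vbE V)) (ginv (vbG V));
  vb_mul_pr : forall e f, scar e -> scar f ->
    gsrc (vbE V) e = gtgt (vbE V) f ->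
    bpr (vbA V) (gmul (vbE V) e f) =
      gmul (vbG V) (bpr (vbA V) e) (bpr (vbA V) f);
  vb_mul_add : forall g h e e' f f',
    fibre (vbA V) g e -> fibre (vbA V) g e' ->
    fibre (vbA V) h f -> fibre (vbA V) h f' ->
    gsrc (vbE V) e = gtgt (vbE V) f -> gsrc (vbE V) e' = gtgt (vbE V) f' ->
    gmul (vbE V) (badd (vbA V) e e') (badd (vbA V) f f') =
      badd (vbA V) (gmul (vbE V) e f) (gmul (vbE V) e' f');
  vb_mul_scale : forall a e f, scar e -> scar f ->
    gsrc (vbE V) e = gtgt (vbE V) f ->
    gmul (vbE V) (bscale (vbA V) a e) (bscale (vbA V) a f) =
      bscale (vbA V) a (gmul (vbE V) e f) }.

Section Core.
Context (V : vb_groupoid).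
Local Notation s := (gsrc (vbG V)).
Local Notation u := (gunit (vbG V)).
Local Notation "'s~'" := (gsrc (vbE V)).
Local Notation "'t~'" := (gtgt (vbE V)).
Local Notation "'m~'" := (gmul (vbE V)).
Local Notation "'u~'" := (gunit (vbE V)).
Local Notation "'tau~'" := (ginv (vbE V)).
Local Notation "'0A'" := (bzero (vbA V)).
Local Notation "'0O'" := (bzero (vbO V)).
Local Notation addA := (badd (vbA V)).

Definition ker_src (g : vbGA V) : set (vbEA V) :=
  [set e | fibre (vbA V) g e /\ s~ e = 0O (s g)].

Definition ker_tgt (g : vbGA V) : set (vbEA V) :=
  [set e | fibre (vbA V) g e /\ t~ e = 0O (gtgt (vbG V) g)].

Definition core_space : sspace :=
  subsp [set e : vbEA V | exists2 x, scar x & ker_src (u x) e].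

(* The core C -> M; an element over 1_x is sent to x = s(1_x). *)
Definition core : bundle core_space (vbGO V) :=
  @Bundle R core_space (vbGO V)
    (fun e => s (bpr (vbA V) e))
    (fun x => 0A (u x))
    addA
    (bscale (vbA V)).

Definition core_anchor (c : core_space) : vbEO V := t~ c.

Definition right_translation (g : vbGA V) (e : vbEA V) : vbEA V :=
  m~ e (0A g).

(* The dual VB-groupoid E_G^* => C^*. *)
Definition dual_src (xi : dual_space (vbA V)) : dual_space core :=
  functional core (s xi.1) (fun v => - xi.2 (m~ (0A xi.1) (tau~ v))).

Definition dual_tgt (xi : dual_space (vbA V)) : dual_space core :=
  functional core (gtgt (vbG V) xi.1) (fun v => xi.2 (m~ v (0A xi.1))).

Definition dual_mul (xi1 xi2 : dual_space (vbA V)) : dual_space (vbA V) :=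
  the xi1 [set zeta : dual_space (vbA V) |
    [/\ scar zeta,
        zeta.1 = gmul (vbG V) xi1.1 xi2.1 &
        forall v1 v2, fibre (vbA V) xi1.1 v1 -> fibre (vbA V) xi2.1 v2 ->
          s~ v1 = t~ v2 -> zeta.2 (m~ v1 v2) = xi1.2 v1 + xi2.2 v2]].

(* The unit and the inverse are those forced by the product: a unit over
   alpha in C_x^* vanishes on units of E_G and restricts to alpha on C_x. *)
Definition dual_unit (alpha : dual_space core) : dual_space (vbA V) :=
  functional (vbA V) (u alpha.1)
    (fun e => alpha.2 (addA e (bscale (vbA V) (-1) (u~ (s~ e))))).

Definition dual_inv (xi : dual_space (vbA V)) : dual_space (vbA V) :=
  functional (vbA V) (ginv (vbG V) xi.1) (fun e => - xi.2 (tau~ e)).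

Definition dual_vb_groupoid : vb_groupoid :=
  @VBGroupoid (vbGA V) (vbGO V) (dual_space (vbA V)) (dual_space core)
    (vbG V)
    (@Groupoid R (dual_space (vbA V)) (dual_space core)
       dual_src dual_tgt dual_mul dual_unit dual_inv)
    (dual_bundle (vbA V)) (dual_bundle core).

End Core.

(* The canonical identification of E_M^* with the core of the dual, and its
   inverse: eta in the fibre of E_M^* over x is sent to eta o t~ on the fibre
   over 1_x; conversely zeta is sent to zeta o u~.  (A core element zeta of the
   dual vanishes on ker t~, because its source is zero, so it factors through
   t~; and t~ o u~ = id.) *)
Definition to_dual_core (V : vb_groupoid) (eta : dual_space (vbO V)) :
    core_space (dual_vb_groupoid V) :=
  functional (vbA V) (gunit (vbG V) eta.1) (fun e => eta.2 (gtgt (vbE V) e)).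

Definition of_dual_core (V : vb_groupoid)
    (zeta : core_space (dual_vb_groupoid V)) : dual_space (vbO V) :=
  functional (vbO V) (gsrc (vbG V) zeta.1)
    (fun v => zeta.2 (gunit (vbE V) v)).

End VBGroupoids.

Section GeneralLinear2Groupoid.
Context {R : realType}.
Local Notation sspace := (@sspace R).

Record two_groupoid := TwoGroupoid {
  L0 : sspace; L1 : sspace; L2 : sspace;
  L10 : groupoid L1 L0;
  L20 : groupoid L2 L0;
  L21 : groupoid L2 L1 }.

Record two_groupoid_iso (L L' : two_groupoid)
    (F0 : L0 L -> L0 L') (F1 : L1 L -> L1 L') (F2 : L2 L -> L2 L') : Prop := {
  liso10 : groupoid_iso (L10 L) (L10 L') F1 F0;
  liso20 : groupoid_iso (L20 L) (L20 L') F2 F0;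
  liso21 : groupoid_iso (L21 L) (L21 L') F2 F1 }.

Section GL.
Context (l k : nat).

Definition GL0 : sspace := mxsp k l.

(* Triples (d, A, B). *)
Definition GL1 : sspace :=
  subsp (X := prodsp (prodsp (mxsp k l) (mxsp l l)) (mxsp k k))
    [set x | x.1.2 \in unitmx /\ x.2 \in unitmx].

Definition gl2_space : sspace := prodsp (mxsp k l) (mxsp (l + k) (l + k)).

(* (d, A, J, B) stands for d together with the block matrix (A, JB; 0, B). *)
Definition gl2 (d : 'M[R]_(k, l)) (A : 'M[R]_l) (J : 'M[R]_(l, k)) (B : 'M[R]_k) :
    gl2_space := (d, block_mx A (J *m B) 0 B).
Definition gl2_d (x : gl2_space) : 'M[R]_(k, l) := x.1.
Definition gl2_A (x : gl2_space) : 'M[R]_l := ulsubmx x.2.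
Definition gl2_B (x : gl2_space) : 'M[R]_k := drsubmx x.2.
Definition gl2_J (x : gl2_space) : 'M[R]_(l, k) :=
  ursubmx x.2 *m invmx (gl2_B x).

Definition gl2_IdJ (x : gl2_space) : 'M[R]_k := 1%:M + gl2_d x *m gl2_J x.
Definition gl2_IJd (x : gl2_space) : 'M[R]_l := 1%:M + gl2_J x *m gl2_d x.

Definition GL2 : sspace :=
  subsp [set x : gl2_space |
    [/\ x.2 \in unitmx, dlsubmx x.2 = 0,
        gl2_IJd x \in unitmx & gl2_IdJ x \in unitmx]].

Definition GL10 : groupoid GL1 GL0 := @Groupoid R GL1 GL0
  (fun x => invmx x.2 *m x.1.1 *m x.1.2)
  (fun x => x.1.1)
  (fun x y => (x.1.1, x.1.2 *m y.1.2, x.2 *m y.2))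
  (fun d => (d, 1%:M, 1%:M))
  (fun x => (invmx x.2 *m x.1.1 *m x.1.2, invmx x.1.2, invmx x.2)).

Definition gl2_s20 (x : gl2_space) : 'M[R]_(k, l) :=
  invmx (gl2_IdJ x *m gl2_B x) *m gl2_d x *m gl2_A x.

Definition GL20 : groupoid GL2 GL0 := @Groupoid R GL2 GL0
  gl2_s20
  (fun x => x.1)
  (fun x y => (x.1, x.2 *m y.2))
  (fun d => (d, 1%:M))
  (fun x => (gl2_s20 x, invmx x.2)).

Definition GL21 : groupoid GL2 GL1 := @Groupoid R GL2 GL1
  (fun x => (gl2_d x, invmx (gl2_IJd x) *m gl2_A x, gl2_B x))
  (fun x => (gl2_d x, gl2_A x, gl2_IdJ x *m gl2_B x))
  (fun x y => gl2 (gl2_d x) (gl2_A x)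
     (gl2_J x *m gl2_d x *m gl2_J y + gl2_J x + gl2_J y) (gl2_B y))
  (fun z => gl2 z.1.1 z.1.2 0 z.2)
  (fun x => gl2 (gl2_d x) (invmx (gl2_IJd x) *m gl2_A x)
     (- (invmx (gl2_IJd x) *m gl2_J x)) (gl2_IdJ x *m gl2_B x)).

Definition GL : two_groupoid := TwoGroupoid GL10 GL20 GL21.

End GL.

(* The canonical isomorphism GL(l,k) -> GL(k,l).  On GL(l,k)_2 it is
   (d, A, J, B) |-> (d^T, ((I+dJ)B)^-T, -(J (I+dJ)^-1)^T,
                     ((I+Jd)^-1 A)^-T). *)
Definition GLdual0 (l k : nat) (d : GL0 l k) : GL0 k l := d^T.

Definition GLdual1 (l k : nat) (x : GL1 l k) : GL1 k l :=
  (x.1.1^T, (invmx x.2)^T, (invmx x.1.2)^T).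

Definition GLdual2 (l k : nat) (x : GL2 l k) : GL2 k l :=
  gl2 (gl2_d x)^T
    (invmx (gl2_IdJ x *m gl2_B x))^T
    (- (gl2_J x *m invmx (gl2_IdJ x)))^T
    (invmx (invmx (gl2_IJd x) *m gl2_A x))^T.

End GeneralLinear2Groupoid.

Section PBGroupoids.
Context {R : realType}.
Local Notation sspace := (@sspace R).

(* PB-groupoid over G with structural 2-groupoid L: total groupoid, projection,
   moment maps and right actions of L_2 and L_1. *)
Record pb_groupoid (A O : sspace) (G : groupoid A O)
    (L : @two_groupoid R) := PBGroupoid {
  pbA : sspace;
  pbO : sspace;
  pbP : groupoid pbA pbO;
  pb_prA : pbA -> A;
  pb_prO : pbO -> O;
  pb_momentA : pbA -> L0 L;
  pb_momentO : pbO -> L0 L;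
  pb_actA : pbA -> L2 L -> pbA;
  pb_actO : pbO -> L1 L -> pbO }.

Record pb_iso (A O : sspace) (G : groupoid A O) (L L' : two_groupoid)
    (P : pb_groupoid G L) (P' : pb_groupoid G L')
    (FA : pbA P -> pbA P') (FO : pbO P -> pbO P')
    (F0 : L0 L -> L0 L') (F1 : L1 L -> L1 L') (F2 : L2 L -> L2 L') : Prop := {
  pbiso_groupoid : groupoid_iso (pbP P) (pbP P') FA FO;
  pbiso_prA : forall p, scar p -> pb_prA (FA p) = pb_prA p;
  pbiso_prO : forall p, scar p -> pb_prO (FO p) = pb_prO p;
  pbiso_structural : two_groupoid_iso F0 F1 F2;
  pbiso_momentA : forall p, scar p -> pb_momentA (FA p) = F0 (pb_momentA p);
  pbiso_momentO : forall p, scar p -> pb_momentO (FO p) = F0 (pb_momentO p);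
  pbiso_actA : forall p x, scar p -> scar x ->
    pb_momentA p = gtgt (L20 L) x ->
    FA (pb_actA p x) = pb_actA (FA p) (F2 x);
  pbiso_actO : forall p x, scar p -> scar x ->
    pb_momentO p = gtgt (L10 L) x ->
    FO (pb_actO p x) = pb_actO (FO p) (F1 x) }.

(* Renaming the objects of a PB-groupoid along inverse bijections. *)
Definition pb_rename (A O : sspace) (G : groupoid A O) (L : two_groupoid)
    (P : pb_groupoid G L) (Q : sspace) (f : Q -> pbO P) (f' : pbO P -> Q) :
    pb_groupoid G L :=
  @PBGroupoid A O G L (pbA P) Q
    (Groupoid (fun p => f' (gsrc (pbP P) p)) (fun p => f' (gtgt (pbP P) p))
       (gmul (pbP P)) (fun q => gunit (pbP P) (f q)) (ginv (pbP P)))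
    (@pb_prA _ _ _ _ P) (fun q => pb_prO (f q))
    (@pb_momentA _ _ _ _ P) (fun q => pb_momentO (f q))
    (@pb_actA _ _ _ _ P) (fun q x => f' (pb_actO (f q) x)).

(* Fr(E) x_B Fr(E') for bundles over the same base. *)
Definition frame_pair_space (r r' : nat) (T T' B : sspace)
    (E : bundle T B) (E' : bundle T' B) : sspace :=
  subsp (X := prodsp (frame_space 'cV[R]_r E) (frame_space 'cV[R]_r' E'))
    [set f | frame_base E f.1 = frame_base E' f.2].

Section SBisectionFrames.
Context (V : @vb_groupoid R) (l k : nat).
Local Notation addA := (badd (vbA V)).
Local Notation base := (frame_base (vbA V)).

(* Frames R^l x R^k -> E_G *)
Local Notation frame := ('cV[R]_l * 'cV[R]_k -> vbEA V).

(* H (+) K is the whole fibre over g. *)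
Definition complementary (g : vbGA V) (H K : set (vbEA V)) : Prop :=
  H `&` K = [set bzero (vbA V) g] /\
  forall e, fibre (vbA V) g e <->
    exists h n, [/\ H h, K n & e = addA h n].

Definition sbisection (phi : frame) : Prop :=
  let g := base phi in
  let H := [set phi (0, v) | v in [set: 'cV[R]_k]] in
  [/\ forall w, ker_src g (phi (w, 0)),
      complementary g H (ker_src g) &
      complementary g H (ker_tgt g)].

Definition sbis_space : sspace :=
  subsp (X := frame_space ('cV[R]_l * 'cV[R]_k)%type (vbA V)) sbisection.

Definition sbis_obj : sspace := frame_pair_space l k (core V) (vbO V).

(* The matrix of (phi^b)^-1 o rho o phi^c *)
Definition anchor_matrix (f : sbis_obj) : 'M[R]_(k, l) :=
  \matrix_(i, j) frame_inv f.2 (core_anchor (f.1 (delta_mx j 0))) i 0.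

Definition sbis_tgt (phi : sbis_space) : sbis_obj :=
  (fun w => right_translation (ginv (vbG V) (base phi)) (phi (w, 0)),
   fun v => gtgt (vbE V) (phi (0, v))).

Definition sbis_d (phi : sbis_space) : 'M[R]_(k, l) :=
  anchor_matrix (sbis_tgt phi).

Definition sbis_src (phi : sbis_space) : sbis_obj :=
  (fun w => right_translation (base phi)
              (ginv (vbE V) (phi (- w, sbis_d phi *m w))),
   fun v => gsrc (vbE V) (phi (0, v))).

Definition sbis_mul (phi psi : sbis_space) : sbis_space :=
  fun x => addA (gmul (vbE V) (phi (0, x.2)) (psi (0, x.2)))
                (right_translation (base psi) (phi (x.1, 0))).

Definition sbis_unit (f : sbis_obj) : sbis_space :=
  fun x => addA (gunit (vbE V) (f.2 x.2)) (f.1 x.1).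

Definition sbis_inv (phi : sbis_space) : sbis_space :=
  fun x => ginv (vbE V) (phi (- x.1, x.2 + sbis_d phi *m x.1)).

Definition sbis_groupoid : groupoid sbis_space sbis_obj :=
  Groupoid sbis_src sbis_tgt sbis_mul sbis_unit sbis_inv.

Definition sbis_actA (phi : sbis_space) (x : L2 (GL l k)) : sbis_space :=
  fun wv => let y := x.2 *m col_mx wv.1 wv.2 in phi (usubmx y, dsubmx y).

Definition sbis_actO (f : sbis_obj) (x : L1 (GL l k)) : sbis_obj :=
  (fun w => f.1 (x.1.2 *m w), fun v => f.2 (x.2 *m v)).

(* Fr^sbis(E_G) => Fr(C) x_M Fr(E_M) *)
Definition sbis_pb : pb_groupoid (vbG V) (GL l k) :=
  @PBGroupoid (vbGA V) (vbGO V) (vbG V) (GL l k) sbis_space sbis_obj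
    sbis_groupoid
    (frame_base (vbA V)) (fun f => frame_base (vbO V) f.2)
    sbis_d anchor_matrix
    sbis_actA sbis_actO.

End SBisectionFrames.

Section Dual.
Context (V : @vb_groupoid R) (l k : nat).

(* Fr(E_M^* ) x_M Fr(C^* ) *)
Definition dual_sbis_obj : sspace :=
  frame_pair_space k l (dual_bundle (vbO V)) (dual_bundle (core V)).

(* Fr^sbis(E_G^* ) => Fr(E_M^* ) x_M Fr(C^* ), where E_M^* is identified with
   the core of E_G^* *)
Definition dual_sbis_pb : pb_groupoid (vbG V) (GL k l) :=
  pb_rename (P := sbis_pb (dual_vb_groupoid V) k l) (Q := dual_sbis_obj)
    (fun f => (fun w => to_dual_core (f.1 w), f.2))
    (fun f => (fun w => of_dual_core (f.1 w), f.2)).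

(* The canonical map: phi_g is sent to the frame
     (beta, alpha) |-> (phi_g(w, v) |-> beta . (v + d w) + alpha . w)
   of the fibre of E_G^* over g.  The functionals with alpha = 0 vanish
   on ker t~ = {phi_g(w, - d w)}, hence lie in the kernel of the source map of
   the dual; those with beta = 0 vanish on H = phi_g(0, -). *)
Definition dual_sbis (phi : sbis_space V l k) : pbA dual_sbis_pb :=
  fun x => functional (vbA V) (frame_base (vbA V) phi)
    (fun e => let wv := frame_inv phi e in
       dot x.1 (wv.2 + sbis_d phi *m wv.1) + dot x.2 wv.1).

(* (phi^c, phi^b) is sent to the pair of dual frames. *)
Definition dual_sbis_objects (f : sbis_obj V l k) : pbO dual_sbis_pb :=
  (dual_frame (vbO V) f.2, dual_frame (core V) f.1).

End Dual.

End PBGroupoids.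

(* Main.v *)
Require Import Defs.
From mathcomp Require Import all_boot all_order all_algebra.
From mathcomp Require Import all_classical all_reals all_analysis.
From mathcomp Require Import lra.

Set Implicit Arguments.
Unset Strict Implicit.
Unset Printing Implicit Defensive.

Import Order.TTheory GRing.Theory Num.Theory.
Import numFieldNormedType.Exports.

Local Open Scope classical_set_scope.
Local Open Scope ring_scope.

(** An s-bisection frame [phi] over [g] identifies the fibre of [E_G] over [g]
    with [R^l x R^k] in such a way that the whole VB-groupoid becomes explicit.
    The source of [phi (w, v)] depends on [v] only, and with [d = sbis_d phi]
    the target of [phi (w, v)] is that of [phi (0, v + d w)]; so [ker s~]
    consists of the vectors [phi (w, 0)] and [ker t~] of the vectors
    [phi (w, - d w)].  If the source of [phi] is the target of [psi], then
<<
      m~ (phi (w1, v + d w2)) (psi (w2, v)) = (phi psi) (w1 + w2, v)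
>>
    where [phi psi] is the product frame ([sbis_mulE]).  This formula describes
    all composable pairs over [(g, h)], and everything else follows from it.

    The dual frame [Xi] takes at [phi (w, v)] the value
    [b . (v + d w) + a . w] on the parameter [(b, a)].  Substituting the formula
    above into the definition of the dual product, the product of
    [Xi_phi (b1, a2 + d^T b2)] and [Xi_psi (b2, a2)] is
    [Xi_(phi psi) (b1 + b2, a2)] ([dual_mul_sbis]).  Together with the
    corresponding formula for inverses ([dual_inv_sbis]) it gives the
    compatibility with all structure maps; the source and the target of [Xi],
    which involve right translations, are obtained from the products
    [phi^-1 phi] and [phi phi^-1].  It also shows that the anchor matrix of
    [Xi] is [d^T], which is the compatibility with the moment maps.

    Conversely, an s-bisection frame [Xi] of the dual is the dual basis of a
    unique basis [chi] of the fibre of [E_G].  The s-bisection conditions say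
    that [ker t~] consists of the vectors [chi (0, w)] and that [s~] is
    injective on the vectors [chi (v, 0)]; hence there is a unique matrix [D]
    with [s~ (chi (D w, w)) = 0], and [phi (w, v) = chi (v + D w, w)] is the
    only s-bisection frame that is sent to [Xi] ([undual_sbis]).

    Smoothness is tested in local models of bundles: locally along a plot of the
    base, a bundle is a smooth family of retracts of [R^n] ([smooth_model]).
    This covers the core, which is a retract of the restriction of [E_G] to the
    units.  Coordinates in a frame and predual bases are then given by rational
    formulas, in which the only matrices to be inverted are Gram matrices of
    injective ones.

    On frames, an element [M] of [GL(l,k)_2] over [d] acts by [phi o M]; on the
    bases [chi] it acts by the conjugate of [M] by shears with parameters [d]
    and [s_20 (d, M)], and on dual bases by the inverse transpose of the latter.
    This expression of [GLdual2] ([GLdual2_shear]) is visibly multiplicative. *)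

(** * Smooth functions on open sets *)

Section SmoothCalculus.
Context {R : realType} {m : nat}.
Implicit Types U W : set 'rV[R]_m.

Lemma nbhs_eq (V : Type) U (f g : 'rV[R]_m -> V) x :
  open U -> U x -> (forall y, U y -> f y = g y) -> {near x, f =1 g}.
Proof.
move=> oU Ux fg; apply: (filterS _ (open_nbhs_nbhs (conj oU Ux))) => y Uy.
exact: fg.
Qed.

(** Differentiability is local; in [Ck] the derivative of a function is only
    controlled on [U], so that this is what makes [Ck] insensitive to the values
    taken outside [U]. *)
Lemma near_eq_differentiable (V : normedModType R) (f g : 'rV[R]_m -> V) x :
  {near x, f =1 g} -> differentiable f x -> differentiable g x.
Proof.
move=> nfg df; have fgx : f x = g x := nbhs_singleton nfg.
have [dc fE] := (diff_locallyP x f).1 df.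
have gE : g \o shift x = cst (g x) + 'd f x +o_ 0 id.
  apply/eqaddoP => e e0; move/eqaddoP/(_ e e0): fE => fE.
  have nfg0 : \forall h \near (0 : 'rV[R]_m), f (h + x) = g (h + x).
    move: nfg; rewrite (near_shift 0 x) => h0.
    by apply: filterS h0 => h /=; rewrite subr0.
  near=> h.
  have -> : (g \o shift x - (cst (g x) + 'd f x)) h =
            (f \o shift x - (cst (f x) + 'd f x)) h.
    by rewrite -fgx /GRing.add /GRing.opp /=; rewrite (near nfg0 h).
  by near: h.
have dg := diff_unique dc gE.
by apply/diff_locallyP; rewrite dg.
Unshelve. all: by end_near.
Qed.

Lemma Ck_ext (V : normedModType R) k U (f g : 'rV[R]_m -> V) :
  open U -> (forall y, U y -> f y = g y) -> Ck k U f -> Ck k U g.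
Proof.
move=> oU; elim: k f g => [|k IH] f g fg /=.
  move=> cf x Ux; rewrite -fg //.
  have gf := nbhs_eq oU Ux fg.
  exact: cvg_trans (near_eq_cvg gf) (cf x Ux).
move=> [df Df]; split => [x Ux|v].
  by apply: near_eq_differentiable (df x Ux); exact: (nbhs_eq oU Ux fg).
apply: IH (Df v) => y Uy; apply: near_eq_derive.
exact: (nbhs_eq oU Uy fg).
Qed.

Lemma Ck_restrict (V : normedModType R) k U W (f : 'rV[R]_m -> V) :
  W `<=` U -> Ck k U f -> Ck k W f.
Proof.
move=> WU; elim: k f => [|k IH] f /=; first by move=> cf x /WU; apply: cf.
by move=> [df Df]; split => [x /WU|v]; [exact: df|exact/IH/Df].
Qed.

Lemma Ck_glue (V : normedModType R) k U (f : 'rV[R]_m -> V) :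
  (forall x, U x -> exists2 W, W x & Ck k W f) -> Ck k U f.
Proof.
elim: k f => [|k IH] f h /=.
  by move=> x Ux; have [W Wx cf] := h x Ux; exact: cf.
split => [x Ux|v].
  by have [W Wx [df _]] := h x Ux; exact: df.
by apply: IH => x Ux; have [W Wx [_ Df]] := h x Ux; exists W => //; exact: Df.
Qed.

Lemma CkS (V : normedModType R) k U (f : 'rV[R]_m -> V) :
  Ck k.+1 U f <-> (forall x, U x -> differentiable f x) /\
                  (forall v, Ck k U (fun x => 'D_v f x)).
Proof. by []. Qed.

Lemma CkW (V : normedModType R) k U (f : 'rV[R]_m -> V) : Ck k.+1 U f -> Ck k U f.
Proof.
elim: k f => [|k IH] f [df Df] /=.
  by move=> x Ux; apply: differentiable_continuous (df x Ux).
by split => // v; apply: IH; apply: Df.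
Qed.

Lemma Ck_cst (V : normedModType R) k U (a : V) : Ck k U (fun=> a).
Proof.
elim: k a => [|k IH] a /=; first by move=> x _; exact: (@cvg_cst V a _ (nbhs x) _).
split => [x _|v]; first exact: (differentiable_cst a x).
have -> : (fun x => 'D_v (fun=> a) x) = (fun=> 0) :> ('rV[R]_m -> V).
  by apply/funext => x; exact: derive_cst.
exact: IH.
Qed.

Lemma CkD (V : normedModType R) k U (f g : 'rV[R]_m -> V) : open U ->
  Ck k U f -> Ck k U g -> Ck k U (fun x => f x + g x).
Proof.
move=> oU; elim: k f g => [|k IH] f g /=.
  by move=> cf cg x Ux; exact: (cvgD (cf x Ux) (cg x Ux)).
move=> [df Df] [dg Dg]; split => [x Ux|v].
  by apply: differentiableD; [exact: df|exact: dg].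
apply: Ck_ext (IH _ _ (Df v) (Dg v)) => // x Ux.
by rewrite -deriveD //; apply: diff_derivable; [exact: df|exact: dg].
Qed.

Lemma CkM k U (f g : 'rV[R]_m -> R^o) : open U ->
  Ck k U f -> Ck k U g -> Ck k U (fun x => f x * g x : R^o).
Proof.
move=> oU; elim: k f g => [|k IH] f g.
  by move=> /= cf cg x Ux; exact: (cvgM (cf x Ux) (cg x Ux)).
move=> Cf Cg; have /CkS[df Df] := Cf; have /CkS[dg Dg] := Cg; split => [x Ux|v].
  by apply: differentiableM; [exact: df|exact: dg].
apply: (@Ck_ext _ _ _ (fun x => f x * 'D_v g x + g x * 'D_v f x : R^o)) => //.
  by move=> x Ux; rewrite [RHS](deriveM (diff_derivable (df x Ux)) (diff_derivable (dg x Ux))).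
by apply: CkD => //; apply: IH => //; exact: CkW.
Qed.

Lemma CkV k U (f : 'rV[R]_m -> R^o) : open U -> (forall x, U x -> f x != 0) ->
  Ck k U f -> Ck k U (fun x => (f x)^-1 : R^o).
Proof.
move=> oU f0; elim: k => [|k IH].
  by move=> /= cf x Ux; exact: (cvgV (f0 x Ux) (cf x Ux)).
move=> Cf; have /CkS[df Df] := Cf; split => [x Ux|v].
  by apply: differentiableV; [exact: df|exact: f0].
have Ci : Ck k U (fun x => (f x)^-1 : R^o) by apply: IH; exact: CkW.
apply: (@Ck_ext _ _ _ (fun x => (-1) * ((f x)^-1 * (f x)^-1 * 'D_v f x) : R^o)) => //.
  move=> x Ux; rewrite [RHS](deriveV (f0 x Ux) (diff_derivable (df x Ux))).
  by rewrite expr2 invfM scaleNr mulN1r.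
apply: CkM => //; first exact: Ck_cst.
by apply: CkM => //; apply: CkM.
Qed.

Lemma cvg_finsum (V : normedModType R) n (f : 'I_n -> 'rV[R]_m -> V) x :
  (forall i, f i @ x --> f i x) ->
  (\sum_i f i y) @[y --> x] --> \sum_i f i x.
Proof.
elim: n f => [|n IH] f cf.
  rewrite big_ord0; under eq_fun do rewrite big_ord0.
  exact: (@cvg_cst V 0 _ (nbhs x) _).
rewrite big_ord_recr; under eq_fun do rewrite big_ord_recr.
exact: (cvgD (IH _ (fun i => cf _)) (cf ord_max)).
Qed.

(** Continuity and differentiability of a matrix-valued map follow from those of its entries
    by the expansion on the elementary matrices; the derivative itself is
    computed entrywise. *)
Lemma Ck_mxP k U (a b : nat) (f : 'rV[R]_m -> 'M[R]_(a, b)) : open U ->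
  Ck k U f <-> forall i j, Ck k U (fun x => f x i j : R^o).
Proof.
move=> oU; elim: k f => [|k IH] f; split.
- move=> /= cf i j x Ux.
  apply: (@cvg_comp _ _ _ f (fun M => M i j : R^o) _ _ _ (cf x Ux)).
  exact: coord_continuous.
- move=> /= cf x Ux.
  have fE y : f y = \sum_i \sum_j f y i j *: delta_mx i j.
    exact: matrix_sum_delta.
  have -> : f = fun y => \sum_i \sum_j f y i j *: delta_mx i j by exact/funext.
  apply: cvg_finsum => i; apply: cvg_finsum => j.
  exact: (@cvgZr_tmp R 'M[R]_(a, b) _ (nbhs x) _ (fun y => f y i j : R^o) _
            (delta_mx i j) (cf i j x Ux)).
- move=> /CkS[df Df] i j; apply/CkS; split=> [x Ux|v].
    exact: (differentiable_comp (df x Ux) (differentiable_coord _ _ _)).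
  apply: Ck_ext ((IH _).1 (Df v) i j) => // x Ux.
  by rewrite derive_mx ?mxE //; exact: diff_derivable (df x Ux).
- move=> cf.
  have df x : U x -> differentiable f x.
    move=> Ux.
    have -> : f = \sum_i \sum_j (fun x => f x i j *: delta_mx i j).
      apply/funext => y; rewrite {1}[f y]matrix_sum_delta fct_sumE.
      by apply: eq_bigr => i _; rewrite fct_sumE.
    apply: differentiable_sum => i; apply: differentiable_sum => j.
    by apply: differentiableZl; have /CkS[dfij _] := cf i j; exact: dfij.
  apply/CkS; split=> // v; apply/IH => i j.
  have /CkS[_ Df] := cf i j; apply: Ck_ext (Df v) => // x Ux.
  by rewrite derive_mx ?mxE //; exact: diff_derivable (df x Ux).
Qed.

Lemma Cinfty_ext (V : normedModType R) U (f g : 'rV[R]_m -> V) :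
  open U -> (forall y, U y -> f y = g y) -> Cinfty U f -> Cinfty U g.
Proof. by move=> oU fg Cf k; exact: Ck_ext (Cf k). Qed.

Lemma Cinfty_restrict (V : normedModType R) U W (f : 'rV[R]_m -> V) :
  W `<=` U -> Cinfty U f -> Cinfty W f.
Proof. by move=> WU Cf k; exact: Ck_restrict (Cf k). Qed.

Lemma Cinfty_glue (V : normedModType R) U (f : 'rV[R]_m -> V) :
  (forall x, U x -> exists2 W, W x & Cinfty W f) -> Cinfty U f.
Proof.
move=> h k; apply: Ck_glue => x Ux.
by have [W Wx Cf] := h x Ux; exists W.
Qed.

Lemma Cinfty_cst (V : normedModType R) U (a : V) : Cinfty U (fun=> a).
Proof. by move=> k; exact: Ck_cst. Qed.

Section OnOpen.
Variables (U : set 'rV[R]_m) (oU : open U).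

Lemma CinftyD (V : normedModType R) (f g : 'rV[R]_m -> V) :
  Cinfty U f -> Cinfty U g -> Cinfty U (fun x => f x + g x).
Proof. by move=> Cf Cg k; exact: CkD. Qed.

Lemma CinftyM (f g : 'rV[R]_m -> R^o) :
  Cinfty U f -> Cinfty U g -> Cinfty U (fun x => f x * g x : R^o).
Proof. by move=> Cf Cg k; exact: CkM. Qed.

Lemma CinftyV (f : 'rV[R]_m -> R^o) : (forall x, U x -> f x != 0) ->
  Cinfty U f -> Cinfty U (fun x => (f x)^-1 : R^o).
Proof. by move=> f0 Cf k; exact: CkV. Qed.

Lemma Cinfty_mxP (a b : nat) (f : 'rV[R]_m -> 'M[R]_(a, b)) :
  Cinfty U f <-> forall i j, Cinfty U (fun x => f x i j : R^o).
Proof.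
split=> [Cf i j k|Cf k]; last by apply/Ck_mxP => // i j; exact: Cf.
by have /(Ck_mxP k _ oU) := Cf k; exact.
Qed.

Lemma Cinfty_sum (I : Type) (r : seq I) (P : pred I) (f : I -> 'rV[R]_m -> R^o) :
  (forall i, Cinfty U (f i)) ->
  Cinfty U (fun x => \sum_(i <- r | P i) f i x : R^o).
Proof.
move=> Cf; elim: r => [|i r IH].
  apply: (@Cinfty_ext R^o _ (fun=> 0)) => [||]; first exact: oU.
    by move=> x _; rewrite big_nil.
  exact: Cinfty_cst.
apply: (@Cinfty_ext R^o _ (fun x => (if P i then f i x else 0)
                            + \sum_(i <- r | P i) f i x)); first exact: oU.
  by move=> x _; rewrite big_cons; case: (P i); rewrite ?add0r.
by apply: CinftyD IH; case: (P i); [exact: Cf|exact: Cinfty_cst].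
Qed.

Lemma Cinfty_prod (I : Type) (r : seq I) (P : pred I) (f : I -> 'rV[R]_m -> R^o) :
  (forall i, Cinfty U (f i)) ->
  Cinfty U (fun x => \prod_(i <- r | P i) f i x : R^o).
Proof.
move=> Cf; elim: r => [|i r IH].
  apply: (@Cinfty_ext R^o _ (fun=> 1)) => [||]; first exact: oU.
    by move=> x _; rewrite big_nil.
  exact: Cinfty_cst.
apply: (@Cinfty_ext R^o _ (fun x => (if P i then f i x else 1)
                            * \prod_(i <- r | P i) f i x)); first exact: oU.
  by move=> x _; rewrite big_cons; case: (P i); rewrite ?mul1r.
by apply: CinftyM IH; case: (P i); [exact: Cf|exact: Cinfty_cst].
Qed.

Lemma Cinfty_mulmx (a b c : nat) (f : 'rV[R]_m -> 'M[R]_(a, b))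
    (g : 'rV[R]_m -> 'M[R]_(b, c)) :
  Cinfty U f -> Cinfty U g -> Cinfty U (fun x => f x *m g x).
Proof.
move=> /Cinfty_mxP Cf /Cinfty_mxP Cg; apply/Cinfty_mxP => i j.
apply: (@Cinfty_ext R^o _ (fun x => \sum_k f x i k * g x k j)) => //.
  by move=> x _; rewrite mxE.
by apply: Cinfty_sum => k; apply: CinftyM.
Qed.

Lemma Cinfty_reindex (a b a' b' : nat) (h : 'I_a' -> 'I_b' -> 'I_a * 'I_b)
    (f : 'rV[R]_m -> 'M[R]_(a, b)) (g : 'rV[R]_m -> 'M[R]_(a', b')) :
  (forall x i j, g x i j = f x (h i j).1 (h i j).2) -> Cinfty U f -> Cinfty U g.
Proof.
move=> gE /Cinfty_mxP Cf; apply/Cinfty_mxP => i j.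
by apply: (Cinfty_ext oU) (Cf (h i j).1 (h i j).2) => x _; rewrite gE.
Qed.

Lemma Cinfty_tr (a b : nat) (f : 'rV[R]_m -> 'M[R]_(a, b)) :
  Cinfty U f -> Cinfty U (fun x => (f x)^T).
Proof. by apply: (Cinfty_reindex (h := fun i j => (j, i))) => x i j; rewrite mxE. Qed.

Lemma CinftyN (a b : nat) (f : 'rV[R]_m -> 'M[R]_(a, b)) :
  Cinfty U f -> Cinfty U (fun x => - f x).
Proof.
move=> Cf; apply: (@Cinfty_ext _ _ (fun x => (-1)%:M *m f x)) => //.
  by move=> x _; rewrite mul_scalar_mx scaleN1r.
by apply: Cinfty_mulmx => //; exact: Cinfty_cst.
Qed.

Lemma Cinfty_usubmx (a a' b : nat) (f : 'rV[R]_m -> 'M[R]_(a + a', b)) :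
  Cinfty U f -> Cinfty U (fun x => usubmx (f x)).
Proof.
by apply: (Cinfty_reindex (h := fun i j => (lshift a' i, j))) => x i j; rewrite mxE.
Qed.

Lemma Cinfty_dsubmx (a a' b : nat) (f : 'rV[R]_m -> 'M[R]_(a + a', b)) :
  Cinfty U f -> Cinfty U (fun x => dsubmx (f x)).
Proof.
by apply: (Cinfty_reindex (h := fun i j => (rshift a i, j))) => x i j; rewrite mxE.
Qed.

Lemma Cinfty_lsubmx (a b b' : nat) (f : 'rV[R]_m -> 'M[R]_(a, b + b')) :
  Cinfty U f -> Cinfty U (fun x => lsubmx (f x)).
Proof.
by apply: (Cinfty_reindex (h := fun i j => (i, lshift b' j))) => x i j; rewrite mxE.
Qed.

Lemma Cinfty_rsubmx (a b b' : nat) (f : 'rV[R]_m -> 'M[R]_(a, b + b')) :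
  Cinfty U f -> Cinfty U (fun x => rsubmx (f x)).
Proof.
by apply: (Cinfty_reindex (h := fun i j => (i, rshift b j))) => x i j; rewrite mxE.
Qed.

Lemma Cinfty_row_mx (a b b' : nat) (f : 'rV[R]_m -> 'M[R]_(a, b))
    (g : 'rV[R]_m -> 'M[R]_(a, b')) :
  Cinfty U f -> Cinfty U g -> Cinfty U (fun x => row_mx (f x) (g x)).
Proof.
move=> /Cinfty_mxP Cf /Cinfty_mxP Cg; apply/Cinfty_mxP => i j.
case: (split_ordP j) => j' ->.
  by apply: (Cinfty_ext oU) (Cf i j') => x _; rewrite row_mxEl.
by apply: (Cinfty_ext oU) (Cg i j') => x _; rewrite row_mxEr.
Qed.

Lemma Cinfty_col_mx (a a' b : nat) (f : 'rV[R]_m -> 'M[R]_(a, b))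
    (g : 'rV[R]_m -> 'M[R]_(a', b)) :
  Cinfty U f -> Cinfty U g -> Cinfty U (fun x => col_mx (f x) (g x)).
Proof.
move=> /Cinfty_mxP Cf /Cinfty_mxP Cg; apply/Cinfty_mxP => i j.
case: (split_ordP i) => i' ->.
  by apply: (Cinfty_ext oU) (Cf i' j) => x _; rewrite col_mxEu.
by apply: (Cinfty_ext oU) (Cg i' j) => x _; rewrite col_mxEd.
Qed.

Lemma Cinfty_det (a : nat) (f : 'rV[R]_m -> 'M[R]_a) :
  Cinfty U f -> Cinfty U (fun x => \det (f x) : R^o).
Proof.
move=> /Cinfty_mxP Cf; apply: Cinfty_sum => s; apply: CinftyM.
  exact: Cinfty_cst.
by apply: Cinfty_prod => i; exact: Cf.
Qed.

(** By Cramer's rule, the entries of the inverse are quotients of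
    polynomials in the entries. *)
Lemma Cinfty_invmx (a : nat) (f : 'rV[R]_m -> 'M[R]_a) :
  (forall x, U x -> f x \in unitmx) -> Cinfty U f ->
  Cinfty U (fun x => invmx (f x)).
Proof.
move=> uf Cf; apply/Cinfty_mxP => i j.
apply: (@Cinfty_ext R^o _ (fun x => (\det (f x))^-1 *
    ((-1) ^+ (j + i) * \det (row' j (col' i (f x)))))) => //.
  by move=> x Ux; rewrite /invmx uf // !mxE.
apply: CinftyM.
  apply: CinftyV; last exact: Cinfty_det.
  by move=> x /uf; rewrite unitmxE unitfE.
apply: CinftyM; first exact: Cinfty_cst.
apply: Cinfty_det.
by apply: (Cinfty_reindex (h := fun p q => (lift j p, lift i q))) Cf => x p q;
  rewrite !mxE.
Qed.

Lemma Cinfty_dot (r : nat) (f g : 'rV[R]_m -> 'cV[R]_r) :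
  Cinfty U f -> Cinfty U g -> Cinfty U (fun x => dot (f x) (g x) : R^o).
Proof.
move=> Cf Cg; have /Cinfty_mxP := Cinfty_mulmx (Cinfty_tr Cf) Cg; exact.
Qed.

End OnOpen.
End SmoothCalculus.

(** * Linear algebra *)

Section LinearAlgebra.
Context {R : realType}.

Lemma dotDl r (a b c : 'cV[R]_r) : dot (a + b) c = dot a c + dot b c.
Proof. by rewrite /dot linearD mulmxDl mxE. Qed.

Lemma dotDr r (a b c : 'cV[R]_r) : dot a (b + c) = dot a b + dot a c.
Proof. by rewrite /dot mulmxDr mxE. Qed.

Lemma dotZl r x (a b : 'cV[R]_r) : dot (x *: a) b = x * dot a b.
Proof. by rewrite /dot linearZ -scalemxAl mxE. Qed.

Lemma dotZr r x (a b : 'cV[R]_r) : dot a (x *: b) = x * dot a b.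
Proof. by rewrite /dot -scalemxAr mxE. Qed.

Lemma dotNl r (a b : 'cV[R]_r) : dot (- a) b = - dot a b.
Proof. by rewrite -scaleN1r dotZl mulN1r. Qed.

Lemma dotNr r (a b : 'cV[R]_r) : dot a (- b) = - dot a b.
Proof. by rewrite -scaleN1r dotZr mulN1r. Qed.

Lemma dot0l r (a : 'cV[R]_r) : dot 0 a = 0.
Proof. by rewrite -(scale0r 0) dotZl mul0r. Qed.

Lemma dot0r r (a : 'cV[R]_r) : dot a 0 = 0.
Proof. by rewrite -(scale0r 0) dotZr mul0r. Qed.

Lemma dotC r (a b : 'cV[R]_r) : dot a b = dot b a.
Proof. by rewrite /dot -[a^T *m b]trmxK trmx_mul trmxK mxE. Qed.

Lemma dot_mulmx r s (M : 'M[R]_(r, s)) (a : 'cV[R]_r) b :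
  dot a (M *m b) = dot (M^T *m a) b.
Proof. by rewrite /dot trmx_mul trmxK mulmxA. Qed.

Lemma dot_col_mx r s (a b : 'cV[R]_r) (a' b' : 'cV[R]_s) :
  dot (col_mx a a') (col_mx b b') = dot a b + dot a' b'.
Proof. by rewrite /dot tr_col_mx mul_row_col mxE. Qed.

Lemma dot_delta r (i : 'I_r) (b : 'cV[R]_r) : dot (delta_mx i 0) b = b i 0.
Proof. by rewrite /dot trmx_delta -rowE mxE. Qed.

Lemma dot_eq0 r (a : 'cV[R]_r) : dot a a = 0 -> a = 0.
Proof.
rewrite /dot mxE => /psumr_eq0P a0; apply/colP => i; rewrite [RHS]mxE.
have /(_ i isT) : forall j, true -> a^T 0 j * a j 0 = 0.
  by apply: a0 => j _; rewrite mxE -expr2 sqr_ge0.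
by rewrite mxE -expr2 => /eqP; rewrite sqrf_eq0 => /eqP.
Qed.

Lemma dot_inj r (a b : 'cV[R]_r) : (forall c, dot a c = dot b c) -> a = b.
Proof. by move=> ab; apply/colP => i; rewrite -!dot_delta dotC ab dotC. Qed.

Lemma unitmx_inj r (A : 'M[R]_r) :
  (forall v : 'cV[R]_r, A *m v = 0 -> v = 0) -> A \in unitmx.
Proof.
move=> A0; rewrite -unitmx_tr -row_free_unit -kermx_eq0; apply/eqP/row_matrixP => i.
rewrite row0 -[LHS]trmxK -[RHS]trmx0; congr (_^T); apply: A0.
by rewrite -{1}[A]trmxK -trmx_mul -row_mul mulmx_ker row0 trmx0.
Qed.

(** The Gram matrix of a real matrix with trivial kernel is invertible, because
    [A^T A v = 0] forces [|A v|^2 = 0]. *)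
Lemma unitmx_gram r s (A : 'M[R]_(r, s)) :
  (forall v : 'cV[R]_s, A *m v = 0 -> v = 0) -> A^T *m A \in unitmx.
Proof.
move=> A0; apply: unitmx_inj => v /(congr1 (dot v)).
rewrite dot0r -mulmxA dot_mulmx trmxK => /dot_eq0; exact: A0.
Qed.

(** Only the linear combination [a *: v + w] is assumed to be respected, as in the
    definition of frames. *)
Lemma linear_dot r (f : 'cV[R]_r -> R) :
  (forall a v w, f (a *: v + w) = a * f v + f w) ->
  forall v, f v = dot (\col_i f (delta_mx i 0)) v.
Proof.
move=> fL v.
have f0 : f 0 = 0.
  by have := fL 1 0 0; rewrite scale1r addr0 mul1r -[LHS]addr0 => /addrI.
have fsum (I : Type) (s : seq I) (c : I -> R) (w : I -> 'cV_r) :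
    f (\sum_(i <- s) c i *: w i) = \sum_(i <- s) c i * f (w i).
  by elim: s => [|i s IH]; rewrite ?big_nil // !big_cons fL IH.
rewrite {1}[v]matrix_sum_delta.
under eq_bigr do rewrite big_ord1.
by rewrite fsum /dot mxE; apply: eq_bigr => i _; rewrite !mxE mulrC.
Qed.

End LinearAlgebra.

Section MatrixFacts.
Context {F : fieldType}.

Lemma invmx_mul n (A B : 'M[F]_n) : A \in unitmx -> B \in unitmx ->
  invmx (A *m B) = invmx B *m invmx A.
Proof.
move=> uA uB; have uAB : A *m B \in unitmx by rewrite unitmx_mul uA.
apply: (can_inj (mulKmx uAB)).
by rewrite mulmxV // -mulmxA (mulmxA B) mulmxV // mul1mx mulmxV.
Qed.

Lemma invmx_unique n (A B : 'M[F]_n) : A *m B = 1%:M -> invmx A = B.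
Proof.
move=> AB; have [uA _] := mulmx1_unit AB.
by apply: (can_inj (mulKmx uA)); rewrite mulmxV.
Qed.

(** The push-through identities between [1 + J d] and [1 + d J], which are
    invertible together. *)
Section Sylvester.
Context l k (d : 'M[F]_(k, l)) (J : 'M[F]_(l, k)).
Hypothesis uP : 1%:M + d *m J \in unitmx.
Local Notation P := (1%:M + d *m J).
Local Notation Q := (1%:M + J *m d).

Lemma sylvester_mulV : Q *m (1%:M - J *m invmx P *m d) = 1%:M.
Proof.
have QJ : Q *m J = J *m P by rewrite mulmxDl mulmxDr mul1mx mulmx1 mulmxA.
rewrite mulmxBr mulmx1 !mulmxA QJ -(mulmxA J) mulmxV // mulmx1.
by rewrite addrK.
Qed.

Lemma sylvester_unit : Q \in unitmx.
Proof. by have [] := mulmx1_unit sylvester_mulV. Qed.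

Lemma sylvester_inv : invmx Q = 1%:M - J *m invmx P *m d.
Proof. exact: invmx_unique sylvester_mulV. Qed.

Lemma sylvester_commute : Q *m J = J *m P.
Proof. by rewrite mulmxDl mulmxDr mul1mx mulmx1 mulmxA. Qed.

Lemma sylvester_commute_inv : invmx Q *m J = J *m invmx P.
Proof.
apply: (can_inj (mulKmx sylvester_unit)).
by rewrite mulKVmx ?sylvester_unit // mulmxA sylvester_commute mulmxK.
Qed.

End Sylvester.
End MatrixFacts.

(** * The isomorphism between the general linear 2-groupoids *)

Section GLdual.
Context {R : realType} (l k : nat).
Implicit Types (d e : 'M[R]_(k, l)) (A : 'M[R]_l) (J : 'M[R]_(l, k)) (B : 'M[R]_k).

Lemma gl2_dE d A J B : gl2_d (gl2 d A J B) = d. Proof. by []. Qed.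
Lemma gl2_AE d A J B : gl2_A (gl2 d A J B) = A.
Proof. exact: block_mxKul. Qed.
Lemma gl2_BE d A J B : gl2_B (gl2 d A J B) = B.
Proof. exact: block_mxKdr. Qed.
Lemma gl2_JE d A J B : B \in unitmx -> gl2_J (gl2 d A J B) = J.
Proof. by move=> uB; rewrite /gl2_J gl2_BE block_mxKur mulmxK. Qed.
Lemma gl2_IdJE d A J B : B \in unitmx -> gl2_IdJ (gl2 d A J B) = 1%:M + d *m J.
Proof. by move=> uB; rewrite /gl2_IdJ gl2_JE. Qed.
Lemma gl2_IJdE d A J B : B \in unitmx -> gl2_IJd (gl2 d A J B) = 1%:M + J *m d.
Proof. by move=> uB; rewrite /gl2_IJd gl2_JE. Qed.
Definition gl2E := (gl2_dE, gl2_AE, gl2_BE, gl2_JE, gl2_IdJE, gl2_IJdE).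

Lemma ublock_unit a b (A : 'M[R]_a) (X : 'M[R]_(a, b)) (B : 'M[R]_b) :
  (block_mx A X 0 B \in unitmx) = (A \in unitmx) && (B \in unitmx).
Proof. by rewrite !unitmxE det_ublock unitrM. Qed.

Lemma GL2_intro d A J B : A \in unitmx -> B \in unitmx ->
  1%:M + d *m J \in unitmx -> scar (s := @GL2 R l k) (gl2 d A J B).
Proof.
move=> uA uB uP; split=> //; rewrite /= !gl2E //; split=> //.
- by rewrite ublock_unit uA.
- by rewrite block_mxKdl.
- exact: sylvester_unit.
Qed.

Lemma GL2_elim (x : gl2_space l k) : scar (s := @GL2 R l k) x ->
  exists d A J B, [/\ x = gl2 d A J B, A \in unitmx, B \in unitmx,
    1%:M + d *m J \in unitmx & 1%:M + J *m d \in unitmx].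
Proof.
move=> [_ [uM dl uQ uP]]; exists (gl2_d x), (gl2_A x), (gl2_J x), (gl2_B x).
move: (uM); rewrite -{1}[x.2]submxK dl ublock_unit => /andP[uA uB].
split=> //; case: x {uP uQ} uM dl uA uB => d M /= uM dl uA uB.
by rewrite /gl2 /gl2_J mulmxKV // -{1}[M]submxK dl.
Qed.

(** If [d] is the anchor matrix of a frame [phi], then [phi o shear_mx d] is the
    frame [chi] of the opening comment, up to the order of the two blocks: it
    sends [(w, v)] to [phi (w, v - d w)]. *)
Definition shear_mx d : 'M[R]_(l + k) := block_mx 1%:M 0 (- d) 1%:M.

Lemma shear_mxN d : shear_mx (- d) *m shear_mx d = 1%:M.
Proof.
rewrite /shear_mx mulmx_block opprK !mul0mx !mulmx0 !mul1mx !mulmx1 !addr0 add0r.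
by rewrite addrN -scalar_mx_block.
Qed.

Lemma shear_mx_unit d : shear_mx d \in unitmx.
Proof. by have [] := mulmx1_unit (shear_mxN d). Qed.

Lemma shear_mx_mul d e A J B :
  shear_mx (- d) *m block_mx A (J *m B) 0 B *m shear_mx e =
  block_mx (A - J *m B *m e) (J *m B)
    (d *m A - (1%:M + d *m J) *m B *m e) ((1%:M + d *m J) *m B).
Proof.
rewrite /shear_mx !mulmx_block opprK !mul0mx !mulmx0 !mul1mx !mulmx1 !addr0 !add0r.
rewrite !mulmxN; congr block_mx; rewrite ?mulmxDl ?mul1mx ?mulmxA.
  by rewrite [B *m e + _]addrC.
by rewrite addrC.
Qed.

(** The transpose of [N], with the two summands exchanged in the source
    and in the target. *)
Definition swap_tr a b (N : 'M[R]_(a + b)) : 'M[R]_(b + a) :=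
  block_mx (drsubmx N)^T (ursubmx N)^T (dlsubmx N)^T (ulsubmx N)^T.

Lemma swap_tr_mul a b (N N' : 'M[R]_(a + b)) :
  swap_tr (N *m N') = swap_tr N' *m swap_tr N.
Proof.
rewrite -{1}[N]submxK -{1}[N']submxK mulmx_block /swap_tr mulmx_block.
rewrite block_mxKul block_mxKur block_mxKdl block_mxKdr.
by congr block_mx; rewrite linearD /= !trmx_mul addrC.
Qed.

Lemma swap_tr1 a b : swap_tr (1%:M : 'M[R]_(a + b)) = 1%:M.
Proof.
rewrite /swap_tr scalar_mx_block block_mxKul block_mxKur block_mxKdl block_mxKdr.
by rewrite !trmx1 !trmx0 -scalar_mx_block.
Qed.

Lemma swap_tr_inv a b (N : 'M[R]_(a + b)) : N \in unitmx ->
  invmx (swap_tr N) = swap_tr (invmx N).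
Proof. by move=> uN; apply: invmx_unique; rewrite -swap_tr_mul mulVmx // swap_tr1. Qed.

Lemma swap_tr_col a b (N : 'M[R]_(a + b)) (x : 'cV[R]_a) (y : 'cV[R]_b) :
  swap_tr N *m col_mx y x =
  col_mx (dsubmx (N^T *m col_mx x y)) (usubmx (N^T *m col_mx x y)).
Proof.
rewrite -{2 3}[N]submxK tr_block_mx !mul_block_col col_mxKu col_mxKd.
by congr col_mx; rewrite addrC.
Qed.

Lemma invmx_ublock a b (E : 'M[R]_a) (X : 'M[R]_(a, b)) (G : 'M[R]_b) :
  E \in unitmx -> G \in unitmx ->
  invmx (block_mx E X 0 G) =
  block_mx (invmx E) (- (invmx E *m X *m invmx G)) 0 (invmx G).
Proof.
move=> uE uG; apply: invmx_unique.
rewrite mulmx_block !mul0mx !mulmx0 !addr0 !mulmxV // add0r mulmxN !mulmxA mulmxV //.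
by rewrite mul1mx addNr -scalar_mx_block.
Qed.

(** The conjugate of [M] by the shears is block upper triangular exactly when [e] is
    the source of [(d, M)]; then its diagonal blocks are [(1 + J d)^-1 A] and
    [(1 + d J) B], and its inverse can be compared with the definition of
    [GLdual2].  The hypotheses on [M] do not mention [J]; they are stable under
    products and inverses, where the invertibility of [1 + d J] is not obvious. *)
Lemma GLdual2_shear d e (M : 'M[R]_(l + k)) : M \in unitmx -> dlsubmx M = 0 ->
  dlsubmx (shear_mx (- d) *m M *m shear_mx e) = 0 ->
  [/\ scar (s := @GL2 R l k) (d, M), gl2_s20 ((d, M) : gl2_space l k) = e &
      GLdual2 ((d, M) : GL2 l k) =
        (d^T, swap_tr (invmx (shear_mx (- d) *m M *m shear_mx e)))].
Proof.
move=> uM dl; move: (uM); rewrite -[M]submxK dl ublock_unit => /andP[].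
move: (ulsubmx M) (drsubmx M) (ursubmx M) => A B X uA uB.
have [J ->] : exists J, X = J *m B by exists (X *m invmx B); rewrite mulmxKV.
rewrite shear_mx_mul block_mxKdl => /eqP; rewrite subr_eq0 => /eqP dA.
have uK : shear_mx (- d) *m block_mx A (J *m B) 0 B *m shear_mx e \in unitmx.
  by rewrite !unitmx_mul !shear_mx_unit ublock_unit uA uB.
move: uK; rewrite shear_mx_mul dA subrr ublock_unit => /andP[uE uF].
have uP : 1%:M + d *m J \in unitmx by move: uF; rewrite unitmx_mul => /andP[].
have uQ := sylvester_unit uP.
have QE : (1%:M + J *m d) *m (A - J *m B *m e) = A.
  have QJ : (1%:M + J *m d) *m (J *m B *m e) = J *m d *m A.
    by rewrite -(mulmxA J d A) dA !mulmxA sylvester_commute.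
  by rewrite mulmxBr QJ mulmxDl mul1mx addrK.
have EE : A - J *m B *m e = invmx (1%:M + J *m d) *m A by rewrite -{2}QE mulKmx.
split.
- exact: GL2_intro.
- rewrite /gl2_s20 -/(gl2 d A J B) !gl2E // -mulmxA dA mulmxA mulVmx // mul1mx //.
- rewrite -/(gl2 d A J B) /GLdual2 !gl2E // {1}/gl2; congr pair.
  rewrite invmx_ublock // /swap_tr block_mxKul block_mxKur block_mxKdl block_mxKdr.
  rewrite trmx0 -EE; congr block_mx; rewrite -trmx_mul; congr (_^T).
  by rewrite mulmxN invmx_mul // !mulmxA mulmxK.
Qed.

Lemma GL2_shear x : scar (s := @GL2 R l k) x ->
  [/\ x.2 \in unitmx, dlsubmx x.2 = 0 &
    dlsubmx (shear_mx (- x.1) *m x.2 *m shear_mx (gl2_s20 x)) = 0].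
Proof.
move=> /GL2_elim [d [A [J [B [-> uA uB uP uQ]]]]] /=; split.
- by rewrite ublock_unit uA.
- by rewrite block_mxKdl.
- rewrite shear_mx_mul block_mxKdl /gl2_s20 !gl2E //.
  by rewrite -(mulmxA (invmx _)) mulKVmx ?subrr // unitmx_mul uP.
Qed.

Lemma GLdual2E x : scar (s := @GL2 R l k) x ->
  @GLdual2 R l k x =
  (x.1^T, swap_tr (invmx (shear_mx (- x.1) *m x.2 *m shear_mx (gl2_s20 x)))).
Proof.
case: x => d M hx; have [uM dl dl'] := GL2_shear hx.
by have [] := GLdual2_shear uM dl dl'.
Qed.

End GLdual.

Section GLdualIso.
Context {R : realType}.

Section DualParameters.
Context (l k : nat).
Implicit Types (d e : 'M[R]_(k, l)) (A : 'M[R]_l) (J : 'M[R]_(l, k)) (B : 'M[R]_k).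

Section At.
Context d A J B (uA : A \in unitmx) (uB : B \in unitmx)
  (uP : 1%:M + d *m J \in unitmx).
Local Notation P := (1%:M + d *m J).
Local Notation Q := (1%:M + J *m d).
Let uQ : Q \in unitmx := sylvester_unit uP.

Definition dual_A : 'M[R]_k := (invmx (P *m B))^T.
Definition dual_J : 'M[R]_(k, l) := (- (J *m invmx P))^T.
Definition dual_B : 'M[R]_l := (invmx (invmx Q *m A))^T.

Lemma GLdual2_gl2 : @GLdual2 R l k (gl2 d A J B) = gl2 d^T dual_A dual_J dual_B.
Proof. by rewrite /GLdual2 !gl2E. Qed.

Lemma dual_A_unit : dual_A \in unitmx.
Proof. by rewrite unitmx_tr unitmx_inv unitmx_mul uP. Qed.

Lemma dual_B_unit : dual_B \in unitmx.
Proof. by rewrite unitmx_tr unitmx_inv unitmx_mul unitmx_inv uQ. Qed.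

Lemma dual_P : 1%:M + d^T *m dual_J = (invmx Q)^T.
Proof.
by rewrite (sylvester_inv uP) linearB /= trmx1 /dual_J -trmx_mul mulNmx linearN.
Qed.

Lemma dual_Q : 1%:M + dual_J *m d^T = (invmx P)^T.
Proof.
have -> : invmx (1%:M + d *m J) = 1%:M - d *m J *m invmx (1%:M + d *m J).
  apply: (can_inj (mulmxK uP)).
  by rewrite mulVmx // mulmxBl mul1mx mulmxKV // addrK.
by rewrite linearB /= trmx1 /dual_J -trmx_mul mulmxN linearN mulmxA.
Qed.

Lemma dual_P_unit : 1%:M + d^T *m dual_J \in unitmx.
Proof. by rewrite dual_P unitmx_tr unitmx_inv. Qed.

Lemma dual_PB : (1%:M + d^T *m dual_J) *m dual_B = (invmx A)^T.
Proof.
rewrite dual_P /dual_B -trmx_mul invmx_mul ?unitmx_inv // invmxK.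
by rewrite mulmxK.
Qed.

Lemma dual_QA : invmx (1%:M + dual_J *m d^T) *m dual_A = (invmx B)^T.
Proof.
rewrite dual_Q /dual_A -trmx_inv invmxK -trmx_mul invmx_mul //.
by rewrite mulmxKV.
Qed.

Lemma GLdual2_car_gl2 : scar (s := @GL2 R k l) (@GLdual2 R l k (gl2 d A J B)).
Proof.
rewrite GLdual2_gl2; apply: GL2_intro; [exact: dual_A_unit|exact: dual_B_unit|].
exact: dual_P_unit.
Qed.

Lemma GLdual2_s20_gl2 :
  gl2_s20 (@GLdual2 R l k (gl2 d A J B)) = (gl2_s20 (gl2 d A J B))^T.
Proof.
rewrite GLdual2_gl2 /gl2_s20 !gl2E ?dual_B_unit // dual_PB -trmx_inv invmxK.
by rewrite /dual_A -!trmx_mul mulmxA.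
Qed.

End At.
End DualParameters.

Section Diffeomorphisms.
Context (l k : nat).
Implicit Types (d e : 'M[R]_(k, l)) (A : 'M[R]_l) (J : 'M[R]_(l, k)) (B : 'M[R]_k).

Lemma GLdual2K_gl2 d A J B : A \in unitmx -> B \in unitmx ->
  1%:M + d *m J \in unitmx ->
  @GLdual2 R k l (@GLdual2 R l k (gl2 d A J B)) = gl2 d A J B.
Proof.
move=> uA uB uP; rewrite (GLdual2_gl2 d A J uB) GLdual2_gl2 ?dual_B_unit //.
congr gl2.
- exact: trmxK.
- by rewrite /dual_A dual_PB // -trmx_inv invmxK trmxK.
- rewrite {1}/dual_J dual_P // -trmx_inv invmxK /dual_J -trmx_mul linearN /= trmxK.
  by rewrite mulmxN opprK mulmxA sylvester_commute mulmxK.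
- by rewrite {1}/dual_B dual_QA // -trmx_inv invmxK trmxK.
Qed.

Lemma GLdual2_car x : scar (s := @GL2 R l k) x ->
  scar (s := @GL2 R k l) (@GLdual2 R l k x).
Proof. by move=> /GL2_elim [d [A [J [B [-> uA uB uP uQ]]]]]; exact: GLdual2_car_gl2. Qed.

Lemma GLdual2K x : scar (s := @GL2 R l k) x ->
  @GLdual2 R k l (@GLdual2 R l k x) = x.
Proof. by move=> /GL2_elim [d [A [J [B [-> uA uB uP uQ]]]]]; exact: GLdual2K_gl2. Qed.

Lemma GLdual2_s20 x : scar (s := @GL2 R l k) x ->
  gl2_s20 (@GLdual2 R l k x) = (gl2_s20 x)^T.
Proof. by move=> /GL2_elim [d [A [J [B [-> uA uB uP uQ]]]]]; exact: GLdual2_s20_gl2. Qed.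

Lemma GLdual2_smooth : smooth (@GLdual2 R l k).
Proof.
split; first exact: GLdual2_car.
move=> m U p [/= [[oU Cd] [_ CM]] cp].
have sp u : U u -> scar (s := @GL2 R l k) (p u) by move=> Uu; split=> //; exact: cp.
have un u : U u -> [/\ gl2_A (p u) \in unitmx, gl2_B (p u) \in unitmx,
    gl2_IdJ (p u) \in unitmx & gl2_IJd (p u) \in unitmx].
  by move=> /sp /GL2_elim [d [A [J [B [-> uA uB uP uQ]]]]]; rewrite !gl2E.
have CA : Cinfty U (fun u => gl2_A (p u)).
  by apply: Cinfty_lsubmx => //; apply: Cinfty_usubmx.
have CB : Cinfty U (fun u => gl2_B (p u)).
  by apply: Cinfty_rsubmx => //; apply: Cinfty_dsubmx.
have CJ : Cinfty U (fun u => gl2_J (p u)).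
  apply: Cinfty_mulmx => //.
    by apply: Cinfty_rsubmx => //; apply: Cinfty_usubmx.
  by apply: Cinfty_invmx => // u /un [].
have CP : Cinfty U (fun u => gl2_IdJ (p u)).
  by apply: CinftyD => //; [exact: Cinfty_cst|exact: Cinfty_mulmx].
have CQ : Cinfty U (fun u => gl2_IJd (p u)).
  by apply: CinftyD => //; [exact: Cinfty_cst|exact: Cinfty_mulmx].
have CAd : Cinfty U (fun u => (invmx (gl2_IdJ (p u) *m gl2_B (p u)))^T).
  apply: Cinfty_tr => //; apply: Cinfty_invmx => // [u /un [_ uB uP _]|].
    by rewrite unitmx_mul uP.
  exact: Cinfty_mulmx.
have CBd : Cinfty U (fun u => (invmx (invmx (gl2_IJd (p u)) *m gl2_A (p u)))^T).
  apply: Cinfty_tr => //; apply: Cinfty_invmx => // [u /un [uA _ _ uQ]|].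
    by rewrite unitmx_mul unitmx_inv uQ.
  by apply: Cinfty_mulmx => //; apply: Cinfty_invmx => // u /un [].
have CJd : Cinfty U (fun u => (- (gl2_J (p u) *m invmx (gl2_IdJ (p u))))^T).
  apply: Cinfty_tr => //; apply: CinftyN => //; apply: Cinfty_mulmx => //.
  by apply: Cinfty_invmx => // u /un [].
split; last by move=> u /sp /GLdual2_car [].
split; first by split=> //; exact: Cinfty_tr.
split=> //; apply: Cinfty_col_mx => //; apply: Cinfty_row_mx => //.
  exact: Cinfty_mulmx.
exact: Cinfty_cst.
Qed.

Lemma GLdual1_smooth : smooth (@GLdual1 R l k).
Proof.
have car x : scar (s := @GL1 R l k) x -> scar (s := @GL1 R k l) (@GLdual1 R l k x).
  by move=> [_ [uA uB]]; split=> //=; rewrite !unitmx_tr !unitmx_inv.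
split=> // m U p [/= [[[oU Cd] [_ CA]] [_ CB]] cp].
split; last by move=> u /cp [uA uB]; rewrite /= !unitmx_tr !unitmx_inv.
split; first split.
- by split=> //; exact: Cinfty_tr.
- by split=> //; apply: Cinfty_tr => //; apply: Cinfty_invmx => // u /cp [].
- by split=> //; apply: Cinfty_tr => //; apply: Cinfty_invmx => // u /cp [].
Qed.

Lemma GLdual1K x : @GLdual1 R k l (@GLdual1 R l k x) = x.
Proof. by case: x => [[d A] B]; rewrite /GLdual1 /= !trmx_inv !trmxK !invmxK. Qed.

Lemma GLdual0_smooth : smooth (@GLdual0 R l k).
Proof. by split=> // m U p [oU Cp]; split=> //; exact: Cinfty_tr. Qed.

End Diffeomorphisms.

Lemma GLdual0_diffeo l k : diffeo (@GLdual0 R l k).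
Proof.
split; first exact: GLdual0_smooth.
exists (@GLdual0 R k l); split; first exact: GLdual0_smooth.
- by move=> x _; exact: trmxK.
- by move=> x _; exact: trmxK.
Qed.

Lemma GLdual1_diffeo l k : diffeo (@GLdual1 R l k).
Proof.
split; first exact: GLdual1_smooth.
exists (@GLdual1 R k l); split; first exact: GLdual1_smooth.
- by move=> x _; exact: GLdual1K.
- by move=> x _; exact: GLdual1K.
Qed.

Lemma GLdual2_diffeo l k : diffeo (@GLdual2 R l k).
Proof.
split; first exact: GLdual2_smooth.
exists (@GLdual2 R k l); split; first exact: GLdual2_smooth.
- by move=> x; exact: GLdual2K.
- by move=> x; exact: GLdual2K.
Qed.

Section Iso.
Context (l k : nat).
Implicit Types (d e : 'M[R]_(k, l)) (A : 'M[R]_l) (J : 'M[R]_(l, k)) (B : 'M[R]_k).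

Lemma GLdual_iso10 : groupoid_iso (@GL10 R l k) (@GL10 R k l)
  (@GLdual1 R l k) (@GLdual0 R l k).
Proof.
split.
- exact: GLdual1_diffeo.
- exact: GLdual0_diffeo.
- move=> [[d A] B] _; rewrite /GLdual0 /= trmx_inv invmxK !trmx_mul.
  by rewrite -mulmxA.
- by [].
- move=> [[d A] B] [[d' A'] B'] [_ [uA uB]] [_ [uA' uB']] _; rewrite /GLdual1 /=.
  by rewrite !invmx_mul // !trmx_mul.
- by move=> d _; rewrite /GLdual1 /GLdual0 /= !invmx1 !trmx1.
- move=> [[d A] B] _; rewrite /GLdual1 /= !invmxK !trmx_inv !invmxK.
  by rewrite !trmx_mul !trmx_inv mulmxA.
Qed.

Let conj (x : @gl2_space R l k) : 'M[R]_(l + k) :=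
  shear_mx (- x.1) *m x.2 *m shear_mx (gl2_s20 x).

Let conj_unit x : scar (s := @GL2 R l k) x -> conj x \in unitmx.
Proof.
by move=> /GL2_shear [uM _ _]; rewrite /conj !unitmx_mul uM !shear_mx_unit.
Qed.

(** Conjugates compose because the shear on the right of the conjugate of [x] cancels
    the one on the left of the conjugate of [y] when the source of [x] is the
    target of [y]; [swap_tr] and the inverse both reverse products. *)
Lemma GLdual_iso20 : groupoid_iso (@GL20 R l k) (@GL20 R k l)
  (@GLdual2 R l k) (@GLdual0 R l k).
Proof.
have SS (D : 'M[R]_(k, l)) : shear_mx D *m shear_mx (- D) = 1%:M.
  by rewrite -{1}[D]opprK shear_mxN.
have dl0 a b (X : 'M[R]_(a + b)) (Y : 'M[R]_(a + b)) : dlsubmx X = 0 -> dlsubmx Y = 0 ->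
    dlsubmx (X *m Y) = 0.
  move=> X0 Y0; rewrite -[X]submxK -[Y]submxK X0 Y0 mulmx_block block_mxKdl.
  by rewrite mul0mx mulmx0 addr0.
split.
- exact: GLdual2_diffeo.
- exact: GLdual0_diffeo.
- by move=> x; exact: GLdual2_s20.
- by [].
- move=> x y hx hy xy; have {}xy : gl2_s20 x = y.1 := xy.
  rewrite (GLdual2E hx) (GLdual2E hy).
  have [uM dM dK] := GL2_shear hx; have [uN dN dL] := GL2_shear hy.
  have KL : shear_mx (- x.1) *m (x.2 *m y.2) *m shear_mx (gl2_s20 y) = conj x *m conj y.
    rewrite /conj -xy -!mulmxA (mulmxA (shear_mx (gl2_s20 x))) SS mul1mx.
    by [].
  have uMN : x.2 *m y.2 \in unitmx by rewrite unitmx_mul uM.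
  have [_ _ ->] := GLdual2_shear uMN (dl0 _ _ _ _ dM dN)
    (etrans (congr1 dlsubmx KL) (dl0 _ _ _ _ dK dL)).
  rewrite /=; congr pair.
  by rewrite KL invmx_mul ?conj_unit // swap_tr_mul.
- move=> d _; have [||_ _ ->] := @GLdual2_shear R l k d d 1%:M (unitmx1 _ _).
  + by rewrite scalar_mx_block block_mxKdl.
  + by rewrite mulmx1 shear_mxN scalar_mx_block block_mxKdl.
  by rewrite mulmx1 shear_mxN invmx1 swap_tr1.
- move=> x hx; have [uM dM dK] := GL2_shear hx.
  have sE := GLdual2_s20 hx; rewrite (GLdual2E hx) in sE *.
  have KV : shear_mx (- gl2_s20 x) *m invmx x.2 *m shear_mx x.1 = invmx (conj x).
    apply/esym/invmx_unique; rewrite /conj -!mulmxA (mulmxA (shear_mx (gl2_s20 x))) SS mul1mx.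
    by rewrite (mulmxA x.2) mulmxV // mul1mx shear_mxN.
  have dlV a b (X : 'M[R]_(a + b)) : X \in unitmx -> dlsubmx X = 0 -> dlsubmx (invmx X) = 0.
    move=> uX X0; move: (uX); rewrite -{1 2}[X]submxK X0 ublock_unit => /andP[u1 u2].
    by rewrite invmx_ublock // block_mxKdl.
  have uV : invmx x.2 \in unitmx by rewrite unitmx_inv.
  have [_ _ ->] := GLdual2_shear uV (dlV _ _ _ uM dM)
    (etrans (congr1 dlsubmx KV) (dlV _ _ _ (conj_unit hx) dK)).
  rewrite [RHS]/= sE; congr pair.
  by rewrite KV swap_tr_inv ?unitmx_inv ?conj_unit // invmxK.
Qed.

(** The product over [GL(l,k)_1] turns [1 + d J] and [1 + J d] into products, which
    reduces everything to identities between the parameters. *)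
Lemma GLdual_iso21 : groupoid_iso (@GL21 R l k) (@GL21 R k l)
  (@GLdual2 R l k) (@GLdual1 R l k).
Proof.
split.
- exact: GLdual2_diffeo.
- exact: GLdual1_diffeo.
- move=> x /GL2_elim [d [A [J [B [-> uA uB uP uQ]]]]].
  rewrite GLdual2_gl2 //= !gl2E ?dual_B_unit //.
  by rewrite dual_QA // /GLdual1 /=.
- move=> x /GL2_elim [d [A [J [B [-> uA uB uP uQ]]]]].
  rewrite GLdual2_gl2 //= !gl2E ?dual_B_unit //.
  by rewrite dual_PB // /GLdual1 /=.
- move=> x y /GL2_elim [d [A [J [B [-> uA uB uP uQ]]]]].
  move=> /GL2_elim [d' [A' [J' [B' [-> uA' uB' uP' uQ']]]]].
  rewrite [gsrc _ _]/= [gtgt _ _]/= !gl2E // => -[dd AA BB]; subst d'.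
  rewrite [gmul (GL21 l k) _ _]/= !gl2E //.
  have PE : 1%:M + d *m (J *m d *m J' + J + J') = (1%:M + d *m J) *m (1%:M + d *m J').
    rewrite [RHS]mulmxDl mul1mx !mulmxDr mulmx1 !mulmxA -!addrA; congr (_ + _).
    by rewrite addrCA [RHS]addrC -addrA.
  have QE : 1%:M + (J *m d *m J' + J + J') *m d = (1%:M + J *m d) *m (1%:M + J' *m d).
    rewrite [RHS]mulmxDl mul1mx !mulmxDl mulmxDr mulmx1 !mulmxA -!addrA; congr (_ + _).
    by rewrite addrCA [RHS]addrC -addrA.
  have uPP : 1%:M + d *m (J *m d *m J' + J + J') \in unitmx by rewrite PE unitmx_mul uP.
  have uBd := dual_B_unit uA uP; have uBd' := dual_B_unit uA' uP'.
  rewrite !GLdual2_gl2 // [RHS]/= !gl2E //; congr gl2.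
  + by rewrite /dual_A PE -mulmxA -BB.
  + have key : (J *m d *m J' + J + J') *m (invmx (1%:M + d *m J') *m invmx (1%:M + d *m J)) =
        J *m invmx (1%:M + d *m J) + J' *m invmx (1%:M + d *m J')
        - J' *m invmx (1%:M + d *m J') *m (d *m (J *m invmx (1%:M + d *m J))).
      set X := J *m invmx (1%:M + d *m J); set Y := J' *m invmx (1%:M + d *m J').
      have XP : X *m (1%:M + d *m J) = J by rewrite /X mulmxKV.
      have YP : Y *m (1%:M + d *m J') = J' by rewrite /Y mulmxKV.
      clearbody X Y.
      apply: (can_inj (mulmxK uP)); rewrite (mulmxA _ (invmx _) (invmx _)) mulmxKV //.
      have -> : (X + Y - Y *m (d *m X)) *m (1%:M + d *m J) = J + Y.
        by rewrite mulmxBl mulmxDl -!mulmxA XP mulmxDr mulmx1 -addrA addrK.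
      apply: (can_inj (mulmxK uP')); rewrite mulmxKV // mulmxDl YP mulmxDr mulmx1 !mulmxA.
      by rewrite [J + _]addrC.
    rewrite /dual_J PE invmx_mul // key -!trmx_mul -!linearD; congr (_^T).
    by rewrite mulmxN mulNmx mulmxN opprK opprB opprD addrA.
  + by rewrite /dual_B QE -AA mulmxA -invmx_mul.
- move=> [[d A] B] [_ [uA uB]]; rewrite [gunit (GL21 l k) _]/=.
  have uP : 1%:M + d *m 0 \in unitmx by rewrite mulmx0 addr0 unitmx1.
  rewrite (GLdual2_gl2 d A 0 uB) /dual_A /dual_J /dual_B /GLdual1 /=.
  by rewrite !mulmx0 !mul0mx !addr0 !invmx1 !mul1mx oppr0 trmx0.
- move=> x /GL2_elim [d [A [J [B [-> uA uB uP uQ]]]]].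
  have uBd := dual_B_unit uA uP.
  rewrite (GLdual2_gl2 d A J uB) [ginv (GL21 k l) _]/= !gl2E // dual_QA // dual_PB //.
  rewrite [ginv (GL21 l k) _]/= !gl2E //.
  have PE : 1%:M - d *m (invmx (1%:M + J *m d) *m J) = invmx (1%:M + d *m J).
    rewrite (sylvester_commute_inv uP); apply: (can_inj (mulmxK uP)).
    by rewrite mulVmx // mulmxBl mul1mx -!mulmxA mulVmx // mulmx1 addrK.
  have QE : 1%:M - invmx (1%:M + J *m d) *m J *m d = invmx (1%:M + J *m d).
    apply: (can_inj (mulKmx uQ)).
    by rewrite mulmxV // mulmxBr mulmx1 -!mulmxA mulKVmx // addrK.
  have uPB : (1%:M + d *m J) *m B \in unitmx by rewrite unitmx_mul uP.
  rewrite (GLdual2_gl2 _ _ _ uPB) /dual_A /dual_B mulmxN mulNmx PE QE invmxK.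
  congr gl2.
  + by rewrite mulKmx.
  + rewrite /dual_J mulmxN PE invmxK mulNmx opprK dual_Q // -trmx_inv invmxK.
    rewrite -trmx_mul -linearN /= mulNmx opprK (sylvester_commute_inv uP).
    by rewrite mulmxKV.
  + by rewrite mulKVmx.
Qed.

Lemma GLdual_iso : two_groupoid_iso (L := @GL R l k) (L' := @GL R k l)
  (@GLdual0 R l k) (@GLdual1 R l k) (@GLdual2 R l k).
Proof. by split; [exact: GLdual_iso10|exact: GLdual_iso20|exact: GLdual_iso21]. Qed.

End Iso.
End GLdualIso.

(** * Linear fibres, frames and dual frames *)

Section Bundles.
Context {R : realType}.
Local Notation sspace := (@sspace R).

(** A retraction of [R^n] onto the fibre, rather than an isomorphism: no
    trivialization of the core is given, but its fibres are retracts of fibres of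
    [E_G].  The injection [lambda] is enough to transport the vector space axioms
    from [R^n], and [sigma] provides the vectors needed to test functionals. *)
Record fibre_model (T B : sspace) (E : bundle T B) (x : B) (n : nat)
    (sigma : 'cV[R]_n -> T) (lambda : T -> 'cV[R]_n) : Prop := {
  fm_fibre : forall a, fibre E x (sigma a);
  fm_sigmaD : forall a b, sigma (a + b) = badd E (sigma a) (sigma b);
  fm_sigmaZ : forall c a, sigma (c *: a) = bscale E c (sigma a);
  fm_K : forall e, fibre E x e -> sigma (lambda e) = e;
  fm_add : forall e e', fibre E x e -> fibre E x e' ->
    fibre E x (badd E e e') /\ lambda (badd E e e') = lambda e + lambda e';
  fm_scale : forall c e, fibre E x e ->
    fibre E x (bscale E c e) /\ lambda (bscale E c e) = c *: lambda e;
  fm_zero : fibre E x (bzero E x) /\ lambda (bzero E x) = 0 }.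

Definition linear_fibre (T B : sspace) (E : bundle T B) (x : B) : Prop :=
  exists n sigma lambda, @fibre_model T B E x n sigma lambda.

Section FibreAlgebra.
Context (T B : sspace) (E : bundle T B) (x : B) (hx : linear_fibre E x).
Local Notation F := (fibre E x).
Local Notation "e +E e'" := (badd E e e') (at level 50, left associativity).
Local Notation "a *E e" := (bscale E a e) (at level 40).
Local Notation "'0E'" := (bzero E x).

Lemma fib_add e e' : F e -> F e' -> F (e +E e').
Proof. by case: hx => n [s [la h]] /(fm_add h) + /[dup] => /[apply] -[]. Qed.

Lemma fib_scale a e : F e -> F (a *E e).
Proof. by case: hx => n [s [la h]] /(fm_scale h a) []. Qed.

Lemma fib_zero : F 0E.
Proof. by case: hx => n [s [la h]]; case: (fm_zero h). Qed.

Lemma fib_baddC e e' : F e -> F e' -> e +E e' = e' +E e.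
Proof.
case: hx => n [s [la h]] Fe Fe'.
have [F1 E1] := fm_add h Fe Fe'; have [F2 E2] := fm_add h Fe' Fe.
by rewrite -(fm_K h F1) -(fm_K h F2) E1 E2 addrC.
Qed.

Lemma fib_baddA e e' e'' : F e -> F e' -> F e'' ->
  e +E (e' +E e'') = e +E e' +E e''.
Proof.
case: hx => n [s [la h]] Fe Fe' Fe''.
have [F1 E1] := fm_add h Fe Fe'; have [F2 E2] := fm_add h Fe' Fe''.
have [F3 E3] := fm_add h Fe F2; have [F4 E4] := fm_add h F1 Fe''.
by rewrite -(fm_K h F3) -(fm_K h F4) E3 E4 E1 E2 addrA.
Qed.

Lemma fib_badd0 e : F e -> e +E 0E = e.
Proof.
case: hx => n [s [la h]] Fe; have [F0 E0] := fm_zero h.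
have [F1 E1] := fm_add h Fe F0.
by rewrite -(fm_K h F1) E1 E0 addr0 (fm_K h).
Qed.

Lemma fib_add0b e : F e -> 0E +E e = e.
Proof. by move=> Fe; rewrite fib_baddC ?fib_badd0 //; exact: fib_zero. Qed.

Lemma fib_bscale1 e : F e -> 1 *E e = e.
Proof.
case: hx => n [s [la h]] Fe; have [F1 E1] := fm_scale h 1 Fe.
by rewrite -(fm_K h F1) E1 scale1r (fm_K h).
Qed.

Lemma fib_bscale0 e : F e -> 0 *E e = 0E.
Proof.
case: hx => n [s [la h]] Fe; have [F1 E1] := fm_scale h 0 Fe.
have [F0 E0] := fm_zero h.
by rewrite -(fm_K h F1) E1 scale0r -E0 (fm_K h).
Qed.

Lemma fib_scale0 a : a *E 0E = 0E.
Proof.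
case: hx => n [s [la h]]; have [F0 E0] := fm_zero h.
have [F1 E1] := fm_scale h a F0.
by rewrite -(fm_K h F1) E1 E0 scaler0 -E0 (fm_K h).
Qed.

Lemma fib_bscaleA a b e : F e -> a *E (b *E e) = (a * b) *E e.
Proof.
case: hx => n [s [la h]] Fe; have [F1 E1] := fm_scale h b Fe.
have [F2 E2] := fm_scale h a F1; have [F3 E3] := fm_scale h (a * b) Fe.
by rewrite -(fm_K h F2) -(fm_K h F3) E2 E3 E1 scalerA.
Qed.

Lemma fib_subb e : F e -> e +E (-1 *E e) = 0E.
Proof.
case: hx => n [s [la h]] Fe; have [F1 E1] := fm_scale h (-1) Fe.
have [F0 E0] := fm_zero h; have [F2 E2] := fm_add h Fe F1.
by rewrite -(fm_K h F2) E2 E1 scaleN1r subrr -E0 (fm_K h).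
Qed.

Lemma fib_baddACA a b c d : F a -> F b -> F c -> F d ->
  (a +E b) +E (c +E d) = (a +E c) +E (b +E d).
Proof.
case: hx => n [s [la h]] Fa Fb Fc Fd.
have [F1 E1] := fm_add h Fa Fb; have [F2 E2] := fm_add h Fc Fd.
have [F3 E3] := fm_add h Fa Fc; have [F4 E4] := fm_add h Fb Fd.
have [F5 E5] := fm_add h F1 F2; have [F6 E6] := fm_add h F3 F4.
by rewrite -(fm_K h F5) -(fm_K h F6) E5 E6 E1 E2 E3 E4 addrACA.
Qed.

Lemma fib_bscaleD a e e' : F e -> F e' -> a *E (e +E e') = (a *E e) +E (a *E e').
Proof.
case: hx => n [s [la h]] Fe Fe'.
have [F1 E1] := fm_add h Fe Fe'; have [F2 E2] := fm_scale h a F1.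
have [F3 E3] := fm_scale h a Fe; have [F4 E4] := fm_scale h a Fe'.
have [F5 E5] := fm_add h F3 F4.
by rewrite -(fm_K h F2) -(fm_K h F5) E2 E5 E1 E3 E4 scalerDr.
Qed.

Section Frame.
Context (V : lmodType R) (phi : V -> T) (hphi : is_frame E x phi).

Lemma frame_fibre v : F (phi v).
Proof. by case: hphi. Qed.

Lemma frame_base_eq : frame_base E phi = x.
Proof. by rewrite /frame_base; case: (frame_fibre 0). Qed.

Lemma frameD v w : phi (v + w) = phi v +E phi w.
Proof.
case: hphi => hF hL _ _; have := hL 1 v w.
by rewrite scale1r fib_bscale1.
Qed.

Lemma frame0 : phi 0 = 0E.
Proof.
case: hphi => hF hL _ _; have := hL (-1) 0 0.
rewrite scaler0 addr0 fib_baddC ?fib_subb //; exact: fib_scale.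
Qed.

Lemma frameZ a v : phi (a *: v) = a *E phi v.
Proof.
case: hphi => hF hL _ _; have := hL a v 0.
by rewrite addr0 frame0 fib_badd0 //; exact: fib_scale.
Qed.

Lemma frame_injective : injective phi.
Proof. by case: hphi. Qed.

Lemma frame_eq0 v : phi v = 0E -> v = 0.
Proof. by rewrite -frame0 => /frame_injective. Qed.

Lemma frame_surj e : F e -> exists v, phi v = e.
Proof. by case: hphi => _ _ _; apply. Qed.

Lemma frame_invK e : F e -> phi (frame_inv phi e) = e.
Proof.
by move=> /frame_surj [v ve]; rewrite /frame_inv; case: xgetP => // /(_ v).
Qed.

Lemma frameK v : frame_inv phi (phi v) = v.
Proof. exact/frame_injective/frame_invK/frame_fibre. Qed.

End Frame.

Definition frame_matrix (T' : Type) r n (theta : 'cV[R]_n -> T')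
    (f : 'cV[R]_r -> T') : 'M[R]_(n, r) :=
  \matrix_(i, j) frame_inv theta (f (delta_mx j 0)) i 0.

Lemma frame_matrixE r n (theta : 'cV[R]_n -> T) (f : 'cV[R]_r -> T) w :
  is_frame E x theta -> (forall v, F (f v)) ->
  (forall a v w, f (a *: v + w) = (a *E f v) +E f w) ->
  theta (frame_matrix theta f *m w) = f w.
Proof.
move=> ht Ff Lf; rewrite -[RHS](frame_invK ht) //; congr theta; apply/colP => i.
pose h w := frame_inv theta (f w) i 0.
have hL a v v' : h (a *: v + v') = a * h v + h v'.
  rewrite /h Lf.
  have -> : (a *E f v) +E f v' =
      theta (a *: frame_inv theta (f v) + frame_inv theta (f v')).
    by rewrite (frameD ht) (frameZ ht) !(frame_invK ht).
  by rewrite (frameK ht) !mxE.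
rewrite [RHS](linear_dot hL) /dot !mxE; apply: eq_bigr => j _.
by rewrite !mxE.
Qed.

(** The matrix of [phi] in the frame [theta] is square and has trivial kernel, so it
    is invertible. *)
Lemma frame_of_injective n (theta phi : 'cV[R]_n -> T) :
  is_frame E x theta ->
  (forall v, F (phi v)) ->
  (forall a v w, phi (a *: v + w) = (a *E phi v) +E phi w) ->
  (forall v, phi v = 0E -> v = 0) -> is_frame E x phi.
Proof.
move=> ht Fphi Lphi phi0; pose M := frame_matrix theta phi.
have Mv v : theta (M *m v) = phi v by exact: frame_matrixE.
have uM : M \in unitmx.
  by apply: unitmx_inj => v v0; apply: phi0; rewrite -Mv v0 (frame0 ht).
split=> // [v w vw|e Fe].
  have MvMw := frame_injective ht (etrans (Mv v) (etrans vw (esym (Mv w)))).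
  by have := congr1 (mulmx (invmx M)) MvMw; rewrite !mulKmx.
exists (invmx M *m frame_inv theta e).
by rewrite -Mv mulKVmx // (frame_invK ht).
Qed.

End FibreAlgebra.

Section DualFrames.
Context (T B : sspace) (E : bundle T B) (x : B).
Hypotheses (cx : scar x) (hx : linear_fibre E x).

Lemma functional_in (f : T -> R) e : fibre E x e -> (functional E x f).2 e = f e.
Proof. by move=> Fe; rewrite /functional /= mem_set. Qed.

Lemma functional_out (f : T -> R) e : ~ fibre E x e -> (functional E x f).2 e = 0.
Proof. by move=> Fe; rewrite /functional /= memNset. Qed.

Lemma functional_ext (f g : T -> R) : (forall e, fibre E x e -> f e = g e) ->
  functional E x f = functional E x g.
Proof.
move=> fg; congr pair; apply/funext => e.
by case: ifPn => // /set_mem; exact: fg.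
Qed.

Lemma functional_eq (zeta : dual_space E) (f : T -> R) :
  fibre (dual_bundle E) x zeta -> (forall e, fibre E x e -> zeta.2 e = f e) ->
  zeta = functional E x f.
Proof.
case: zeta => y z [[/= _ _ _ z0] yx] zf; rewrite /bpr /= in yx; subst y.
congr pair; apply/funext => e /=.
have [/set_mem Fe|/negP Fe] := boolP (e \in fibre E x); first exact: zf.
by apply: z0 => Fe'; apply: Fe; exact: mem_set.
Qed.

Lemma functional_fibre (f : T -> R) :
  (forall e e', fibre E x e -> fibre E x e' -> f (badd E e e') = f e + f e') ->
  (forall a e, fibre E x e -> f (bscale E a e) = a * f e) ->
  fibre (dual_bundle E) x (functional E x f).
Proof.
move=> fD fZ; split=> //; split=> //=.
- move=> e e' Fe Fe'; rewrite !mem_set ?fD //; exact: fib_add.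
- move=> a e Fe; rewrite !mem_set ?fZ //; exact: fib_scale.
- by move=> e Fe; rewrite memNset.
Qed.

Lemma dual_fibre_ext (z z' : dual_space E) :
  fibre (dual_bundle E) x z -> fibre (dual_bundle E) x z' ->
  (forall e, fibre E x e -> z.2 e = z'.2 e) -> z = z'.
Proof.
move=> hz hz' zz'; rewrite (functional_eq hz zz').
by apply/esym; exact: functional_eq.
Qed.

Lemma dual_fibre_linear (z : dual_space E) a e e' :
  fibre (dual_bundle E) x z -> fibre E x e -> fibre E x e' ->
  z.2 (badd E (bscale E a e) e') = a * z.2 e + z.2 e'.
Proof.
move=> [[_ zD zZ _] zx] Fe Fe'; rewrite /= in zx; rewrite zx in zD zZ.
by rewrite zD ?zZ //; exact: fib_scale.
Qed.

Lemma dual_frame_val r (phi : 'cV[R]_r -> T) a v :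
  is_frame E x phi -> (dual_frame E phi a).2 (phi v) = dot a v.
Proof.
move=> hphi; rewrite /dual_frame (frame_base_eq hphi) functional_in.
  by rewrite (frameK hphi).
exact: frame_fibre.
Qed.

Lemma dual_frame_fibre r (phi : 'cV[R]_r -> T) a :
  is_frame E x phi -> fibre (dual_bundle E) x (dual_frame E phi a).
Proof.
move=> hphi; rewrite /dual_frame (frame_base_eq hphi).
apply: functional_fibre => [e e' Fe Fe'|c e Fe].
  rewrite -dotDr; congr dot; apply: (frame_injective hphi).
  by rewrite (frameD hx hphi) !(frame_invK hphi) //; exact: fib_add.
rewrite -dotZr; congr dot; apply: (frame_injective hphi).
by rewrite (frameZ hx hphi) !(frame_invK hphi) //; exact: fib_scale.
Qed.

Lemma dual_functional_dot r (phi : 'cV[R]_r -> T) (z : dual_space E) v :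
  (forall v, fibre E x (phi v)) ->
  (forall v w, phi (v + w) = badd E (phi v) (phi w)) ->
  (forall c v, phi (c *: v) = bscale E c (phi v)) ->
  fibre (dual_bundle E) x z ->
  z.2 (phi v) = dot (\col_i z.2 (phi (delta_mx i 0))) v.
Proof.
move=> Fphi phiD phiZ hz.
by apply: (linear_dot (f := fun v => z.2 (phi v))) => a w w'; rewrite phiD phiZ;
  exact: dual_fibre_linear.
Qed.

Lemma dual_frame_frame r (phi : 'cV[R]_r -> T) :
  is_frame E x phi -> is_frame (dual_bundle E) x (dual_frame E phi).
Proof.
move=> hphi; split.
- by move=> a; exact: dual_frame_fibre.
- move=> c a b; rewrite /dual_frame /badd /bscale /=; congr pair; apply/funext => e /=.
  by case: ifP => _; rewrite ?mulr0 ?addr0 // dotDl dotZl.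
- move=> a b ab; apply: dot_inj => v.
  by rewrite -!(dual_frame_val _ _ hphi) ab.
- move=> z hz; exists (\col_i z.2 (phi (delta_mx i 0))).
  apply: dual_fibre_ext => //; first exact: dual_frame_fibre.
  move=> e /(frame_surj hphi) [v <-]; rewrite dual_frame_val //.
  rewrite (dual_functional_dot _ _ _ _ hz) //.
  + by move=> w; exact: frame_fibre.
  + by move=> w w'; exact: (frameD hx hphi).
  + by move=> c w; exact: (frameZ hx hphi).
Qed.

(** The dual basis of [phi] is a basis of the dual, hence a model of it. *)
Lemma dual_linear_fibre r (phi : 'cV[R]_r -> T) :
  is_frame E x phi -> linear_fibre (dual_bundle E) x.
Proof.
move=> hphi; exists r, (dual_frame E phi), (fun z => \col_i z.2 (phi (delta_mx i 0))).
have hd := dual_frame_frame hphi.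
have dfD a b : dual_frame E phi (a + b) =
    badd (dual_bundle E) (dual_frame E phi a) (dual_frame E phi b).
  rewrite /dual_frame /badd /=; congr pair; apply/funext => e /=.
  by case: ifP => _; rewrite ?addr0 // dotDl.
have dfZ c a : dual_frame E phi (c *: a) =
    bscale (dual_bundle E) c (dual_frame E phi a).
  rewrite /dual_frame /bscale /=; congr pair; apply/funext => e /=.
  by case: ifP => _; rewrite ?mulr0 // dotZl.
have df0 : dual_frame E phi 0 = bzero (dual_bundle E) x.
  rewrite /dual_frame (frame_base_eq hphi); congr pair; apply/funext => e.
  by case: ifP => // _; rewrite dot0l.
split=> //.
- by move=> a; exact: (frame_fibre hd).
- move=> z hz; apply: (dual_fibre_ext (frame_fibre hd _) hz) => e.
  move=> /(frame_surj hphi) [v <-]; rewrite dual_frame_val //.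
  apply/esym/(dual_functional_dot _ (frame_fibre hphi)) => //.
  + by move=> w w'; exact: (frameD hx hphi).
  + by move=> c w; exact: (frameZ hx hphi).
- move=> z z' hz hz'; split; last by apply/colP => i; rewrite !mxE.
  have [a <-] := frame_surj hd hz; have [b <-] := frame_surj hd hz'.
  by rewrite -dfD; exact: frame_fibre.
- move=> c z hz; split; last by apply/colP => i; rewrite !mxE.
  by have [a <-] := frame_surj hd hz; rewrite -dfZ; exact: frame_fibre.
- split; last by apply/colP => i; rewrite !mxE.
  by rewrite -df0; exact: frame_fibre.
Qed.

Lemma dual_frame_inj r (phi psi : 'cV[R]_r -> T) :
  is_frame E x phi -> is_frame E x psi ->
  dual_frame E phi = dual_frame E psi -> phi = psi.
Proof.
move=> hphi hpsi pp; apply/funext => v.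
have /(frame_surj hpsi) [w wv] := frame_fibre hphi v.
rewrite -wv; congr psi; apply: dot_inj => c; rewrite !(dotC _ c).
by rewrite -(dual_frame_val c w hpsi) wv -pp dual_frame_val.
Qed.

End DualFrames.

Lemma the_unique (T : Type) (x0 x : T) (A : set T) :
  A x -> (forall y, A y -> y = x) -> the x0 A = x.
Proof.
move=> Ax xu; rewrite /the; case: pselect => [h|]; last by case; exists x.
exact/xu/(projT2 (cid h)).
Qed.

(** The basis of which [Xi] is the dual basis. *)
Definition predual (r : nat) (T B : sspace) (E : bundle T B)
    (Xi : 'cV[R]_r -> dual_space E) (w : 'cV[R]_r) : T :=
  the (bzero E (Xi 0).1)
    [set e | fibre E (Xi 0).1 e /\ forall a, (Xi a).2 e = dot a w].

(** A right inverse of [N], when the rows of [N] are independent. *)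
Definition pseudo_inverse r n (N : 'M[R]_(r, n)) : 'M[R]_(n, r) :=
  N^T *m invmx (N *m N^T).

Section Pointwise.
Context (T B : sspace) (E : bundle T B) (x : B) (cx : scar x).
Context (n : nat) (sigma : 'cV[R]_n -> T) (lambda : T -> 'cV[R]_n).
Hypothesis hm : fibre_model E x sigma lambda.
Context (r : nat) (Xi : 'cV[R]_r -> dual_space E).
Hypothesis hXi : is_frame (dual_bundle E) x Xi.

Let hx : linear_fibre E x. Proof. by exists n, sigma, lambda. Qed.

(** The fibre is only known to be spanned by the [n] vectors [sigma (delta_mx i 0)],
    where [n] may exceed its dimension; so the predual basis is not the inverse
    of this matrix but is obtained from a right inverse. *)
Definition pairing_matrix : 'M[R]_(r, n) :=
  \matrix_(a, i) (Xi (delta_mx a 0)).2 (sigma (delta_mx i 0)).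

Lemma frame_dot e (a : 'cV[R]_r) :
  (Xi a).2 e = dot a (\col_i (Xi (delta_mx i 0)).2 e).
Proof.
rewrite dotC; apply: (linear_dot (f := fun a => (Xi a).2 e)) => c v w.
by case: hXi => _ -> _ _.
Qed.

Lemma pairing_matrixE a v : (Xi a).2 (sigma v) = dot a (pairing_matrix *m v).
Proof.
rewrite frame_dot; congr dot; apply/colP => i; rewrite !mxE.
rewrite (dual_functional_dot hx _ (fm_fibre hm) (fm_sigmaD hm) (fm_sigmaZ hm)).
  by rewrite /dot mxE; apply: eq_bigr => j _; rewrite !mxE.
by case: hXi.
Qed.

(** A combination of the rows that vanishes is a combination of the vectors of [Xi]
    that vanishes on a spanning family, so it is trivial. *)
Lemma pairing_gram_unit : pairing_matrix *m pairing_matrix^T \in unitmx.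
Proof.
set N := pairing_matrix; rewrite -[X in X *m _]trmxK; apply: unitmx_gram => a Na0.
case: hXi => fXi _ inj _; apply: inj; apply: dual_fibre_ext (fXi _) (fXi _) _.
  move=> e /(fm_K hm) <-; rewrite !pairing_matrixE dot0l dot_mulmx -/N Na0.
  by rewrite dot0l.
Qed.

Lemma pairing_matrixK : pairing_matrix *m pseudo_inverse pairing_matrix = 1%:M.
Proof. by rewrite mulmxA mulmxV ?pairing_gram_unit. Qed.

(** The coordinates of [lambda] are functionals on the fibre, hence values of [Xi]. *)
Lemma dual_frame_separates e e' : fibre E x e -> fibre E x e' ->
  (forall a, (Xi a).2 e = (Xi a).2 e') -> e = e'.
Proof.
move=> Fe Fe' ee'; rewrite -(fm_K hm Fe) -(fm_K hm Fe').
congr sigma; apply/colP => i.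
have hz : fibre (dual_bundle E) x (functional E x (fun e => lambda e i 0)).
  apply: (functional_fibre cx hx) => [e1 e2 F1 F2|c e1 F1].
    by rewrite (fm_add hm F1 F2).2 mxE.
  by rewrite (fm_scale hm c F1).2 mxE.
have [a az] : exists a, Xi a = functional E x (fun e => lambda e i 0).
  by case: hXi => _ _ _; apply.
have lE f : fibre E x f -> lambda f i 0 = (Xi a).2 f.
  by move=> Ff; rewrite az functional_in.
by rewrite !lE.
Qed.

Lemma predualE w : predual Xi w = sigma (pseudo_inverse pairing_matrix *m w).
Proof.
have Xi0 : (Xi 0).1 = x by case: hXi => /(_ 0) [].
have val a : (Xi a).2 (sigma (pseudo_inverse pairing_matrix *m w)) = dot a w.
  by rewrite pairing_matrixE mulmxA pairing_matrixK mul1mx.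
rewrite /predual Xi0; apply: the_unique; first by split; [exact: (fm_fibre hm _)|].
move=> e [Fe ea]; apply: dual_frame_separates => // [|a].
  exact: (fm_fibre hm _).
by rewrite ea val.
Qed.

Lemma predual_val a w : (Xi a).2 (predual Xi w) = dot a w.
Proof. by rewrite predualE pairing_matrixE mulmxA pairing_matrixK mul1mx. Qed.

Lemma predual_frame : is_frame E x (predual Xi).
Proof.
split.
- by move=> v; rewrite predualE; exact: (fm_fibre hm _).
- move=> c v w; rewrite !predualE mulmxDr -scalemxAr.
  by rewrite (fm_sigmaD hm) (fm_sigmaZ hm).
- by move=> v w vw; apply: dot_inj => c; rewrite !(dotC _ c) -!predual_val vw.
- move=> e Fe; exists (\col_i (Xi (delta_mx i 0)).2 e).
  apply: dual_frame_separates => // [|a]; last by rewrite predual_val -frame_dot.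
  by rewrite predualE; exact: (fm_fibre hm _).
Qed.

Lemma dual_frame_predual : dual_frame E (predual Xi) = Xi.
Proof.
apply/funext => a; apply: (dual_fibre_ext (x := x)).
- exact: (dual_frame_fibre cx hx _ predual_frame).
- by case: hXi.
- move=> e /(frame_surj predual_frame) [w <-].
  by rewrite (dual_frame_val _ _ predual_frame) predual_val.
Qed.

End Pointwise.

Lemma predual_dual_frame (T B : sspace) (E : bundle T B) (x : B) (cx : scar x)
    (hx : linear_fibre E x) r (phi : 'cV[R]_r -> T) :
  is_frame E x phi -> predual (dual_frame E phi) = phi.
Proof.
move=> hphi; have hd := dual_frame_frame cx hx hphi.
have [n [s [la hm]]] := hx.
apply: (dual_frame_inj (predual_frame cx hm hd) hphi).
exact: (dual_frame_predual cx hm hd).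
Qed.

(** * Smoothness of dual and predual frames *)

(** Plots form a sheaf on the opens of [R^m]; this holds for manifolds and their
    subspaces, but is not part of the definition of a smooth space. *)
Record local_plots (X : sspace) : Prop := {
  plot_open : forall m (U : set 'rV[R]_m) p, plot (s := X) U p -> open U;
  plot_car : forall m (U : set 'rV[R]_m) p, plot (s := X) U p ->
    forall u, U u -> scar (p u);
  plot_ext : forall m (U : set 'rV[R]_m) p p', plot (s := X) U p ->
    (forall u, U u -> p u = p' u) -> plot U p';
  plot_restrict : forall m (U W : set 'rV[R]_m) p, open W -> W `<=` U ->
    plot (s := X) U p -> plot W p;
  plot_glue : forall m (U : set 'rV[R]_m) p, open U ->
    (forall u, U u -> exists W, [/\ W u, W `<=` U & plot (s := X) W p]) ->
    plot U p }.

Lemma manifold_local_plots (X : sspace) : is_manifold X -> local_plots X.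
Proof.
move=> [n [A hA]]; have pE := atlas_plots hA; split.
- by move=> m U p /pE [].
- move=> m U p /pE [_ hp] u /hp [c [W [Ac _ Wu _ [dW _]]]].
  exact: (atlas_dom hA Ac (dW u Wu)).
- move=> m U p p' /pE [oU hp] pp'; apply/pE; split=> // u /hp.
  move=> [c [W [Ac oW Wu WU [dW CW]]]]; exists c, W; split=> //; split.
    by move=> w Ww; rewrite -pp'; [exact: dW|exact: WU].
  by apply: Cinfty_ext CW => // w Ww; rewrite /= pp' //; exact: WU.
- move=> m U W p oW WU /pE [oU hp]; apply/pE; split=> // u Wu.
  have [c [W' [Ac oW' Wu' WU' [dW' CW']]]] := hp u (WU u Wu).
  exists c, (W `&` W'); split=> //; first exact: openI.
  split; first by move=> w [_ /dW'].
  by apply: Cinfty_restrict CW' => w [].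
- move=> m U p oU hp; apply/pE; split=> // u Uu.
  have [W [Wu WU /pE [oW hW]]] := hp u Uu.
  have [c [W' [Ac oW' Wu' WU' [dW' CW']]]] := hW u Wu.
  by exists c, W'; split=> // w /WU' /WU.
Qed.

Lemma subsp_local_plots (X : sspace) (A : set X) :
  local_plots X -> local_plots (subsp A).
Proof.
move=> hX; split.
- by move=> m U p [/(plot_open hX)].
- by move=> m U p [/(plot_car hX) cp Ap] u Uu; split; [exact: cp|exact: Ap].
- move=> m U p p' [pp Ap] pp'; split; first exact: (plot_ext hX pp pp').
  by move=> u Uu; rewrite -pp' //; exact: Ap.
- move=> m U W p oW WU [pp Ap]; split; first exact: (plot_restrict hX oW WU pp).
  by move=> u /WU; exact: Ap.
- move=> m U p oU hp; split=> [|u /hp [W [Wu _ [_ Ap]]]]; last exact: Ap.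
  by apply: (plot_glue hX) => // u /hp [W [Wu WU [pp _]]]; exists W.
Qed.

(** Along the plot [p] of the base, vectors over [p w] are smooth exactly when their
    coordinates under [lambda w] are. *)
Record smooth_model (T B : sspace) (E : bundle T B) m (W : set 'rV[R]_m)
    (p : 'rV[R]_m -> B) n (sigma : 'rV[R]_m -> 'cV[R]_n -> T)
    (lambda : 'rV[R]_m -> T -> 'cV[R]_n) : Prop := {
  sm_open : open W;
  sm_fibre : forall w, W w -> fibre_model E (p w) (sigma w) (lambda w);
  sm_sigma : forall W' (a : 'rV[R]_m -> 'cV[R]_n), open W' -> W' `<=` W ->
    Cinfty W' a -> plot W' (fun w => sigma w (a w));
  sm_lambda : forall W' q, W' `<=` W -> plot (s := T) W' q ->
    (forall w, W' w -> bpr E (q w) = p w) ->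
    Cinfty W' (fun w => lambda w (q w)) }.

Record smooth_bundle (T B : sspace) (E : bundle T B) : Prop := {
  sb_total : local_plots T;
  sb_base : local_plots B;
  sb_pr : smooth (bpr E);
  sb_fibre : forall x, scar x -> linear_fibre E x;
  sb_model : forall m (U : set 'rV[R]_m) p, plot (s := B) U p ->
    forall u, U u -> exists W n sigma lambda,
      [/\ W u, W `<=` U & @smooth_model T B E m W p n sigma lambda] }.

Definition coordinate_matrix (T : Type) r n (lambda : T -> 'cV[R]_n)
    (phi : 'cV[R]_r -> T) : 'M[R]_(n, r) :=
  \matrix_(i, j) lambda (phi (delta_mx j 0)) i 0.

Lemma coordinate_matrixE (T B : sspace) (E : bundle T B) x r n sigma lambda
    (phi : 'cV[R]_r -> T) v :
  @fibre_model T B E x n sigma lambda -> is_frame E x phi ->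
  lambda (phi v) = coordinate_matrix lambda phi *m v.
Proof.
move=> fm hphi; have hx : linear_fibre E x by exists n, sigma, lambda.
apply/colP => i; rewrite (linear_dot (f := fun v => lambda (phi v) i 0)) => [|c v1 v2].
  by rewrite /dot !mxE; apply: eq_bigr => j _; rewrite !mxE.
have F1 := frame_fibre hphi v1; have F2 := frame_fibre hphi v2.
rewrite (frameD hx hphi) (frameZ hx hphi).
have [F3 E3] := fm_scale fm c F1.
by rewrite (fm_add fm F3 F2).2 E3 !mxE.
Qed.

Section SmoothBundle.
Context (T B : sspace) (E : bundle T B) (hE : smooth_bundle E).

Lemma frame_plot_base (V : lmodType R) m (U : set 'rV[R]_m) p :
  plot (s := frame_space V E) U p -> plot (s := B) U (fun u => frame_base E (p u)).
Proof. by move=> [_ pp]; exact: ((sb_pr hE).2 _ _ _ (pp 0)). Qed.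

Lemma frame_at_base (V : lmodType R) (phi : V -> T) :
  scar (s := frame_space V E) phi ->
  scar (frame_base E phi) /\ is_frame E (frame_base E phi) phi.
Proof. by move=> [x cx hphi]; rewrite (frame_base_eq hphi). Qed.

Lemma smooth_coordinate_matrix r m (U W : set 'rV[R]_m) p n s la :
  plot (s := frame_space 'cV[R]_r E) U p -> W `<=` U ->
  smooth_model E W (fun u => frame_base E (p u)) s la ->
  Cinfty W (fun w => coordinate_matrix (n := n) (la w) (p w)).
Proof.
move=> pp WU hm; have oW := sm_open hm.
apply/Cinfty_mxP => // i j.
have /(Cinfty_mxP oW)/(_ i 0) : Cinfty W (fun w => la w (p w (delta_mx j 0))).
  apply: (sm_lambda hm) => [//||w Ww].
    exact: (plot_restrict (sb_total hE) oW WU (pp.2 _)).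
  have [_ hw] := frame_at_base (pp.1 w (WU w Ww)).
  by case: (frame_fibre hw (delta_mx j 0)).
by apply: Cinfty_ext => // w _; rewrite mxE.
Qed.

(** The coordinates [c] of [q] in the frame [p] solve [L c = lambda q], where the
    columns of [L] are the images under [lambda] of the vectors of the frame; as
    [L] is injective but perhaps not square, the system is solved by
    [c = (L^T L)^-1 L^T lambda q]. *)
Lemma smooth_frame_coordinates r m (U W : set 'rV[R]_m)
    (p : 'rV[R]_m -> 'cV[R]_r -> T) (q : 'rV[R]_m -> T) :
  plot (s := frame_space 'cV[R]_r E) U p -> W `<=` U -> plot (s := T) W q ->
  (forall w, W w -> bpr E (q w) = frame_base E (p w)) ->
  Cinfty W (fun w => frame_inv (p w) (q w)).
Proof.
move=> pp WU pq qp; have oW := plot_open (sb_total hE) pq.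
have pb := plot_restrict (sb_base hE) oW WU (frame_plot_base pp).
apply: Cinfty_glue => u Wu.
have [W' [n [s [la [W'u W'W hm]]]]] := sb_model hE pb Wu.
have oW' := sm_open hm.
exists W' => //.
pose L w := coordinate_matrix (la w) (p w).
have hp w : W' w -> is_frame E (frame_base E (p w)) (p w).
  by move=> W'w; case: pp => /(_ w (WU w (W'W w W'w))) /frame_at_base [].
have Fq w : W' w -> fibre E (frame_base E (p w)) (q w).
  move=> W'w; split; last exact/qp/W'W.
  exact: (plot_car (sb_total hE) pq (W'W w W'w)).
have lin w : W' w -> linear_fibre E (frame_base E (p w)).
  by move=> W'w; exists n, (s w), (la w); exact: (sm_fibre hm W'w).
have LE w : W' w -> forall v, la w (p w v) = L w *m v.
  by move=> W'w v; exact: (coordinate_matrixE v (sm_fibre hm W'w) (hp w W'w)).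
have uG w : W' w -> (L w)^T *m L w \in unitmx.
  move=> W'w; apply: unitmx_gram => v; rewrite -LE // => v0.
  apply: (frame_injective (hp w W'w)).
  have fm := sm_fibre hm W'w.
  rewrite -[LHS](fm_K fm) ?v0; last exact: (frame_fibre (hp w W'w) _).
  rewrite (frame0 (lin w W'w) (hp w W'w)); have [F0 <-] := fm_zero fm.
  exact: (fm_K fm F0).
have CL : Cinfty W' L.
  exact: (smooth_coordinate_matrix pp (subset_trans W'W WU) hm).
apply: (@Cinfty_ext _ _ _ _ (fun w =>
  invmx ((L w)^T *m L w) *m (L w)^T *m la w (q w))) => //.
  move=> w W'w; rewrite -{1}(frame_invK (hp w W'w) (Fq w W'w)) LE //.
  by rewrite mulmxA -(mulmxA (invmx _)) mulVmx ?mul1mx //; exact: uG.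
apply: Cinfty_mulmx => //.
  apply: Cinfty_mulmx => //; last exact: Cinfty_tr.
  by apply: Cinfty_invmx => //; apply: Cinfty_mulmx => //; exact: Cinfty_tr.
apply: (sm_lambda hm) => // [|w W'w]; last exact/qp/W'W.
exact: (plot_restrict (sb_total hE) oW' W'W pq).
Qed.

Lemma dual_plot_ext m (U : set 'rV[R]_m) p p' : plot (s := dual_space E) U p ->
  (forall u, U u -> p u = p' u) -> plot (s := dual_space E) U p'.
Proof.
move=> [pb pc pq] pp'; split=> [|u Uu|W q WU pW qp].
- by apply: (plot_ext (sb_base hE) pb) => u /pp' ->.
- by rewrite -pp' //; exact: pc.
- apply: (Cinfty_ext (plot_open (sb_total hE) pW)) (pq W q WU pW _) => w Ww.
    by rewrite pp' //; exact: WU.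
  by rewrite pp' ?qp //; exact: WU.
Qed.

Lemma smooth_dual_frame r : smooth (X := frame_space 'cV[R]_r E)
  (Y := frame_space 'cV[R]_r (dual_bundle E)) (dual_frame E).
Proof.
have car (phi : 'cV[R]_r -> T) : scar (s := frame_space 'cV[R]_r E) phi ->
    is_frame (dual_bundle E) (frame_base E phi) (dual_frame E phi).
  move=> /frame_at_base [cx hphi].
  by apply: dual_frame_frame => //; exact: (sb_fibre hE cx).
split=> [phi hphi|m U p pp].
  by exists (frame_base E phi); [exact: (frame_at_base hphi).1|exact: car].
have cp u : U u -> scar (s := frame_space 'cV[R]_r E) (p u) by case: pp => + _; apply.
split=> [u Uu|a].
  exists (frame_base E (p u)); first exact: (frame_at_base (cp u Uu)).1.
  exact: (car _ (cp u Uu)).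
split=> [|u Uu|W q WU pq qp].
- exact: (frame_plot_base pp).
- by case: (frame_fibre (car _ (cp u Uu)) a).
- have oW := plot_open (sb_total hE) pq.
  apply: (@Cinfty_ext _ _ R^o _ (fun w => dot a (frame_inv (p w) (q w)))) => //.
    move=> w Ww; rewrite /dual_frame functional_in //.
    by split; [exact: (plot_car (sb_total hE) pq Ww)|exact: qp].
  apply: Cinfty_dot => //; first exact: Cinfty_cst.
  exact: (smooth_frame_coordinates pp WU pq qp).
Qed.

(** Locally, the predual basis is [sigma] applied to the right inverse of the pairing
    matrix, whose entries are smooth by the definition of the plots of the
    dual. *)
Lemma smooth_predual r : smooth (X := frame_space 'cV[R]_r (dual_bundle E))
  (Y := frame_space 'cV[R]_r E) (predual (E := E)).
Proof.
have car Xi : scar (s := frame_space 'cV[R]_r (dual_bundle E)) Xi ->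
    scar (s := frame_space 'cV[R]_r E) (predual Xi).
  move=> [x cx hXi]; exists x => //.
  have [n [s [la hm]]] := sb_fibre hE cx.
  exact: (predual_frame cx hm hXi).
split=> // m U p pp.
have cp u : U u -> scar (p u) by case: pp => + _; apply.
split=> [u Uu|w]; first exact/car/cp.
have pb : plot (s := B) U (fun u => (p u 0).1) by case: (pp.2 0).
have oU := plot_open (sb_base hE) pb.
have hp u : U u -> scar (p u 0).1 /\ is_frame (dual_bundle E) (p u 0).1 (p u).
  by move=> /cp [x cx hu]; case: (frame_fibre hu 0) => _ /= ->.
apply: (plot_glue (sb_total hE)) => // u Uu.
have [W [n [s [la [Wu WU hm]]]]] := sb_model hE pb Uu.
have oW := sm_open hm; exists W; split=> //.
pose N v := pairing_matrix (s v) (p v).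
have NE v i a : W v -> N v a i = (p v (delta_mx a 0)).2 (s v (delta_mx i 0)).
  by rewrite mxE.
have CN : Cinfty W N.
  apply/Cinfty_mxP => // a i.
  have [_ _ /(_ W (fun v => s v (delta_mx i 0)) WU)] := pp.2 (delta_mx a 0).
  have ps : plot (s := T) W (fun v => s v (delta_mx i 0)).
    by apply: (sm_sigma hm) => //; exact: Cinfty_cst.
  move=> /(_ ps) H; apply: (@Cinfty_ext _ _ R^o _ _ _ oW _ (H _)) => v Wv.
    by rewrite mxE.
  have [cx hv] := hp v (WU v Wv).
  have [_ ->] := fm_fibre (sm_fibre hm Wv) (delta_mx i 0).
  by case: (frame_fibre hv (delta_mx a 0)) => _ /= ->.
apply: (plot_ext (sb_total hE) (sm_sigma hm
    (a := fun v => pseudo_inverse (N v) *m w) oW _ _)) => //.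
  apply: Cinfty_mulmx => //; last exact: Cinfty_cst.
  apply: Cinfty_mulmx => //; first exact: Cinfty_tr.
  apply: Cinfty_invmx => // [v Wv|]; last first.
    by apply: Cinfty_mulmx => //; exact: Cinfty_tr.
  have [cx hv] := hp v (WU v Wv).
  exact: (pairing_gram_unit (sm_fibre hm Wv) hv).
move=> v Wv; have [cx hv] := hp v (WU v Wv).
by rewrite /= (predualE cx (sm_fibre hm Wv) hv).
Qed.

End SmoothBundle.

Lemma smooth_model_plot (T B : sspace) (E : bundle T B) (hT : local_plots T)
    m W p n s la (hm : @smooth_model T B E m W p n s la) (W' : set 'rV[R]_m) q :
  open W' -> W' `<=` W -> (forall w, W' w -> fibre E (p w) (q w)) ->
  Cinfty W' (fun w => la w (q w)) -> plot W' q.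
Proof.
move=> oW' W'W Fq Cq; apply: (plot_ext hT (sm_sigma hm oW' W'W Cq)) => w W'w.
exact: (fm_K (sm_fibre hm (W'W w W'w)) (Fq w W'w)).
Qed.

(** The converse of [sm_lambda]: a family of vectors with smooth coordinates is
    a plot. *)
Lemma smooth_bundle_plot (T B : sspace) (E : bundle T B) (hE : smooth_bundle E)
    m (U : set 'rV[R]_m) p q : plot (s := B) U p ->
  (forall u, U u -> fibre E (p u) (q u)) ->
  (forall W n s la, W `<=` U -> @smooth_model T B E m W p n s la ->
     Cinfty W (fun w => la w (q w))) ->
  plot U q.
Proof.
move=> pp Fq Cq; have oU := plot_open (sb_base hE) pp.
apply: (plot_glue (sb_total hE)) => // u Uu.
have [W [n [s [la [Wu WU hm]]]]] := sb_model hE pp Uu.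
exists W; split=> //.
by apply: (smooth_model_plot (sb_total hE) hm (sm_open hm)) (Cq _ _ _ _ WU hm)
  => // w /WU; exact: Fq.
Qed.

Lemma smooth_coordinates (T B : sspace) (E : bundle T B) (hE : smooth_bundle E)
    m (U W : set 'rV[R]_m) p q n s la (hm : @smooth_model T B E m W p n s la) :
  W `<=` U -> plot (s := T) U q -> (forall u, U u -> bpr E (q u) = p u) ->
  Cinfty W (fun w => la w (q w)).
Proof.
move=> WU pq qp; apply: (sm_lambda hm) => // [|w /WU]; last exact: qp.
exact: (plot_restrict (sb_total hE) (sm_open hm) WU pq).
Qed.

Lemma smooth_add (T B : sspace) (E : bundle T B) (hE : smooth_bundle E)
    m (U : set 'rV[R]_m) p q q' : plot (s := B) U p ->
  plot (s := T) U q -> plot (s := T) U q' ->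
  (forall u, U u -> bpr E (q u) = p u) ->
  (forall u, U u -> bpr E (q' u) = p u) ->
  plot U (fun u => badd E (q u) (q' u)).
Proof.
move=> pp pq pq' qp qp'.
have Fq u : U u -> fibre E (p u) (q u).
  by move=> Uu; split; [exact: (plot_car (sb_total hE) pq Uu)|exact: qp].
have Fq' u : U u -> fibre E (p u) (q' u).
  by move=> Uu; split; [exact: (plot_car (sb_total hE) pq' Uu)|exact: qp'].
apply: (smooth_bundle_plot hE pp) => [u Uu|W n s la WU hm].
  apply: fib_add; [|exact: Fq|exact: Fq'].
  exact: (sb_fibre hE (plot_car (sb_base hE) pp Uu)).
have oW := sm_open hm.
apply: (@Cinfty_ext _ _ _ _ (fun w => la w (q w) + la w (q' w))) => //.
  move=> w Ww; have Uw := WU w Ww.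
  by rewrite (fm_add (sm_fibre hm Ww) (Fq w Uw) (Fq' w Uw)).2.
by apply: CinftyD => //; apply: (smooth_coordinates hE hm WU).
Qed.

Lemma smooth_scale (T B : sspace) (E : bundle T B) (hE : smooth_bundle E)
    m (U : set 'rV[R]_m) p c q : plot (s := B) U p ->
  plot (s := T) U q -> (forall u, U u -> bpr E (q u) = p u) ->
  plot U (fun u => bscale E c (q u)).
Proof.
move=> pp pq qp.
have Fq u : U u -> fibre E (p u) (q u).
  by move=> Uu; split; [exact: (plot_car (sb_total hE) pq Uu)|exact: qp].
apply: (smooth_bundle_plot hE pp) => [u Uu|W n s la WU hm].
  apply: fib_scale; last exact: Fq.
  exact: (sb_fibre hE (plot_car (sb_base hE) pp Uu)).
have oW := sm_open hm.
apply: (@Cinfty_ext _ _ _ _ (fun w => c%:M *m la w (q w))) => //.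
  move=> w Ww; have Uw := WU w Ww.
  by rewrite (fm_scale (sm_fibre hm Ww) c (Fq w Uw)).2 mul_scalar_mx.
apply: Cinfty_mulmx => //; first exact: Cinfty_cst.
exact: (smooth_coordinates hE hm WU).
Qed.

Lemma smooth_frame_combination (T B : sspace) (E : bundle T B)
    (hE : smooth_bundle E) r m (U : set 'rV[R]_m) p (a : 'rV[R]_m -> 'cV[R]_r) :
  plot (s := frame_space 'cV[R]_r E) U p -> Cinfty U a ->
  plot U (fun u => p u (a u)).
Proof.
move=> pp Ca; have pb := frame_plot_base hE pp.
have hp u : U u -> is_frame E (frame_base E (p u)) (p u).
  by move=> Uu; case: pp => /(_ u Uu) /frame_at_base [].
have lin u : U u -> linear_fibre E (frame_base E (p u)).
  by move=> Uu; exact: (sb_fibre hE (plot_car (sb_base hE) pb Uu)).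
apply: (smooth_bundle_plot hE pb) => [u Uu|W n s la WU hm].
  exact: (frame_fibre (hp u Uu)).
have oW := sm_open hm.
apply: (@Cinfty_ext _ _ _ _ (fun w => coordinate_matrix (la w) (p w) *m a w)) => //.
  move=> w Ww; exact/esym/(coordinate_matrixE _ (sm_fibre hm Ww) (hp w (WU w Ww))).
apply: Cinfty_mulmx => //; last exact: (Cinfty_restrict WU).
exact: (smooth_coordinate_matrix hE pp WU hm).
Qed.

(** * Vector bundles *)

Section Trivialization.
Context (T B : sspace) (E : bundle T B) (r : nat) (U : set B) (psi : T -> 'cV[R]_r).
Hypotheses (oU : sopen U) (tr : local_trivialization E U psi).

Lemma trivialization_inverse : exists g : B * 'cV[R]_r -> T,
  [/\ smooth (X := prodsp (subsp U) (mxsp r 1))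
        (Y := subsp [set e | U (bpr E e)]) g,
      forall x, U x -> fibre_model E x (fun a => g (x, a)) psi &
      forall x a, U x -> psi (g (x, a)) = a].
Proof.
case: tr => [[sf [g [sg gf fg]]]] lin; exists g.
have cU x : U x -> scar x by move/oU.1.
have gF x a : U x -> fibre E x (g (x, a)) /\ psi (g (x, a)) = a.
  move=> Ux; have cxa : scar (s := prodsp (subsp U) (mxsp r 1)) (x, a).
    by split=> //; split=> //; exact: cU.
  have [cg Ug] := sg.1 _ cxa.
  by case: (fg _ cxa) => E1 E2; split.
have gK x e : U x -> fibre E x e -> g (x, psi e) = e.
  by move=> Ux [ce ex]; rewrite -{1}ex gf //; split=> //=; rewrite ex.
split=> [//|x Ux|x a /(gF x a) []//].
have [[F0 E0] Fadd Fscale] := lin x Ux.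
split=> //.
- by move=> a; case: (gF x a Ux).
- move=> a b; have [Fa Ea] := gF x a Ux; have [Fb Eb] := gF x b Ux.
  have [F E1] := Fadd _ _ Fa Fb.
  by rewrite -[RHS](gK x) // E1 Ea Eb.
- move=> c a; have [Fa Ea] := gF x a Ux; have [F E1] := Fscale c _ Fa.
  by rewrite -[RHS](gK x) // E1 Ea.
- by move=> e; exact: gK.
Qed.

End Trivialization.

Section VectorBundle.
Context (T B : sspace) (E : bundle T B) (r : nat) (hE : is_vector_bundle r E).

Lemma vector_bundle_frame x : scar x ->
  linear_fibre E x /\ exists theta : 'cV[R]_r -> T, is_frame E x theta.
Proof.
case: hE => _ _ _ tr cx; have [U [psi [oU Ux hpsi]]] := tr x cx.
have [g [_ gm gK]] := trivialization_inverse oU hpsi; have fm := gm x Ux.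
split; first by exists r, (fun a => g (x, a)), psi.
exists (fun a => g (x, a)); split.
- by move=> v; exact: (fm_fibre fm).
- by move=> a v w; rewrite (fm_sigmaD fm) (fm_sigmaZ fm).
- by move=> v w vw; rewrite -(gK x v Ux) vw gK.
- by move=> e Fe; exists (psi e); exact: (fm_K fm).
Qed.

Lemma vector_bundle_smooth : smooth_bundle E.
Proof.
case: (hE) => mT mB spr tr.
have hT := manifold_local_plots mT; have hB := manifold_local_plots mB.
split=> //.
  by move=> x /vector_bundle_frame [].
move=> m U p pp u Uu; have cx := plot_car hB pp Uu.
have [Q [psi [oQ Qx hpsi]]] := tr _ cx.
have [g [sg gm gK]] := trivialization_inverse oQ hpsi.
have oW := oQ.2 _ _ _ pp.
exists (U `&` p @^-1` Q), r, (fun w a => g (p w, a)), (fun=> psi); split=> //.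
split=> //.
- by move=> w [_ Qw]; exact: gm.
- move=> W' a oW' W'W Ca.
  have [pg _] : plot (s := subsp [set e | Q (bpr E e)]) W' (fun w => g (p w, a w)).
    apply: sg.2; split=> /=; split=> //.
    - by apply: (plot_restrict hB oW' _ pp) => w /W'W [].
    - by move=> w /W'W [].
  exact: pg.
- move=> W' q W'W pq qp; have [[_ sf] _] := hpsi.1.
  have qW : plot (s := subsp [set e | Q (bpr E e)]) W' q.
    by split=> // w W'w /=; rewrite qp //; case: (W'W w W'w).
  by have [_ []] := sf _ _ _ qW.
Qed.

End VectorBundle.

(** Morphisms are only assumed to respect sums and multiples; the zero vector is
    the multiple by 0 of itself. *)
Lemma bundle_morphism_zero (T B T' B' : sspace) (E : bundle T B)
    (E' : bundle T' B') F f x : bundle_morphism E E' F f ->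
  linear_fibre E x -> linear_fibre E' (f x) ->
  F (bzero E x) = bzero E' (f x).
Proof.
move=> [sF sf pF _ ZF] hx hx'; have F0 := fib_zero hx.
rewrite -(fib_bscale0 hx F0) ZF; last by case: F0.
by apply: (fib_bscale0 hx'); split; [apply: sF.1|rewrite pF]; case: F0 => // ? ->.
Qed.

Lemma bundle_morphism_fibre (T B T' B' : sspace) (E : bundle T B)
    (E' : bundle T' B') F f x e : bundle_morphism E E' F f ->
  fibre E x e -> fibre E' (f x) (F e).
Proof. by move=> [sF _ pF _ _] [ce ex]; split; [exact: sF.1|rewrite pF // ex]. Qed.

End Bundles.

Lemma ginvK (R : realType) (A Ob : @sspace R) (G : groupoid A Ob) (hG : is_groupoid G) e :
  scar e -> ginv G (ginv G e) = e.
Proof.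
move=> ce; have ci := grp_inv_car hG ce; have cii := grp_inv_car hG ci.
have E1 : gsrc G (ginv G (ginv G e)) = gtgt G (ginv G e) by rewrite (grp_src_inv hG).
have E2 : gsrc G (ginv G e) = gtgt G e by rewrite (grp_src_inv hG).
rewrite -[LHS](grp_mul1 hG) // E1 (grp_tgt_inv hG) // -(grp_Vmul hG) //.
by rewrite (grp_mulA hG) // (grp_Vmul hG) // E2 (grp_1mul hG).
Qed.

Lemma gmul_inv_mul (R : realType) (A Ob : @sspace R) (G : groupoid A Ob)
    (hG : is_groupoid G) a b : scar a -> scar b -> gsrc G a = gtgt G b ->
  gmul G b (ginv G (gmul G a b)) = ginv G a.
Proof.
move=> ca cb ab; have cab := grp_mul_car hG ca cb ab.
have ci := grp_inv_car hG cab; have cia := grp_inv_car hG ca.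
have E1 : gsrc G (ginv G a) = gtgt G (gmul G a b).
  by rewrite (grp_src_inv hG) // (grp_tgt_mul hG).
have {1}-> : b = gmul G (ginv G a) (gmul G a b).
  rewrite (grp_mulA hG) ?(grp_src_inv hG) // (grp_Vmul hG) // ab.
  by rewrite (grp_1mul hG).
rewrite -(grp_mulA hG) // ?(grp_tgt_inv hG) // (grp_mulV hG) // -E1.
exact: (grp_mul1 hG).
Qed.

(** * Calculus in a VB-groupoid, and its core *)

Section VBGroupoid.
Context {R : realType} (l k : nat) (V : @vb_groupoid R) (hV : is_vb_groupoid l k V).
Local Notation s := (gsrc (vbG V)).
Local Notation t := (gtgt (vbG V)).
Local Notation u := (gunit (vbG V)).
Local Notation inv := (ginv (vbG V)).
Local Notation mul := (gmul (vbG V)).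
Local Notation "'s~'" := (gsrc (vbE V)).
Local Notation "'t~'" := (gtgt (vbE V)).
Local Notation "'m~'" := (gmul (vbE V)).
Local Notation "'u~'" := (gunit (vbE V)).
Local Notation "'tau~'" := (ginv (vbE V)).
Local Notation "'0A'" := (bzero (vbA V)).
Local Notation "'0O'" := (bzero (vbO V)).
Local Notation addA := (badd (vbA V)).
Local Notation FA := (fibre (vbA V)).
Local Notation FO := (fibre (vbO V)).
Local Notation frame := ('cV[R]_l * 'cV[R]_k -> vbEA V).
Local Notation W := (dual_vb_groupoid V).
Local Notation DA := (dual_bundle (vbA V)).
Local Notation dsbis := (@dual_sbis R V l k).
Implicit Types phi psi : frame.

Let gG : is_groupoid (vbG V) := lie_groupoid (vb_G_lie hV).
Let gE : is_groupoid (vbE V) := lie_groupoid (vb_E_lie hV).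

Lemma linA g : scar g -> linear_fibre (vbA V) g.
Proof. by move=> /(vector_bundle_frame (vb_A_bundle hV)) []. Qed.

Lemma linO x : scar x -> linear_fibre (vbO V) x.
Proof. by move=> /(vector_bundle_frame (vb_O_bundle hV)) []. Qed.

Lemma src_fib g e : FA g e -> FO (s g) (s~ e).
Proof. exact: (bundle_morphism_fibre (vb_src hV)). Qed.

Lemma tgt_fib g e : FA g e -> FO (t g) (t~ e).
Proof. exact: (bundle_morphism_fibre (vb_tgt hV)). Qed.

Lemma unit_fib x v : FO x v -> FA (u x) (u~ v).
Proof. exact: (bundle_morphism_fibre (vb_unit hV)). Qed.

Lemma inv_fib g e : FA g e -> FA (inv g) (tau~ e).
Proof. exact: (bundle_morphism_fibre (vb_inv hV)). Qed.

Lemma mul_fib g h e f : FA g e -> FA h f -> s~ e = t~ f -> FA (mul g h) (m~ e f).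
Proof.
move=> [ce eg] [cf fh] ef; split; first exact: (grp_mul_car gE).
by rewrite (vb_mul_pr hV) // eg fh.
Qed.

Lemma fib_base_composable g h e f : FA g e -> FA h f -> s~ e = t~ f -> s g = t h.
Proof. by move=> /src_fib [_ <-] /tgt_fib [_ <-] ->. Qed.

Lemma zero_fib g : scar g -> FA g (0A g).
Proof. by move=> /linA /fib_zero. Qed.

Lemma src_zero g : scar g -> s~ (0A g) = 0O (s g).
Proof.
move=> cg; apply: (bundle_morphism_zero (vb_src hV)); first exact: linA.
by apply: linO; exact: (grp_src_car gG).
Qed.

Lemma tgt_zero g : scar g -> t~ (0A g) = 0O (t g).
Proof.
move=> cg; apply: (bundle_morphism_zero (vb_tgt hV)); first exact: linA.
by apply: linO; exact: (grp_tgt_car gG).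
Qed.

Lemma unit_zero x : scar x -> u~ (0O x) = 0A (u x).
Proof.
move=> cx; apply: (bundle_morphism_zero (vb_unit hV)); first exact: linO.
by apply: linA; exact: (grp_unit_car gG).
Qed.

Lemma inv_zero g : scar g -> tau~ (0A g) = 0A (inv g).
Proof.
move=> cg; apply: (bundle_morphism_zero (vb_inv hV)); first exact: linA.
by apply: linA; exact: (grp_inv_car gG).
Qed.

Lemma mul_zero g h : scar g -> scar h -> s g = t h -> m~ (0A g) (0A h) = 0A (mul g h).
Proof.
move=> cg ch gh; have [Fg Fh] := (zero_fib cg, zero_fib ch).
have e0 : s~ (0A g) = t~ (0A h) by rewrite src_zero // tgt_zero // gh.
rewrite -{1}(fib_bscale0 (linA cg) Fg) -{1}(fib_bscale0 (linA ch) Fh).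
rewrite (vb_mul_scale hV) //; [|by case: Fg|by case: Fh].
rewrite (fib_bscale0 _ (mul_fib Fg Fh e0)) //.
by apply: linA; exact: (grp_mul_car gG).
Qed.

Lemma srcD g e e' : FA g e -> FA g e' -> s~ (addA e e') = badd (vbO V) (s~ e) (s~ e').
Proof. by case: (vb_src hV) => _ _ _ h _; exact: h. Qed.

Lemma tgtD g e e' : FA g e -> FA g e' -> t~ (addA e e') = badd (vbO V) (t~ e) (t~ e').
Proof. by case: (vb_tgt hV) => _ _ _ h _; exact: h. Qed.

Lemma unitD x v w : FO x v -> FO x w -> u~ (badd (vbO V) v w) = addA (u~ v) (u~ w).
Proof. by case: (vb_unit hV) => _ _ _ h _; exact: h. Qed.

Lemma srcZ g a e : FA g e -> s~ (bscale (vbA V) a e) = bscale (vbO V) a (s~ e).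
Proof. by case=> ce _; case: (vb_src hV) => _ _ _ _; apply. Qed.

Lemma tgtZ g a e : FA g e -> t~ (bscale (vbA V) a e) = bscale (vbO V) a (t~ e).
Proof. by case=> ce _; case: (vb_tgt hV) => _ _ _ _; apply. Qed.

Lemma unitZ x a v : FO x v -> u~ (bscale (vbO V) a v) = bscale (vbA V) a (u~ v).
Proof. by case=> ce _; case: (vb_unit hV) => _ _ _ _; apply. Qed.

Lemma smooth_A : smooth_bundle (vbA V).
Proof. exact: (vector_bundle_smooth (vb_A_bundle hV)). Qed.

Lemma smooth_O : smooth_bundle (vbO V).
Proof. exact: (vector_bundle_smooth (vb_O_bundle hV)). Qed.

Lemma core_fibreP x c : scar x ->
  fibre (core V) x c <-> FA (u x) c /\ s~ c = 0O x.
Proof.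
move=> cx; split=> [[[ce [y cy [[_ yb] sc]]] xb]|[[ce eb] sc]].
  rewrite /core /= yb in xb; rewrite (grp_src_unit gG) // in xb sc; subst y.
  by split.
split; last by rewrite /core /= eb (grp_src_unit gG).
by split=> //; exists x => //; split; rewrite ?(grp_src_unit gG).
Qed.

(** The projection of the fibre over a unit onto the core, along the units of [E_G]. *)
Definition core_proj (e : vbEA V) : vbEA V :=
  addA e (bscale (vbA V) (-1) (u~ (s~ e))).

Lemma unit_src_fib x e : scar x -> FA (u x) e -> FA (u x) (u~ (s~ e)).
Proof.
move=> cx /src_fib; rewrite (grp_src_unit gG) //; exact: unit_fib.
Qed.

Lemma core_proj_fib x e : scar x -> FA (u x) e -> fibre (core V) x (core_proj e).
Proof.
move=> cx Fe; have cu := grp_unit_car gG cx; apply/core_fibreP => //.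
have Fu := unit_src_fib cx Fe; have Fs := src_fib Fe.
rewrite (grp_src_unit gG) // in Fs.
split; first by apply: (fib_add (linA cu)) => //; exact: (fib_scale (linA cu)).
rewrite (srcD Fe (fib_scale (linA cu) _ Fu)) (srcZ _ Fu) (grp_src_unit gE).
  exact: (fib_subb (linO cx)).
by case: Fs.
Qed.

Lemma core_proj_id x c : fibre (core V) x c -> scar x -> core_proj c = c.
Proof.
move=> Fc cx; have cu := grp_unit_car gG cx.
move: Fc => /(core_fibreP _ cx) [Fc c0].
rewrite /core_proj c0 unit_zero //.
have F0 := zero_fib cu; have F1 := fib_scale (linA cu) (-1) F0.
by rewrite -(fib_add0b (linA cu) F1) (fib_subb (linA cu) F0) (fib_badd0 (linA cu) Fc).
Qed.

(** A model of [E_G] over the unit restricts to the core: [core_proj] is smooth and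
    fixes the core. *)
Lemma core_fibre_model x n sg la : scar x ->
  @fibre_model R _ _ (vbA V) (u x) n sg la ->
  @fibre_model R _ _ (core V) x n (core_proj \o sg) la.
Proof.
move=> cx fm; have cu := grp_unit_car gG cx; have lu := linA cu.
have Fs a := fm_fibre fm a; have Fu a := unit_src_fib cx (Fs a).
have FN a := fib_scale lu (-1) (Fu a).
have Fss a : FO x (s~ (sg a)) by have := src_fib (Fs a); rewrite (grp_src_unit gG).
split.
- by move=> a; exact: core_proj_fib.
- move=> a b; rewrite /= /core_proj (fm_sigmaD fm) (srcD (Fs a) (Fs b)).
  rewrite (unitD (Fss a) (Fss b)) (fib_bscaleD lu _ (Fu a) (Fu b)).
  exact: (fib_baddACA lu).
- move=> c a; rewrite /= /core_proj (fm_sigmaZ fm) (srcZ _ (Fs a)).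
  rewrite (unitZ _ (Fss a)) (fib_bscaleD lu _ (Fs a) (FN a)); congr addA.
  by rewrite (fib_bscaleA lu (-1) c (Fu a)) (fib_bscaleA lu c (-1) (Fu a)) mulrC.
- move=> e Fe; rewrite /= (fm_K fm); first exact: (core_proj_id Fe cx).
  by move: Fe => /(core_fibreP _ cx) [].
- move=> e e' /(core_fibreP _ cx) [Fe e0] /(core_fibreP _ cx) [Fe' e0'].
  have [F1 E1] := fm_add fm Fe Fe'; split=> //; apply/core_fibreP => //; split=> //.
  by rewrite (srcD Fe Fe') e0 e0'; exact: (fib_badd0 (linO cx) (fib_zero (linO cx))).
- move=> c e /(core_fibreP _ cx) [Fe e0].
  have [F1 E1] := fm_scale fm c Fe; split=> //; apply/core_fibreP => //; split=> //.
  by rewrite (srcZ _ Fe) e0 (fib_scale0 (linO cx)).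
- have [F0 E0] := fm_zero fm; split=> //; apply/core_fibreP => //; split=> //.
  by rewrite src_zero // (grp_src_unit gG).
Qed.

Lemma linC x : scar x -> linear_fibre (core V) x.
Proof.
move=> cx; have [n [sg [la fm]]] := linA (grp_unit_car gG cx).
by exists n, (core_proj \o sg), la; exact: core_fibre_model.
Qed.

Lemma smooth_core : smooth_bundle (core V).
Proof.
have hA := smooth_A; have hO := smooth_O.
have [sS _ _ _ _] := vb_src hV; have [sU sUb _ _ _] := vb_unit hV.
have [_ _ spA _] := vb_A_bundle hV.
have sSb : smooth s by case: (vb_src hV).
split.
- exact: (subsp_local_plots _ (sb_total hA)).
- exact: (sb_base hO).
- split=> [c [ce [x cx [[_ bc] _]]]|m U p [pp _]].
    by rewrite /core /= bc (grp_src_unit gG).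
  exact: (sSb.2 _ _ _ (spA.2 _ _ _ pp)).
- exact: linC.
- move=> m U p pp v Uv.
  have pu : plot (s := vbGA V) U (u \o p) by exact: sUb.2.
  have [W [n [sg [la [Wv WU hm]]]]] := sb_model hA pu Uv.
  have cp w : W w -> scar (p w) by move=> /WU; exact: (plot_car (sb_base hO) pp).
  exists W, n, (fun w => core_proj \o sg w), la; split=> //; split.
  + exact: (sm_open hm).
  + by move=> w Ww; apply: core_fibre_model; [exact: cp|exact: (sm_fibre hm)].
  + move=> W' a oW' W'W Ca.
    have Fs w : W' w -> FA (u (p w)) (sg w (a w)).
      by move=> /W'W Ww; exact: (fm_fibre (sm_fibre hm Ww)).
    split=> [|w W'w]; last first.
      have cw := cp w (W'W w W'w).
      have /(core_fibreP _ cw) [F1 E1] := core_proj_fib cw (Fs w W'w).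
      by exists (p w) => //; split=> //; rewrite (grp_src_unit gG).
    have p1 := sm_sigma hm oW' W'W Ca.
    have pu' := plot_restrict (sb_base hA) oW' (subset_trans W'W WU) pu.
    have Fu w : W' w -> FA (u (p w)) (u~ (s~ (sg w (a w)))).
      by move=> W'w; apply: unit_src_fib (Fs w W'w); exact/cp/W'W.
    apply: (smooth_add hA pu' p1) => [|w W'w|w W'w].
    * apply: (smooth_scale hA (p := u \o p) (-1) pu').
        exact: (sU.2 _ _ _ (sS.2 _ _ _ p1)).
      by move=> w W'w; case: (Fu w W'w).
    * by case: (Fs w W'w).
    * have cw := grp_unit_car gG (cp w (W'W w W'w)).
      by case: (fib_scale (linA cw) (-1) (Fu w W'w)).
  + move=> W' q W'W [pq Cq] qp; apply: (sm_lambda hm) => // w W'w.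
    have [x cx [[_ bq] _]] := Cq w W'w.
    by have := qp w W'w; rewrite /core /= bq (grp_src_unit gG) // => ->.
Qed.

(** * S-bisection frames *)

(** The s-bisection conditions in a form that is easier to use: since [E_M] has rank
    [k], a complement [H] of [ker s~] (of [ker t~]) framed by [R^k] is mapped
    isomorphically to [E_M] by [s~] (by [t~]). *)
Record sframe phi (g : vbGA V) : Prop := {
  sf_frame : is_frame (vbA V) g phi;
  sf_ker : forall w, s~ (phi (w, 0)) = 0O (s g);
  sf_src : is_frame (vbO V) (s g) (fun v => s~ (phi (0, v)));
  sf_tgt : is_frame (vbO V) (t g) (fun v => t~ (phi (0, v))) }.

Definition uncol (T : Type) a b (chi : 'cV[R]_(a + b) -> T) (x : 'cV[R]_a * 'cV[R]_b) : T :=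
  chi (col_mx x.1 x.2).
Definition tocol (T : Type) a b (phi : 'cV[R]_a * 'cV[R]_b -> T) (y : 'cV[R]_(a + b)) : T :=
  phi (usubmx y, dsubmx y).

Lemma tocolK (T : Type) a b (phi : 'cV[R]_a * 'cV[R]_b -> T) : uncol (tocol phi) = phi.
Proof. by apply/funext => -[x y]; rewrite /uncol /tocol col_mxKu col_mxKd. Qed.

Lemma uncolK (T : Type) a b (chi : 'cV[R]_(a + b) -> T) : tocol (uncol chi) = chi.
Proof. by apply/funext => x; rewrite /uncol /tocol vsubmxK. Qed.

Lemma uncol_frame (T B : @sspace R) (E : bundle T B) x a b (chi : 'cV[R]_(a + b) -> T) :
  is_frame E x chi -> is_frame E x (uncol chi).
Proof.
move=> [F L I S]; split.
- by move=> v; exact: F.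
- by move=> c v w; rewrite /uncol -L scale_col_mx add_col_mx.
- by move=> [v v'] [w w'] /I /eq_col_mx /= [-> ->].
- by move=> e /S [v ve]; exists (usubmx v, dsubmx v); rewrite /uncol vsubmxK.
Qed.

Lemma tocol_frame (T B : @sspace R) (E : bundle T B) x a b (phi : 'cV[R]_a * 'cV[R]_b -> T) :
  is_frame E x phi -> is_frame E x (tocol phi).
Proof.
move=> [F L I S]; split.
- by move=> v; exact: F.
- by move=> c v w; rewrite /tocol -L !linearP.
- by move=> v w /I [] v1 v2; rewrite -(vsubmxK v) v1 v2 vsubmxK.
- by move=> e /S [[v v'] ve]; exists (col_mx v v'); rewrite /tocol col_mxKu col_mxKd.
Qed.

Section AtFrame.
Context phi g (cg : scar g) (hphi : is_frame (vbA V) g phi).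
Let lg := linA cg.

Lemma pair_frame_split w v : phi (w, v) = addA (phi (0, v)) (phi (w, 0)).
Proof. by rewrite -(frameD lg hphi) /= /GRing.add /= /add_pair /= add0r addr0. Qed.

Lemma pair_frame_addr w v v' : phi (w, v + v') = addA (phi (w, v)) (phi (0, v')).
Proof. by rewrite -(frameD lg hphi) /= /GRing.add /= /add_pair /= addr0. Qed.

Lemma pair_frame_addl w w' v : phi (w + w', v) = addA (phi (w, v)) (phi (w', 0)).
Proof. by rewrite -(frameD lg hphi) /= /GRing.add /= /add_pair /= addr0. Qed.

Lemma pair_frame_linear (T' B' : @sspace R) (E' : bundle T' B') F f a x y :
  bundle_morphism (vbA V) E' F f ->
  F (phi (a *: x + y)) = badd E' (bscale E' a (F (phi x))) (F (phi y)).
Proof.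
move=> [_ _ _ DF ZF]; have Fx := frame_fibre hphi x; have Fy := frame_fibre hphi y.
rewrite (frameD lg hphi) (frameZ lg hphi) (DF g) //; last exact: (fib_scale lg).
by rewrite ZF //; case: Fx.
Qed.

Lemma linear_inr a (v v' : 'cV[R]_k) :
  (0, a *: v + v') = a *: (0, v) + (0, v') :> 'cV[R]_l * 'cV[R]_k.
Proof. by apply: injective_projections; rewrite /= ?scaler0 ?addr0. Qed.

Lemma linear_inl a (w w' : 'cV[R]_l) :
  (a *: w + w', 0) = a *: (w, 0) + (w', 0) :> 'cV[R]_l * 'cV[R]_k.
Proof. by apply: injective_projections; rewrite /= ?scaler0 ?addr0. Qed.

Lemma complement_of_frame F f :
  bundle_morphism (vbA V) (vbO V) F f ->
  is_frame (vbO V) (f g) (fun v => F (phi (0, v))) ->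
  complementary g [set phi (0, v) | v in [set: 'cV[R]_k]]
    [set e | FA g e /\ F e = 0O (f g)].
Proof.
move=> hF hf; have F0 := fib_zero lg.
have lf : linear_fibre (vbO V) (f g).
  by apply: linO; case: hF => _ [sf _] _ _ _; exact: sf.
have E0 := bundle_morphism_zero hF lg lf.
split.
  apply/seteqP; split=> [e [[v _ <-] [_ ev]]|e ->] /=.
    by rewrite (frame_eq0 lf hf ev) (frame0 lg hphi).
  by split=> //; exists 0 => //; exact: (frame0 lg hphi).
move=> e; split=> [Fe|[h [n [[v _ <-] [Fn _] ->]]]]; last first.
  by apply: (fib_add lg) => //; exact: frame_fibre.
have [v ve] := frame_surj hf (bundle_morphism_fibre hF Fe).
have Fv := frame_fibre hphi (0, v); have FN := fib_scale lg (-1) Fv.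
exists (phi (0, v)), (addA e (bscale (vbA V) (-1) (phi (0, v)))); split.
- by exists v.
- split; first exact: (fib_add lg).
  case: hF => _ _ _ DF ZF; rewrite (DF g) // ZF ?ve; last by case: Fv.
  apply: (fib_subb lf); rewrite -ve; exact: (frame_fibre hf v).
- by rewrite (fib_baddC lg Fe FN) (fib_baddA lg) // (fib_subb lg) // (fib_add0b lg).
Qed.

End AtFrame.

Lemma sbis_sframe phi : scar (s := sbis_space V l k) phi ->
  scar (frame_base (vbA V) phi) /\ sframe phi (frame_base (vbA V) phi).
Proof.
move=> [/frame_at_base [cg hphi] [K C1 C2]]; split=> //.
set g := frame_base _ _ in cg hphi K C1 C2 *.
have lg := linA cg.
have cs := grp_src_car gG cg; have ct := grp_tgt_car gG cg.
have aux F f : bundle_morphism (vbA V) (vbO V) F f ->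
    complementary g [set phi (0, v) | v in [set: 'cV[R]_k]]
      [set e | FA g e /\ F e = 0O (f g)] ->
    is_frame (vbO V) (f g) (fun v => F (phi (0, v))).
  move=> hF [CF _]; have [_ [sf _] _ _ _] := hF.
  have [lf [th hth]] := vector_bundle_frame (vb_O_bundle hV) (sf _ cg).
  apply: (frame_of_injective lf hth) => [v|a v w|v v0].
  - exact: (bundle_morphism_fibre hF (frame_fibre hphi _)).
  - by rewrite linear_inr; exact: (pair_frame_linear cg hphi _ _ _ hF).
  - have : [set 0A g] (phi (0, v)).
      by rewrite -CF; split; [exists v|split=> //; exact: (frame_fibre hphi)].
    by move=> /(frame_eq0 lg hphi) [].
split=> //.
- by move=> w; case: (K w).
- exact: (aux _ _ (vb_src hV)).
- exact: (aux _ _ (vb_tgt hV)).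
Qed.

Lemma sframe_sbis phi g : scar g -> sframe phi g ->
  scar (s := sbis_space V l k) phi.
Proof.
move=> cg [hphi K S T]; split; first by exists g.
rewrite /sbisection (frame_base_eq hphi); split.
- by move=> w; split=> //; exact: (frame_fibre hphi).
- exact: (complement_of_frame cg hphi (vb_src hV) S).
- exact: (complement_of_frame cg hphi (vb_tgt hV) T).
Qed.

(** Injectivity suffices, by comparison with the ranks of [E_G] and [E_M]. *)
Lemma sframe_intro phi g : scar g ->
  (forall x, FA g (phi x)) ->
  (forall a x y, phi (a *: x + y) = addA (bscale (vbA V) a (phi x)) (phi y)) ->
  (forall w, s~ (phi (w, 0)) = 0O (s g)) ->
  (forall w, phi (w, 0) = 0A g -> w = 0) ->
  (forall v, s~ (phi (0, v)) = 0O (s g) -> v = 0) ->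
  (forall v, t~ (phi (0, v)) = 0O (t g) -> v = 0) ->
  sframe phi g.
Proof.
move=> cg Fphi Lphi K I S T.
have cs := grp_src_car gG cg; have ct := grp_tgt_car gG cg.
have [lg [th hth]] := vector_bundle_frame (vb_A_bundle hV) cg.
have ls := linO cs.
have D x y : phi (x + y) = addA (phi x) (phi y).
  by have := Lphi 1 x y; rewrite scale1r (fib_bscale1 lg).
have hphi : is_frame (vbA V) g phi.
  rewrite -(tocolK phi); apply: uncol_frame; apply: (frame_of_injective lg hth).
  - by move=> v; exact: Fphi.
  - by move=> a v w; rewrite /tocol -Lphi !linearP.
  - move=> y; rewrite /tocol => p0; rewrite -(vsubmxK y).
    move: (usubmx y) (dsubmx y) p0 => w v p0.
    have pE : phi (w, v) = addA (phi (w, 0)) (phi (0, v)).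
      by rewrite -D; congr (phi _); congr pair; rewrite ?addr0 ?add0r.
    have v0 : v = 0.
      apply: S; have := congr1 (s~) p0.
      rewrite pE (srcD (Fphi _) (Fphi _)) K (src_zero cg) (fib_add0b ls) //.
      exact: (src_fib (Fphi _)).
    by move: p0; rewrite v0 => /I ->; rewrite col_mx0.
have aux F f : bundle_morphism (vbA V) (vbO V) F f ->
    (forall v, F (phi (0, v)) = 0O (f g) -> v = 0) ->
    is_frame (vbO V) (f g) (fun v => F (phi (0, v))).
  move=> hF F0; have [_ [sf _] _ _ _] := hF.
  have [lf [th' hth']] := vector_bundle_frame (vb_O_bundle hV) (sf _ cg).
  apply: (frame_of_injective lf hth') => [v|a v w|//].
  - exact: (bundle_morphism_fibre hF (frame_fibre hphi _)).
  - by rewrite linear_inr; exact: (pair_frame_linear cg hphi _ _ _ hF).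
split=> //.
- exact: (aux _ _ (vb_src hV)).
- exact: (aux _ _ (vb_tgt hV)).
Qed.

Section SF.
Context phi g (cg : scar g) (hp : sframe phi g).
Let hphi := sf_frame hp.
Let lg := linA cg.
Let cs := grp_src_car gG cg.
Let ct := grp_tgt_car gG cg.
Let ls := linO cs.
Let lt := linO ct.

Lemma sf_fib x : FA g (phi x). Proof. exact: (frame_fibre hphi). Qed.

Lemma sf_srcE w v : s~ (phi (w, v)) = s~ (phi (0, v)).
Proof.
rewrite (pair_frame_split cg hphi) (srcD (sf_fib _) (sf_fib _)) (sf_ker hp).
exact: (fib_badd0 ls (src_fib (sf_fib _))).
Qed.

(** The right translation in [sbis_tgt] does not change the target. *)
Lemma sbis_d_frame_matrix : sbis_d phi =
  frame_matrix (fun v => t~ (phi (0, v))) (fun w => t~ (phi (w, 0))).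
Proof.
have tE w : t~ (right_translation (inv (frame_base (vbA V) phi)) (phi (w, 0))) =
            t~ (phi (w, 0)).
  have ci := grp_inv_car gG cg.
  rewrite (frame_base_eq hphi) /right_translation (grp_tgt_mul gE) //.
  - by case: (sf_fib (w, 0)).
  - by case: (zero_fib ci).
  - by rewrite (sf_ker hp) (tgt_zero ci) (grp_tgt_inv gG).
by apply/matrixP => i j; rewrite !mxE /core_anchor /= tE.
Qed.

Lemma sf_d_ker w : t~ (phi (w, 0)) = t~ (phi (0, sbis_d phi *m w)).
Proof.
rewrite sbis_d_frame_matrix; symmetry.
apply: (frame_matrixE (f := fun w => t~ (phi (w, 0))) lt w (sf_tgt hp)).
  by move=> v; exact: (tgt_fib (sf_fib _)).
by move=> a v v'; rewrite linear_inl; exact: (pair_frame_linear cg hphi _ _ _ (vb_tgt hV)).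
Qed.

Lemma sf_tgtE w v : t~ (phi (w, v)) = t~ (phi (0, v + sbis_d phi *m w)).
Proof.
rewrite (pair_frame_split cg hphi) (pair_frame_addr cg hphi).
by rewrite !(tgtD (sf_fib _) (sf_fib _)) sf_d_ker.
Qed.

Lemma sf_d_unique (D : 'M[R]_(k, l)) :
  (forall w, t~ (phi (w, 0)) = t~ (phi (0, D *m w))) -> sbis_d phi = D.
Proof.
move=> hD; apply/matrixP => i j; have := hD (delta_mx j 0); rewrite sf_d_ker.
by move=> /(frame_injective (sf_tgt hp)) /colP /(_ i); rewrite -!colE !mxE.
Qed.

Lemma sf_tgt_kernel w : t~ (phi (- w, sbis_d phi *m w)) = 0O (t g).
Proof.
rewrite sf_tgtE mulmxN subrr -(tgt_zero cg) -(frame0 lg hphi); by [].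
Qed.

End SF.

(** * The groupoid of s-bisection frames *)

Lemma inv_inj g e : scar g -> FA g e -> tau~ e = 0A (inv g) -> e = 0A g.
Proof.
move=> cg [ce _] e0; rewrite -[LHS](ginvK gE ce) e0 inv_zero ?(ginvK gG) //.
exact: (grp_inv_car gG).
Qed.

Section Inverse.
Context phi g (cg : scar g) (hp : sframe phi g).
Let hphi := sf_frame hp.
Let fib x : FA g (phi x) := sf_fib hp x.

Lemma sbis_inv_linear a x y : sbis_inv phi (a *: x + y) =
  addA (bscale (vbA V) a (sbis_inv phi x)) (sbis_inv phi y).
Proof.
rewrite /sbis_inv -(pair_frame_linear cg hphi _ _ _ (vb_inv hV)).
congr (tau~ (phi _)); apply: injective_projections => /=.
  by rewrite opprD scalerN.
by rewrite mulmxDr -scalemxAr scalerDr addrACA.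
Qed.

Lemma sframe_inv : sframe (sbis_inv phi) (inv g).
Proof.
have ci := grp_inv_car gG cg.
have fi x : FA (inv g) (sbis_inv phi x) by exact: (inv_fib).
have scE x : s~ (tau~ (phi x)) = t~ (phi x).
  by apply: (grp_src_inv gE); case: (fib x).
have tgE x : t~ (tau~ (phi x)) = s~ (phi x).
  by apply: (grp_tgt_inv gE); case: (fib x).
apply: (sframe_intro ci fi sbis_inv_linear) => [w|w|v|v]; rewrite /sbis_inv /=.
- by rewrite scE add0r (sf_tgt_kernel cg hp) (grp_src_inv gG).
- move=> /(inv_inj cg (fib _)) /(frame_eq0 (linA cg) hphi) [+ _] => /eqP.
  by rewrite oppr_eq0 => /eqP.
- rewrite scE oppr0 mulmx0 addr0 (grp_src_inv gG) //.
  exact: (frame_eq0 (linO (grp_tgt_car gG cg)) (sf_tgt hp)).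
- rewrite tgE oppr0 mulmx0 addr0 (grp_tgt_inv gG) //.
  exact: (frame_eq0 (linO (grp_src_car gG cg)) (sf_src hp)).
Qed.

Lemma sbis_d_inv : sbis_d (sbis_inv phi) = sbis_d phi.
Proof.
have ci := grp_inv_car gG cg.
have tgE x : t~ (tau~ (phi x)) = s~ (phi x).
  by apply: (grp_tgt_inv gE); case: (fib x).
apply: (sf_d_unique ci sframe_inv) => w.
rewrite /sbis_inv /= !tgE oppr0 mulmx0 addr0 add0r; exact: (sf_srcE cg hp).
Qed.

End Inverse.

Lemma right_translationK h e : scar h -> scar e -> s~ e = 0O (s h) ->
  m~ (m~ e (0A (inv h))) (0A h) = e.
Proof.
move=> ch ce e0; have ci := grp_inv_car gG ch.
have cs := grp_src_car gG ch.
have [[cz _] [czi _]] := (zero_fib ch, zero_fib ci).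
rewrite -(grp_mulA gE) //; first last.
- by rewrite (src_zero ci) (tgt_zero ch) (grp_src_inv gG).
- by rewrite e0 (tgt_zero ci) (grp_tgt_inv gG).
rewrite (mul_zero ci ch) ?(grp_src_inv gG) // (grp_Vmul gG) // -(unit_zero cs).
by rewrite -e0 (grp_mul1 gE).
Qed.

Section Product.
Context phi g psi h (cg : scar g) (hp : sframe phi g) (ch : scar h) (hq : sframe psi h).
Hypothesis comp : sbis_src phi = sbis_tgt psi.
Let hphi := sf_frame hp.
Let hpsi := sf_frame hq.
Let fib x : FA g (phi x) := sf_fib hp x.
Let fibq x : FA h (psi x) := sf_fib hq x.

Let comp_b v : s~ (phi (0, v)) = t~ (psi (0, v)).
Proof. by have := congr1 (fun f => f.2 v) comp. Qed.

Let comp_c w : m~ (tau~ (phi (- w, sbis_d phi *m w))) (0A g) =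
               m~ (psi (w, 0)) (0A (inv h)).
Proof.
have := congr1 (fun f => f.1 w) comp.
by rewrite /sbis_src /sbis_tgt /= /right_translation (frame_base_eq hphi) (frame_base_eq hpsi).
Qed.

Lemma composable_base : s g = t h.
Proof. exact: (fib_base_composable (fib (0, 0)) (fibq (0, 0)) (comp_b 0)). Qed.

Let ctau w : s~ (tau~ (phi (- w, sbis_d phi *m w))) = t~ (0A g).
Proof.
rewrite (grp_src_inv gE); last by case: (fib (- w, sbis_d phi *m w)).
by rewrite (tgt_zero cg); exact: (sf_tgt_kernel cg hp).
Qed.

(** The anchor matrix is constant along the groupoid: for the target of [psi], which
    is the source of [phi], the core part comes from [ker t~]-vectors
    [phi (- w, d w)], whose source is that of [phi (0, d w)]. *)
Lemma composable_d : sbis_d psi = sbis_d phi.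
Proof.
have cih := grp_inv_car gG ch.
apply: (sf_d_unique ch hq) => w.
have -> : t~ (psi (w, 0)) = t~ (m~ (psi (w, 0)) (0A (inv h))).
  rewrite (grp_tgt_mul gE) //; [by case: (fibq (w, 0))|by case: (zero_fib cih)|].
  by rewrite (sf_ker hq) (tgt_zero cih) (grp_tgt_inv gG).
rewrite -comp_c -comp_b (grp_tgt_mul gE) //.
- rewrite (grp_tgt_inv gE); first exact: (sf_srcE cg hp).
  by case: (fib (- w, sbis_d phi *m w)).
- by case: (inv_fib (fib (- w, sbis_d phi *m w))).
- by case: (zero_fib cg).
Qed.

Let comp_ker w : s~ (phi (w, 0)) = t~ (0A h).
Proof. by rewrite (sf_ker hp) (tgt_zero ch) composable_base. Qed.

Let comp_d w v : s~ (phi (w, v + sbis_d phi *m w)) = t~ (psi (w, v)) .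
Proof. by rewrite (sf_srcE cg hp) (sf_tgtE ch hq) comp_b composable_d. Qed.

(** With [X = phi (- w, d w)], the vector [psi (w, 0)] is the product of [tau~ X] and
    zero vectors, while [phi (0, d w) = X + phi (w, 0)]; the product [m~ X (tau~ X)]
    vanishes since [t~ X = 0], and [phi (w, 0)] remains. *)
Lemma core_exchange w :
  m~ (phi (0, sbis_d phi *m w)) (psi (w, 0)) = m~ (phi (w, 0)) (0A h).
Proof.
set X := phi (- w, sbis_d phi *m w); have FX : FA g X := fib _.
have [cX _] := FX; have FtX := inv_fib FX; have [ctX _] := FtX.
have ci := grp_inv_car gG cg; have cu := grp_unit_car gG (grp_tgt_car gG cg).
have [cphi _] := fib (0, sbis_d phi *m w).
have [[c0g _] [c0h _]] := (zero_fib cg, zero_fib ch).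
have sE : s~ (phi (0, sbis_d phi *m w)) = t~ (tau~ X).
  by rewrite (grp_tgt_inv gE) // /X (sf_srcE cg hp (- w)).
have s00 : s~ (0A g) = t~ (0A h).
  by rewrite (src_zero cg) (tgt_zero ch) composable_base.
rewrite -[psi (w, 0)](right_translationK ch (proj1 (fibq (w, 0))) (sf_ker hq w)) -comp_c -/X.
rewrite (grp_mulA gE) ?(grp_mulA gE cphi ctX c0g) //; first last.
- by rewrite (grp_src_mul gE) //; exact: ctau.
- by rewrite (grp_tgt_mul gE) //; exact: ctau.
- by apply: (grp_mul_car gE) => //; exact: ctau.
- exact: ctau.
congr (m~ _ _).
have -> : m~ (phi (0, sbis_d phi *m w)) (tau~ X) = m~ (phi (w, 0)) (0A (inv g)).
  have pE : phi (0, sbis_d phi *m w) = addA X (phi (w, 0)).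
    by rewrite -(pair_frame_addl cg hphi) addNr.
  have s0i : s~ (phi (w, 0)) = t~ (0A (inv g)).
    by rewrite (sf_ker hp) (tgt_zero ci) (grp_tgt_inv gG).
  have F0i := zero_fib ci.
  have FM : FA (u (t g)) (m~ (phi (w, 0)) (0A (inv g))).
    by rewrite -(grp_mulV gG cg); exact: (mul_fib (fib _) F0i s0i).
  rewrite pE -{1}(fib_badd0 (linA ci) FtX).
  rewrite (vb_mul_add hV FX (fib _) FtX F0i) // ?(grp_tgt_inv gE) //.
  rewrite (grp_mulV gE) // (sf_tgt_kernel cg hp) (unit_zero (grp_tgt_car gG cg)).
  exact: (fib_add0b (linA cu) FM).
exact: (right_translationK cg (proj1 (fib (w, 0))) (sf_ker hp w)).
Qed.

(** The multiplication of [E_G] in the coordinates given by the frames: split both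
    factors into three composable pairs and use [core_exchange] for the last one. *)
Lemma sbis_mulE w1 w2 v :
  m~ (phi (w1, v + sbis_d phi *m w2)) (psi (w2, v)) = sbis_mul phi psi (w1 + w2, v).
Proof.
have lg := linA cg; have lh := linA ch.
have cgh := grp_mul_car gG cg ch composable_base; have lgh := linA cgh.
rewrite /sbis_mul /right_translation (frame_base_eq hpsi) /=.
(* The first pair gives the product frame at [(0, v)], the second one the right
   translate of [phi (w1, 0)], the third one that of [phi (w2, 0)]. *)
have phiE : phi (w1, v + sbis_d phi *m w2) =
    addA (phi (0, v)) (addA (phi (w1, 0)) (phi (0, sbis_d phi *m w2))).
  rewrite -!(frameD lg hphi); congr phi.
  by apply: injective_projections; rewrite /= ?add0r ?addr0.
have psiE : psi (w2, v) = addA (psi (0, v)) (addA (0A h) (psi (w2, 0))).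
  by rewrite (fib_add0b lh) // (pair_frame_split ch hpsi).
have F0h := zero_fib ch.
have dE : s~ (phi (0, sbis_d phi *m w2)) = t~ (psi (w2, 0)).
  by rewrite -comp_d add0r (sf_srcE cg hp w2).
have F1 := fib_add lg (fib (w1, 0)) (fib (0, sbis_d phi *m w2)).
have F2 := fib_add lh F0h (fibq (w2, 0)).
rewrite phiE psiE (vb_mul_add hV (fib _) F1 (fibq _) F2) //; last first.
  by rewrite (srcD (fib _) (fib _)) (tgtD F0h (fibq _)) comp_ker dE.
rewrite (vb_mul_add hV (fib _) (fib _) F0h (fibq _)) // core_exchange.
congr addA; have := vb_mul_add hV (fib (w1, 0)) (fib (w2, 0)) F0h F0h
  (comp_ker w1) (comp_ker w2).
rewrite (fib_badd0 lh F0h) => <-; congr (m~ _ _).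
by rewrite -(pair_frame_addl cg hphi).
Qed.

Let mulE w v : sbis_mul phi psi (w, v) = m~ (phi (w, v)) (psi (0, v)).
Proof. by rewrite -{1}(addr0 w) -sbis_mulE mulmx0 addr0. Qed.

Let comp0 w v : s~ (phi (w, v)) = t~ (psi (0, v)).
Proof. by rewrite (sf_srcE cg hp). Qed.

Lemma sframe_mul : sframe (sbis_mul phi psi) (mul g h).
Proof.
have cgh := grp_mul_car gG cg ch composable_base.
have cphi x : scar (phi x) by case: (fib x).
have cpsi x : scar (psi x) by case: (fibq x).
apply: (sframe_intro cgh) => [[w v]|a [w v] [w' v']|w|w|v|v].
- by rewrite mulE; exact: (mul_fib).
- rewrite [a *: _ + _](_ : _ = (a *: w + w', a *: v + v')) // !mulE.
  rewrite -(vb_mul_scale hV) // -(vb_mul_add hV (g := g) (h := h)) //.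
  + congr (m~ _ _).
      by rewrite -(frameZ (linA cg) hphi) -(frameD (linA cg) hphi).
    rewrite -(frameZ (linA ch) hpsi) -(frameD (linA ch) hpsi); congr psi.
    by apply: injective_projections; rewrite /= ?scaler0 ?addr0.
  + exact: (fib_scale (linA cg)).
  + exact: (fib_scale (linA ch)).
  + by rewrite (srcZ _ (fib _)) (tgtZ _ (fibq _)) comp0.
- rewrite mulE (grp_src_mul gE) // (grp_src_mul gG) ?composable_base //.
  by rewrite (frame0 (linA ch) hpsi) (src_zero ch).
- rewrite mulE (frame0 (linA ch) hpsi) => w0.
  suff /(frame_eq0 (linA cg) hphi) [] : phi (w, 0) = 0A g by [].
  have := congr1 (fun e => m~ e (0A (inv h))) w0.
  have ci := grp_inv_car gG ch.
  have [[c0 _] [ci0 _]] := (zero_fib ch, zero_fib ci).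
  have E0 : s~ (0A h) = t~ (0A (inv h)).
    by rewrite (src_zero ch) (tgt_zero ci) (grp_tgt_inv gG).
  rewrite -(grp_mulA gE) // (mul_zero ch ci) ?(grp_tgt_inv gG) // (grp_mulV gG) //.
  rewrite -composable_base -(unit_zero (grp_src_car gG cg)) -(sf_ker hp w).
  rewrite (grp_mul1 gE) // => ->.
  rewrite (mul_zero cgh ci) ?(grp_tgt_inv gG) ?(grp_src_mul gG) ?composable_base //.
  rewrite -(grp_mulA gG) // ?composable_base ?(grp_tgt_inv gG) // (grp_mulV gG) //.
  by rewrite -composable_base (grp_mul1 gG).
- rewrite mulE (grp_src_mul gE) // (grp_src_mul gG) ?composable_base //.
  exact: (frame_eq0 (linO (grp_src_car gG ch)) (sf_src hq)).
- rewrite mulE (grp_tgt_mul gE) // (grp_tgt_mul gG) ?composable_base //.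
  exact: (frame_eq0 (linO (grp_tgt_car gG cg)) (sf_tgt hp)).
Qed.

Lemma sbis_d_mul : sbis_d (sbis_mul phi psi) = sbis_d phi.
Proof.
have cgh := grp_mul_car gG cg ch composable_base.
have cphi x : scar (phi x) by case: (fib x).
have cpsi x : scar (psi x) by case: (fibq x).
apply: (sf_d_unique cgh sframe_mul) => w.
by rewrite !mulE !(grp_tgt_mul gE) // (sf_d_ker cg hp).
Qed.

Lemma sbis_mul_decompose w v :
  sbis_mul phi psi (w, v) = m~ (phi (w, v)) (psi (0, v)) /\
  s~ (phi (w, v)) = t~ (psi (0, v)).
Proof. by split; [exact: mulE|exact: comp0]. Qed.

Lemma composableP w1 v1 w2 v2 : s~ (phi (w1, v1)) = t~ (psi (w2, v2)) ->
  v1 = v2 + sbis_d phi *m w2.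
Proof.
rewrite (sf_srcE cg hp) (sf_tgtE ch hq) comp_b composable_d.
exact: (frame_injective (sf_tgt hq)).
Qed.

End Product.

Lemma sbis_objP (f : sbis_obj V l k) : scar (s := sbis_obj V l k) f -> exists x,
  [/\ scar x, is_frame (core V) x f.1 & is_frame (vbO V) x f.2].
Proof.
move=> [[/frame_at_base [c1 h1] /frame_at_base [c2 h2]] /= bb].
by exists (frame_base (vbO V) f.2); split=> //; rewrite -bb.
Qed.

Lemma anchor_matrixE (f : sbis_obj V l k) x w : scar x -> is_frame (core V) x f.1 ->
  is_frame (vbO V) x f.2 -> f.2 (anchor_matrix f *m w) = t~ (f.1 w).
Proof.
move=> cx h1 h2; have cu := grp_unit_car gG cx.
have F1 v : FA (u x) (f.1 v) by have /(core_fibreP _ cx) [] := frame_fibre h1 v.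
apply: (frame_matrixE (f := fun w => t~ (f.1 w)) (linO cx) w h2) => [v|a v v'].
  by have := tgt_fib (F1 v); rewrite (grp_tgt_unit gG).
rewrite (frameD (linC cx) h1) (frameZ (linC cx) h1) /=.
rewrite (tgtD (fib_scale (linA cu) a (F1 v)) (F1 v')).
by rewrite (tgtZ _ (F1 v)).
Qed.

Section UnitFrame.
Context (f : sbis_obj V l k) x (cx : scar x)
  (h1 : is_frame (core V) x f.1) (h2 : is_frame (vbO V) x f.2).
Let cu := grp_unit_car gG cx.
Let lu := linA cu.
Let lx := linO cx.
Let lc := linC cx.

Let F1 w : FA (u x) (f.1 w).
Proof. by have /(core_fibreP _ cx) [] := frame_fibre h1 w. Qed.

Let S1 w : s~ (f.1 w) = 0O x.
Proof. by have /(core_fibreP _ cx) [] := frame_fibre h1 w. Qed.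

Let F2 v : FA (u x) (u~ (f.2 v)).
Proof. exact: (unit_fib (frame_fibre h2 v)). Qed.

Let cf2 v : scar (f.2 v). Proof. by case: (frame_fibre h2 v). Qed.

Lemma sbis_unit_src w v : s~ (sbis_unit f (w, v)) = f.2 v.
Proof.
rewrite /sbis_unit (srcD (F2 v) (F1 w)) S1 (grp_src_unit gE) //.
exact: (fib_badd0 lx (frame_fibre h2 v)).
Qed.

Lemma sbis_unit_base v : sbis_unit f (0, v) = u~ (f.2 v).
Proof. by rewrite /sbis_unit /= (frame0 lc h1); exact: (fib_badd0 lu (F2 v)). Qed.

Lemma sbis_unit_core w : sbis_unit f (w, 0) = f.1 w.
Proof.
rewrite /sbis_unit /= (frame0 lx h2) (unit_zero cx).
exact: (fib_add0b lu (F1 w)).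
Qed.

Lemma sframe_unit : sframe (sbis_unit f) (u x).
Proof.
have su := grp_src_unit gG cx; have tu := grp_tgt_unit gG cx.
apply: (sframe_intro cu) => [[w v]|a [w v] [w' v']|w|w|v|v].
- exact: (fib_add lu (F2 v) (F1 w)).
- rewrite /sbis_unit /= (frameD lx h2) (frameZ lx h2) (frameD lc h1) (frameZ lc h1).
  have Fz := frame_fibre h2 v; have Fz' := frame_fibre h2 v'.
  rewrite (unitD (fib_scale lx a Fz) Fz') (unitZ _ Fz).
  rewrite (fib_baddACA lu (fib_scale lu a (F2 v)) (F2 v') (fib_scale lu a (F1 w)) (F1 w')).
  by rewrite (fib_bscaleD lu).
- by rewrite sbis_unit_src su (frame0 lx h2).
- by rewrite sbis_unit_core; exact: (frame_eq0 lc h1).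
- by rewrite sbis_unit_src su; exact: (frame_eq0 lx h2).
- rewrite sbis_unit_base (grp_tgt_unit gE) // tu; exact: (frame_eq0 lx h2).
Qed.

End UnitFrame.

Section Ends.
Context phi g (cg : scar g) (hp : sframe phi g).
Let hphi := sf_frame hp.
Let fib x : FA g (phi x) := sf_fib hp x.
Let ci := grp_inv_car gG cg.
Let ct := grp_tgt_car gG cg.
Let cs := grp_src_car gG cg.

(** The right translation by [g^-1] maps [ker s~] over [g] onto the core, with inverse
    the right translation by [g]. *)
Lemma sbis_tgt_core_frame : is_frame (core V) (t g) (sbis_tgt phi).1.
Proof.
have F0 := zero_fib ci; have F0g := zero_fib cg.
have E0 w : s~ (phi (w, 0)) = t~ (0A (inv g)).
  by rewrite (sf_ker hp) (tgt_zero ci) (grp_tgt_inv gG).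
have FM w : FA (u (t g)) (m~ (phi (w, 0)) (0A (inv g))).
  by rewrite -(grp_mulV gG cg); exact: (mul_fib (fib _) F0 (E0 w)).
rewrite /sbis_tgt /right_translation /= (frame_base_eq hphi).
have K w : m~ (m~ (phi (w, 0)) (0A (inv g))) (0A g) = phi (w, 0).
  exact: (right_translationK cg (proj1 (fib (w, 0))) (sf_ker hp w)).
split.
- move=> w; apply/(core_fibreP _ ct); split=> //.
  rewrite (grp_src_mul gE) ?(src_zero ci) ?(grp_src_inv gG) //.
    by case: (fib (w, 0)).
  by case: F0.
- move=> a w w'; rewrite linear_inl (frameD (linA cg) hphi) (frameZ (linA cg) hphi) /=.
  have [[c0 _] [cw _]] := (F0, fib (w, 0)).
  rewrite -{1}(fib_badd0 (linA ci) F0) -{1}(fib_scale0 (linA ci) a).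
  have Fa := fib_scale (linA cg) a (fib (w, 0)).
  have F0a := fib_scale (linA ci) a F0.
  rewrite (vb_mul_add hV Fa (fib _) F0a F0) //.
    by rewrite (vb_mul_scale hV).
  by rewrite (srcZ _ (fib _)) (tgtZ _ F0) E0.
- move=> w w' ww'.
  have : phi (w, 0) = phi (w', 0) by rewrite -(K w) -(K w') ww'.
  by move=> /(frame_injective hphi) [].
- move=> c /(core_fibreP _ ct) [Fc c0].
  have E1 : s~ c = t~ (0A g) by rewrite c0 (tgt_zero cg).
  have Fcg : FA g (m~ c (0A g)).
    by rewrite -{1}(grp_1mul gG cg); exact: (mul_fib Fc F0g E1).
  have [[w v] wv] := frame_surj hphi Fcg.
  have v0 : v = 0.
    apply: (frame_eq0 (linO cs) (sf_src hp)); rewrite -(sf_srcE cg hp w) wv.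
    by rewrite (grp_src_mul gE) ?(src_zero cg) //; [case: Fc|case: F0g].
  exists w; rewrite -{1}v0 wv.
  have := right_translationK ci (proj1 Fc).
  by rewrite (ginvK gG cg) (grp_src_inv gG cg); apply.
Qed.

Lemma sbis_tgt_coreE w : (sbis_tgt phi).1 w = m~ (phi (w, 0)) (0A (inv g)).
Proof. by rewrite /sbis_tgt /right_translation (frame_base_eq hphi). Qed.

Lemma sbis_src_coreE w :
  (sbis_src phi).1 w = m~ (tau~ (phi (- w, sbis_d phi *m w))) (0A g).
Proof. by rewrite /sbis_src /right_translation (frame_base_eq hphi). Qed.

Lemma sbis_tgt_inv : sbis_tgt (sbis_inv phi) = sbis_src phi.
Proof.
have hpi := sframe_inv cg hp.
congr pair; apply/funext => w; rewrite /right_translation /sbis_inv /=.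
  rewrite (frame_base_eq (sf_frame hpi)) (frame_base_eq hphi) (ginvK gG cg).
  by rewrite add0r.
rewrite (grp_tgt_inv gE) ?oppr0 ?mulmx0 ?addr0 //.
by case: (fib (0, w)).
Qed.

Lemma sbis_src_inv : sbis_src (sbis_inv phi) = sbis_tgt phi.
Proof.
have hpi := sframe_inv cg hp.
congr pair; apply/funext => w; rewrite /right_translation.
  rewrite (frame_base_eq (sf_frame hpi)) (frame_base_eq hphi) (sbis_d_inv cg hp).
  rewrite /sbis_inv /= opprK mulmxN addrN (ginvK gE) //.
  by case: (fib (w, 0)).
rewrite /sbis_inv /= (grp_src_inv gE) ?oppr0 ?mulmx0 ?addr0 //.
by case: (fib (0, w)).
Qed.

Lemma sbis_mul_inv_base v : sbis_mul phi (sbis_inv phi) (0, v) = u~ (t~ (phi (0, v))).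
Proof.
have [mE _] := sbis_mul_decompose cg hp ci (sframe_inv cg hp) (esym sbis_tgt_inv) 0 v.
rewrite mE /sbis_inv /= oppr0 mulmx0 addr0 (grp_mulV gE) //.
by case: (fib (0, v)).
Qed.

Lemma sbis_mul_inv_core w : sbis_mul phi (sbis_inv phi) (w, 0) = (sbis_tgt phi).1 w.
Proof.
have [mE _] := sbis_mul_decompose cg hp ci (sframe_inv cg hp) (esym sbis_tgt_inv) w 0.
by rewrite mE (frame0 (linA ci) (sf_frame (sframe_inv cg hp))) /sbis_tgt /=
  /right_translation (frame_base_eq hphi).
Qed.

End Ends.

Lemma sbis_inv_mul_base phi g v : scar g -> sframe phi g ->
  sbis_mul (sbis_inv phi) phi (0, v) = u~ (s~ (phi (0, v))).
Proof.
move=> cg hp; have ci := grp_inv_car gG cg; have hpi := sframe_inv cg hp.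
have [mE _] := sbis_mul_decompose ci hpi cg hp (sbis_src_inv cg hp) 0 v.
rewrite mE /sbis_inv /= oppr0 mulmx0 addr0 (grp_Vmul gE) //.
by case: (sf_fib hp (0, v)).
Qed.

Lemma sbis_src_core_frame phi g : scar g -> sframe phi g ->
  is_frame (core V) (s g) (sbis_src phi).1.
Proof.
move=> cg hp; have ci := grp_inv_car gG cg.
rewrite -(sbis_tgt_inv cg hp) -(grp_tgt_inv gG cg).
exact: (sbis_tgt_core_frame ci (sframe_inv cg hp)).
Qed.

(** * The operations of the dual groupoid in dual frames *)

Lemma functional_dual_frame (T B : @sspace R) (E : bundle T B) x r
    (phi : 'cV[R]_r -> T) (f : T -> R) a : is_frame E x phi ->
  (forall v, f (phi v) = dot a v) -> functional E x f = dual_frame E phi a.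
Proof.
move=> hphi fE; rewrite /dual_frame (frame_base_eq hphi).
by apply: functional_ext => e /(frame_surj hphi) [v <-]; rewrite fE (frameK hphi).
Qed.

(** The basis [chi] of the opening comment, of which the dual frame of [phi] is the dual
    basis. *)
Definition shear (D : 'M[R]_(k, l)) phi (y : 'cV[R]_(k + l)) : vbEA V :=
  phi (dsubmx y, usubmx y - D *m dsubmx y).

Lemma shear_frame D phi g : is_frame (vbA V) g phi -> is_frame (vbA V) g (shear D phi).
Proof.
move=> [F L I S]; split.
- by move=> v; exact: F.
- move=> c v w; rewrite /shear -L; congr phi; apply: injective_projections => /=.
    by rewrite linearP.
  by rewrite !linearP /= scalerBr scalerN addrACA.
- move=> v w /I [] vw; rewrite vw => /addIr vw'.
  by rewrite -(vsubmxK v) vw vw' vsubmxK.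
- move=> e /S [[w v] ve]; exists (col_mx (v + D *m w) w).
  by rewrite /shear col_mxKu col_mxKd addrK.
Qed.

Section AtFrame.
Context phi g (cg : scar g) (hp : sframe phi g).
Let hphi := sf_frame hp.
Let lg := linA cg.

Lemma dual_sbisE : dsbis phi =
  uncol (dual_frame (vbA V) (shear (sbis_d phi) phi)).
Proof.
apply/funext => -[b a]; rewrite /uncol /dual_sbis (frame_base_eq hphi).
have hs := shear_frame (sbis_d phi) hphi.
apply: (functional_dual_frame hs) => y /=.
rewrite /shear (frameK hphi) /= addrNK -{3}(vsubmxK y) dot_col_mx.
by congr (_ + dot _ _).
Qed.

Lemma dual_sbis_frame : is_frame DA g (dsbis phi).
Proof.
rewrite dual_sbisE; apply: uncol_frame.
exact: (dual_frame_frame cg lg (shear_frame _ hphi)).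
Qed.

Lemma dual_sbis_val b a w v :
  (dsbis phi (b, a)).2 (phi (w, v)) = dot b (v + sbis_d phi *m w) + dot a w.
Proof.
rewrite /dual_sbis (frame_base_eq hphi) functional_in; last exact: (frame_fibre hphi).
by rewrite (frameK hphi).
Qed.

Lemma dual_sbis_base x : (dsbis phi x).1 = g.
Proof. exact: (frame_base_eq hphi). Qed.

Lemma dual_sbis_ext (z : dual_space (vbA V)) b a : fibre DA g z ->
  (forall w v, z.2 (phi (w, v)) = dot b (v + sbis_d phi *m w) + dot a w) ->
  z = dsbis phi (b, a).
Proof.
move=> hz zE; apply: (dual_fibre_ext hz (frame_fibre dual_sbis_frame _)) => e.
by move=> /(frame_surj hphi) [[w v] <-]; rewrite zE dual_sbis_val.
Qed.

Lemma dual_sbis_zero : dsbis phi (0, 0) = bzero DA g.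
Proof.
rewrite /dual_sbis (frame_base_eq hphi); congr pair; apply/funext => e /=.
by case: ifP => // _; rewrite !dot0l addr0.
Qed.

Lemma dual_inv_sbis b a : dual_inv (dsbis phi (b, a)) =
  dsbis (sbis_inv phi) (- b, a + (sbis_d phi)^T *m b).
Proof.
have ci := grp_inv_car gG cg; have hpi := sframe_inv cg hp.
have hi := sf_frame hpi.
rewrite /dual_inv dual_sbis_base {2}/dual_sbis (frame_base_eq hi).
apply: functional_ext => e /(frame_surj hi) [[w v] <-].
rewrite (frameK hi) {1}/sbis_inv (ginvK gE); last first.
  by case: (frame_fibre hphi (- w, v + sbis_d phi *m w)).
rewrite dual_sbis_val /= (sbis_d_inv cg hp) mulmxN addrK.
rewrite !(dotDl, dotDr, dotNl, dotNr) -dot_mulmx; lra.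
Qed.

End AtFrame.

Section Product.
Context phi g psi h (cg : scar g) (hp : sframe phi g) (ch : scar h) (hq : sframe psi h).
Hypothesis comp : sbis_src phi = sbis_tgt psi.

(** The hypothesis is the composability of the two elements of the dual: their values
    on the exchanged core vectors must agree.  The product is characterized by
    its values on composable pairs, all of which are described by
    [sbis_mulE]. *)
Lemma dual_mul_sbis b1 a1 b2 a2 : a1 = a2 + (sbis_d phi)^T *m b2 ->
  dual_mul (dsbis phi (b1, a1)) (dsbis psi (b2, a2)) =
  dsbis (sbis_mul phi psi) (b1 + b2, a2).
Proof.
move=> aE; have gh := composable_base hp hq comp.
have cgh := grp_mul_car gG cg ch gh.
have hm := sframe_mul cg hp ch hq comp.
have dE := composable_d cg hp ch hq comp.
have dm := sbis_d_mul cg hp ch hq comp.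
rewrite /dual_mul; apply: the_unique => [|z [cz zb zE]].
  have [cx _] := frame_fibre (dual_sbis_frame cgh hm) (b1 + b2, a2).
  split=> //; first by rewrite (dual_sbis_base hm) (dual_sbis_base hp) (dual_sbis_base hq).
  rewrite (dual_sbis_base hp) (dual_sbis_base hq) => e1 e2 F1 F2 se.
  have [[w1 v1] E1] := frame_surj (sf_frame hp) F1.
  have [[w2 v2] E2] := frame_surj (sf_frame hq) F2; subst e1 e2.
  have vE := composableP cg hp ch hq comp se.
  rewrite vE (sbis_mulE cg hp ch hq comp).
  rewrite (dual_sbis_val hm) (dual_sbis_val hp) (dual_sbis_val hq) dm dE.
  rewrite aE mulmxDr !(dotDl, dotDr) -dot_mulmx.
  lra.
have bz : fibre DA (mul g h) z.
  by split=> //; rewrite /= zb (dual_sbis_base hp) (dual_sbis_base hq).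
apply: (dual_sbis_ext cgh hm bz) => w v.
have [mE cE] := sbis_mul_decompose cg hp ch hq comp w v.
rewrite mE zE ?(dual_sbis_base hp) ?(dual_sbis_base hq) //; last 2 first.
- exact: (frame_fibre (sf_frame hp)).
- exact: (frame_fibre (sf_frame hq)).
rewrite (dual_sbis_val hp) (dual_sbis_val hq) dm dE mulmx0 addr0 dot0r.
by rewrite aE !(dotDl, dotDr) -dot_mulmx; lra.
Qed.

Lemma dual_right_translation_sbis b :
  right_translation (V := W) h (dsbis phi (b, 0)) =
  dsbis (sbis_mul phi psi) (b, 0).
Proof.
rewrite /right_translation -(dual_sbis_zero hq) /=.
by rewrite dual_mul_sbis ?addr0 // mulmx0 addr0.
Qed.

Lemma dual_sbis_mul : dsbis (sbis_mul phi psi) =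
  sbis_mul (V := W) (l := k) (k := l) (dsbis phi) (dsbis psi).
Proof.
apply/funext => -[b a].
have gh := composable_base hp hq comp.
have cgh := grp_mul_car gG cg ch gh.
have hm := sframe_mul cg hp ch hq comp.
have bE : frame_base (vbA W) (dsbis psi) = h by exact: (dual_sbis_base hq).
rewrite [RHS]/sbis_mul bE /=; symmetry.
rewrite dual_right_translation_sbis dual_mul_sbis; last by rewrite mulmx0 addr0.
have hd := dual_sbis_frame cgh hm; have [_ hL _ _] := hd.
have := hL 1 (0, a) (b, 0); rewrite scale1r.
have -> : (0, a) + (b, 0) = (b, a) :> 'cV[R]_k * 'cV[R]_l.
  by apply: injective_projections; rewrite /= ?add0r ?addr0.
move=> ->; rewrite add0r /=; congr pair; apply/funext => e /=.
by rewrite mul1r.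
Qed.

End Product.

Section Ends.
Context phi g (cg : scar g) (hp : sframe phi g).
Let hphi := sf_frame hp.
Let ci := grp_inv_car gG cg.
Let ct := grp_tgt_car gG cg.
Let cs := grp_src_car gG cg.
Let hpi := sframe_inv cg hp.
Local Notation Xi := (dsbis phi).

Let fib x : FA g (phi x). Proof. exact: (frame_fibre hphi). Qed.

Let XiB : frame_base (vbA W) Xi = g. Proof. exact: (dual_sbis_base hp). Qed.

Lemma dual_tgt_sbis a : dual_tgt (Xi (0, a)) = dual_frame (core V) (sbis_tgt phi).1 a.
Proof.
rewrite /dual_tgt (dual_sbis_base hp).
apply: (functional_dual_frame (sbis_tgt_core_frame cg hp)) => w.
rewrite (sbis_tgt_coreE hp) (right_translationK cg (proj1 (fib (w, 0))) (sf_ker hp w)).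
by rewrite (dual_sbis_val hp) dot0l add0r.
Qed.

Lemma dual_src_sbis a : dual_src (Xi (0, a)) = dual_frame (core V) (sbis_src phi).1 a.
Proof.
rewrite /dual_src (dual_sbis_base hp).
apply: (functional_dual_frame (sbis_src_core_frame cg hp)) => w.
rewrite (sbis_src_coreE hp).
set X := phi (- w, sbis_d phi *m w); have [cX _] : FA g X := fib _.
rewrite (gmul_inv_mul gE) ?(ginvK gE) //.
- by rewrite /X (dual_sbis_val hp) dot0l add0r dotNr opprK.
- by case: (inv_fib (fib (- w, sbis_d phi *m w))).
- by case: (zero_fib cg).
- by rewrite (grp_src_inv gE) // (tgt_zero cg); exact: (sf_tgt_kernel cg hp).
Qed.

(** The zero covector over [g^-1] is the value at 0 of the dual frame of [phi^-1],
    so the right translation is the product of frames [phi phi^-1], which is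
    explicit on the units and on the core. *)
Lemma dual_sbis_tgt_core b : (sbis_tgt (V := W) (l := k) (k := l) Xi).1 b =
  dsbis (sbis_mul phi (sbis_inv phi)) (b, 0).
Proof.
rewrite /sbis_tgt XiB.
exact: (dual_right_translation_sbis cg hp ci hpi (esym (sbis_tgt_inv cg hp))).
Qed.

Lemma anchor_matrix_tr (f' : sbis_obj W k l) x (c : 'cV[R]_l -> core_space V)
    (D : 'M[R]_(k, l)) : scar x -> is_frame (core V) x c -> f'.2 = dual_frame (core V) c ->
  (forall b, core_anchor (f'.1 b) = dual_frame (core V) c (D^T *m b)) ->
  anchor_matrix f' = D^T.
Proof.
move=> cx hc f2 f1; apply/matrixP => i j; rewrite mxE f1 f2.
have hd := dual_frame_frame cx (linC cx) hc.
by rewrite (frameK hd) -colE mxE.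
Qed.

Let mulE v : sbis_mul phi (sbis_inv phi) (0, v) = u~ (t~ (phi (0, v))).
Proof. exact: (sbis_mul_inv_base cg hp). Qed.

Let hm : sframe (sbis_mul phi (sbis_inv phi)) (u (t g)).
Proof.
rewrite -(grp_mulV gG cg).
exact: (sframe_mul cg hp ci hpi (esym (sbis_tgt_inv cg hp))).
Qed.

Lemma core_mul_zero x c : scar x -> FA (u x) c -> s~ c = 0O x -> m~ c (0A (u x)) = c.
Proof.
move=> cx [cc _] c0; rewrite -(unit_zero cx) -c0; exact: (grp_mul1 gE).
Qed.

Lemma sbis_d_dual : sbis_d (V := W) (l := k) (k := l) Xi = (sbis_d phi)^T.
Proof.
have hc := sbis_tgt_core_frame cg hp.
apply: (anchor_matrix_tr ct hc) => [|b].
  by apply/funext => a; exact: dual_tgt_sbis.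
rewrite dual_sbis_tgt_core /core_anchor /= /dual_tgt (dual_sbis_base hm).
rewrite (grp_tgt_unit gG ct); apply: (functional_dual_frame hc) => w.
have /(core_fibreP _ ct) [Fc c0] := frame_fibre hc w.
rewrite (core_mul_zero ct Fc c0) -(sbis_mul_inv_core cg hp) (dual_sbis_val hm).
rewrite (sbis_d_mul cg hp ci hpi (esym (sbis_tgt_inv cg hp))).
by rewrite dot0l addr0 add0r -dot_mulmx.
Qed.

Lemma dual_sbis_tgt : 
  ((fun w => of_dual_core ((sbis_tgt (V := W) (l := k) (k := l) Xi).1 w)),
   (sbis_tgt (V := W) (l := k) (k := l) Xi).2) =
  (dual_frame (vbO V) (sbis_tgt phi).2, dual_frame (core V) (sbis_tgt phi).1).
Proof.
congr pair; apply/funext => b; last exact: dual_tgt_sbis.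
rewrite dual_sbis_tgt_core /of_dual_core (dual_sbis_base hm) (grp_src_unit gG ct).
apply: (functional_dual_frame (sf_tgt hp)) => v.
by rewrite -mulE (dual_sbis_val hm) mulmx0 addr0 dot0l addr0.
Qed.

Let hn : sframe (sbis_mul (sbis_inv phi) phi) (u (s g)).
Proof.
rewrite -(grp_Vmul gG cg).
exact: (sframe_mul ci hpi cg hp (sbis_src_inv cg hp)).
Qed.

Lemma dual_sbis_src :
  ((fun w => of_dual_core ((sbis_src (V := W) (l := k) (k := l) Xi).1 w)),
   (sbis_src (V := W) (l := k) (k := l) Xi).2) =
  (dual_frame (vbO V) (sbis_src phi).2, dual_frame (core V) (sbis_src phi).1).
Proof.
congr pair; apply/funext => b; last exact: dual_src_sbis.
rewrite /sbis_src XiB sbis_d_dual /= (dual_inv_sbis cg hp) opprK mulmxN addrN.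
rewrite (dual_right_translation_sbis ci hpi cg hp (sbis_src_inv cg hp)).
rewrite /of_dual_core (dual_sbis_base hn) (grp_src_unit gG cs).
apply: (functional_dual_frame (sf_src hp)) => v.
rewrite -(sbis_inv_mul_base v cg hp) (dual_sbis_val hn).
by rewrite mulmx0 addr0 dot0l addr0.
Qed.

Lemma dual_sbis_inv : dsbis (sbis_inv phi) =
  sbis_inv (V := W) (l := k) (k := l) Xi.
Proof.
apply/funext => -[b a]; rewrite [RHS]/sbis_inv /= sbis_d_dual (dual_inv_sbis cg hp).
by rewrite opprK mulmxN addrK.
Qed.

End Ends.

Section Unit.
Context (f : sbis_obj V l k) (x : vbGO V) (cx : scar x).
Hypotheses (h1 : is_frame (core V) x f.1) (h2 : is_frame (vbO V) x f.2).

Lemma of_dual_coreK (eta : dual_space (vbO V)) : scar eta ->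
  of_dual_core (to_dual_core eta) = eta.
Proof.
case: eta => y z [/= cy zD zZ z0].
rewrite /of_dual_core /to_dual_core /= (grp_src_unit gG cy).
apply/esym/functional_eq => // v Fv.
have Fu := unit_fib Fv.
by rewrite mem_set //= (grp_tgt_unit gE) //; case: Fv.
Qed.

Lemma anchor_matrix_dual :
  anchor_matrix (V := W) (l := k) (k := l)
    (fun w => to_dual_core (dual_frame (vbO V) f.2 w), dual_frame (core V) f.1) =
  (anchor_matrix f)^T.
Proof.
apply: (anchor_matrix_tr cx h1) => // b.
have bE : frame_base (vbO V) f.2 = x by exact: (frame_base_eq h2).
rewrite /core_anchor /= /dual_tgt /= bE (grp_tgt_unit gG cx).
apply: (functional_dual_frame h1) => w.
have /(core_fibreP _ cx) [Fc c0] := frame_fibre h1 w.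
rewrite (core_mul_zero cx Fc c0) mem_set //.
rewrite -(anchor_matrixE w cx h1 h2) mem_set; last exact: (frame_fibre h2).
by rewrite (frameK h2) -dot_mulmx.
Qed.

Lemma dual_sbis_unit : dsbis (sbis_unit f) =
  sbis_unit (V := W) (l := k) (k := l)
    (fun w => to_dual_core (dual_frame (vbO V) f.2 w), dual_frame (core V) f.1).
Proof.
have hs := sframe_unit cx h1 h2; have cu := grp_unit_car gG cx.
apply/funext => -[b a].
have E1 : (dual_frame (core V) f.1 a).1 = x by exact: (frame_base_eq h1).
have E2 : (dual_frame (vbO V) f.2 b).1 = x by exact: (frame_base_eq h2).
transitivity ((u x, fun e => (dual_unit (dual_frame (core V) f.1 a)).2 e +
    (to_dual_core (dual_frame (vbO V) f.2 b)).2 e) : dual_space (vbA V)); last first.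
  by rewrite -{1}E1.
rewrite /dual_unit /to_dual_core E1 E2 /dual_sbis (frame_base_eq (sf_frame hs)).
congr pair; apply/funext => e.
case: ifPn => [/set_mem Fe|/negP Fe]; last first.
  by rewrite !functional_out ?addr0 // => Fe'; apply: Fe; exact: mem_set.
rewrite !functional_in //; first last.
- by rewrite (frame_base_eq h1); exact: (core_proj_fib cx Fe).
- by rewrite (frame_base_eq h2) -(grp_tgt_unit gG cx); exact: (tgt_fib Fe).
have [[w v] ve] := frame_surj (sf_frame hs) Fe; rewrite -ve (frameK (sf_frame hs)).
have F2 := unit_fib (frame_fibre h2 v).
have /(core_fibreP _ cx) [F1 _] := frame_fibre h1 w.
have lu := linA cu.
have -> : addA (sbis_unit f (w, v))
    (bscale (vbA V) (-1) (u~ (s~ (sbis_unit f (w, v))))) = f.1 w.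
  rewrite (sbis_unit_src cx h1 h2) /sbis_unit /=.
  have FN := fib_scale lu (-1) F2.
  by rewrite (fib_baddC lu F2 F1) -(fib_baddA lu F1 F2 FN) (fib_subb lu F2) (fib_badd0 lu F1).
rewrite (frameK h1) (sf_tgtE cu hs) (sbis_unit_base cx h1 h2).
rewrite (grp_tgt_unit gE); last by case: (frame_fibre h2 (v + sbis_d (sbis_unit f) *m w)).
by rewrite (frameK h2) addrC.
Qed.
End Unit.

(** * Dualization of frames is a diffeomorphism *)

Lemma ginv_unit (x : vbGO V) : scar x -> inv (u x) = u x.
Proof.
move=> cx; have cu := grp_unit_car gG cx; have ci := grp_inv_car gG cu.
have := grp_mulV gG cu; rewrite (grp_tgt_unit gG cx) => {2}<-.
have := grp_1mul gG ci; rewrite (grp_tgt_inv gG cu) (grp_src_unit gG cx).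
by move=> ->.
Qed.

Section AtFibre.
Context (g : vbGA V) (cg : scar g) (z : dual_space (vbA V)) (hz : fibre DA g z).
Let ct := grp_tgt_car gG cg.
Let cs := grp_src_car gG cg.
Let ci := grp_inv_car gG cg.
Let zg : z.1 = g. Proof. by case: hz. Qed.

Lemma functional_zero (T B : @sspace R) (E : bundle T B) (x : B) (f : T -> R) :
  functional E x f = (x, fun=> 0) <-> forall e, fibre E x e -> f e = 0.
Proof.
split=> [fE e Fe|f0].
  by rewrite -(functional_in f Fe) fE.
rewrite (functional_ext (g := fun=> 0) f0) /functional; congr pair; apply/funext => e.
by case: ifP.
Qed.

(** The vectors [m~ 0_g (tau~ v)] with [v] in the core are exactly those of [ker t~]
    over [g]. *)
Lemma dual_ker_srcP : @ker_src R W g z <->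
  forall e, FA g e -> t~ e = 0O (t g) -> z.2 e = 0.
Proof.
have [c0 _] := zero_fib cg.
transitivity (dual_src z = (s g, fun=> 0)); first by split=> [[]|].
rewrite /dual_src zg; apply: (iff_trans (functional_zero _ _ _)).
split=> [H e Fe e0|H c /(core_fibreP _ cs) [Fc c1]].
  have [ce _] := Fe; have Fi := inv_fib Fe; have [cie _] := Fi.
  have E0 : s~ (tau~ e) = t~ (0A g) by rewrite (grp_src_inv gE) // e0 (tgt_zero cg).
  have Fv : fibre (core V) (s g) (m~ (tau~ e) (0A g)).
    apply/(core_fibreP _ cs); split.
      by rewrite -(grp_Vmul gG cg); exact: (mul_fib Fi (zero_fib cg) E0).
    by rewrite (grp_src_mul gE) // (src_zero cg).
  have := H _ Fv; rewrite (gmul_inv_mul gE) // (ginvK gE) // => /eqP.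
  by rewrite oppr_eq0 => /eqP.
have [cc _] := Fc; have Fi := inv_fib Fc; have [cic _] := Fi.
have E0 : s~ (0A g) = t~ (tau~ c).
  by rewrite (grp_tgt_inv gE) // c1 (src_zero cg).
rewrite H ?oppr0 //; last by rewrite (grp_tgt_mul gE) // (tgt_zero cg).
have := mul_fib (zero_fib cg) Fi E0.
by rewrite (ginv_unit cs) (grp_mul1 gG cg).
Qed.

Lemma dual_ker_tgtP : @ker_tgt R W g z <->
  forall e, FA g e -> s~ e = 0O (s g) -> z.2 e = 0.
Proof.
have [c0 _] := zero_fib cg; have [ci0 _] := zero_fib ci.
transitivity (dual_tgt z = (t g, fun=> 0)); first by split=> [[]|].
rewrite /dual_tgt zg; apply: (iff_trans (functional_zero _ _ _)).
split=> [H e Fe e0|H c /(core_fibreP _ ct) [Fc c1]].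
  have [ce _] := Fe.
  have E0 : s~ e = t~ (0A (inv g)) by rewrite e0 (tgt_zero ci) (grp_tgt_inv gG cg).
  have Fv : fibre (core V) (t g) (m~ e (0A (inv g))).
    apply/(core_fibreP _ ct); split.
      by rewrite -(grp_mulV gG cg); exact: (mul_fib Fe (zero_fib ci) E0).
    by rewrite (grp_src_mul gE) // (src_zero ci) (grp_src_inv gG cg).
  by have := H _ Fv; rewrite (right_translationK cg ce e0).
have [cc _] := Fc.
have E0 : s~ c = t~ (0A g) by rewrite c1 (tgt_zero cg).
apply: H; last by rewrite (grp_src_mul gE) // (src_zero cg).
have := mul_fib Fc (zero_fib cg) E0.
by rewrite (grp_1mul gG cg).
Qed.

End AtFibre.

(** In the parameters [(b, a)], the kernel of the source of the dual is [a = 0], that of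
    its target is [a = - d^T b], and both are complements of [b = 0]. *)
Lemma dual_sbis_car phi g : scar g -> sframe phi g ->
  scar (s := sbis_space W k l) (dsbis phi).
Proof.
move=> cg hp; have hX := dual_sbis_frame cg hp.
set X := dsbis phi in hX *.
have FX x : fibre DA g (X x) by exact: (frame_fibre hX).
have [th hth] := (vector_bundle_frame (vb_A_bundle hV) cg).2.
have lD : linear_fibre DA g by exact: (dual_linear_fibre cg (linA cg) hth).
have splitX b a a' : X (b, a) = badd DA (X (0, a')) (X (b, a - a')).
  rewrite -(frameD lD hX); congr X.
  by apply: injective_projections; rewrite /= ?add0r // addrC subrK.
have srcP b a : @ker_src R W g (X (b, a)) <-> a = 0.
  apply: (iff_trans (dual_ker_srcP cg (FX _))); split=> [H|-> e Fe].
    apply: dot_eq0; have := H (phi (a, - (sbis_d phi *m a))) (sf_fib hp _).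
    rewrite (dual_sbis_val hp) addNr dot0r add0r; apply.
    rewrite (sf_tgtE cg hp) addNr.
    exact: (frame0 (linO (grp_tgt_car gG cg)) (sf_tgt hp)).
  have [[w v] <-] := frame_surj (sf_frame hp) Fe.
  rewrite (sf_tgtE cg hp) (dual_sbis_val hp) dot0l addr0.
  by move=> /(frame_eq0 (linO (grp_tgt_car gG cg)) (sf_tgt hp)) ->; rewrite dot0r.
have tgtP b a : @ker_tgt R W g (X (b, a)) <-> a = - ((sbis_d phi)^T *m b).
  have vE w : (X (b, a)).2 (phi (w, 0)) = dot (a + (sbis_d phi)^T *m b) w.
    by rewrite (dual_sbis_val hp) add0r dotDl -dot_mulmx addrC.
  apply: (iff_trans (dual_ker_tgtP cg (FX _))); split=> [H|aE e Fe].
    apply/eqP; rewrite -addr_eq0; apply/eqP/dot_eq0.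
    by rewrite -vE; apply: H (sf_fib hp _) (sf_ker hp _).
  have [[w v] <-] := frame_surj (sf_frame hp) Fe.
  rewrite (sf_srcE cg hp).
  move=> /(frame_eq0 (linO (grp_src_car gG cg)) (sf_src hp)) ->.
  by rewrite vE aE addNr dot0l.
have X0 : X (0, 0) = bzero (vbA W) g by exact: (dual_sbis_zero hp).
have XB : frame_base DA X = g by exact: (frame_base_eq hX).
have compl (K : set (dual_space (vbA V))) (c : 'cV[R]_k -> 'cV[R]_l) :
    (forall z, K z -> fibre DA g z) -> c 0 = 0 ->
    (forall b a, K (X (b, a)) <-> a = c b) ->
    @complementary R W g [set X (0, v) | v in [set: 'cV[R]_l]] K.
  move=> KF c0 KE; split.
    apply/seteqP; split=> [z [[a _ <-] /KE ->]|z ->]; first by rewrite c0 X0.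
    split; last by rewrite -X0; apply/KE.
    by exists 0.
  move=> z; split=> [hz|[h [n [[a _ <-] /KF hn ->]]]]; last exact: (fib_add lD).
  have [[b a] <-] := frame_surj hX hz.
  exists (X (0, a - c b)), (X (b, c b)); split.
  - by exists (a - c b).
  - exact/KE.
  - by rewrite {1}(splitX b a (a - c b)) opprB addrCA subrr addr0.
split; first by exists g.
rewrite /sbisection XB; split.
- by move=> b; apply/srcP.
- by apply: (compl _ (fun=> 0)) => [z []|//|].
- apply: (compl _ (fun b => - ((sbis_d phi)^T *m b))) => [z []//||//].
  by rewrite mulmx0 oppr0.
Qed.

(** The matrix [D] with [s~ (chi (D w, w)) = 0]. *)
Definition undual_shear (chi : 'cV[R]_(k + l) -> vbEA V) : 'M[R]_(k, l) :=
  - frame_matrix (fun v => s~ (chi (col_mx v 0))) (fun w => s~ (chi (col_mx 0 w))).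

Definition undual_sbis (Xi : sbis_space W k l) : sbis_space V l k :=
  let chi := predual (E := vbA V) (tocol Xi) in
  fun x => chi (col_mx (x.2 + undual_shear chi *m x.1) x.1).

Lemma dual_sbisK phi g : scar g -> sframe phi g ->
  undual_sbis (dsbis phi) = phi.
Proof.
move=> cg hp; have hphi := sf_frame hp; have lg := linA cg.
have cs := grp_src_car gG cg.
rewrite /undual_sbis (dual_sbisE hp) uncolK.
rewrite (predual_dual_frame cg lg (shear_frame _ hphi)).
have -> : undual_shear (shear (sbis_d phi) phi) = sbis_d phi.
  rewrite /undual_shear; apply/eqP; rewrite eqr_oppLR; apply/eqP.
  have -> : (fun v => s~ (shear (sbis_d phi) phi (col_mx v 0))) =
            (fun v => s~ (phi (0, v))).
    by apply/funext => v; rewrite /shear col_mxKu col_mxKd mulmx0 subr0.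
  have shE w : s~ (shear (sbis_d phi) phi (col_mx 0 w)) = s~ (phi (0, - sbis_d phi *m w)).
    by rewrite /shear col_mxKu col_mxKd sub0r mulNmx (sf_srcE cg hp).
  apply/matrixP => i j; rewrite mxE shE (frameK (sf_src hp)).
  by rewrite -colE !mxE.
by apply/funext => -[w v]; rewrite /shear /= col_mxKu col_mxKd addrK.
Qed.

Section Undual.
Context (Xi : sbis_space W k l) (hXi : scar Xi).
Let g : vbGA V := frame_base (vbA W) Xi.
Let chi := predual (E := vbA V) (tocol Xi).

Let cg : scar g. Proof. by case: hXi => /frame_at_base []. Qed.
Let hX : is_frame DA g Xi. Proof. by case: hXi => /frame_at_base []. Qed.
Let lg := linA cg.
Let cs := grp_src_car gG cg.
Let ct := grp_tgt_car gG cg.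

Lemma predual_chi : is_frame (vbA V) g chi /\ dual_frame (vbA V) chi = tocol Xi.
Proof.
have [n [sg [la fm]]] := lg; have hT := tocol_frame hX.
by split; [exact: (predual_frame cg fm hT)|exact: (dual_frame_predual cg fm hT)].
Qed.

Let hchi := predual_chi.1.
Let Fchi y : FA g (chi y). Proof. exact: (frame_fibre hchi). Qed.

Lemma undual_val b a v w : (Xi (b, a)).2 (chi (col_mx v w)) = dot b v + dot a w.
Proof.
have -> : Xi (b, a) = dual_frame (vbA V) chi (col_mx b a).
  by rewrite predual_chi.2 /tocol col_mxKu col_mxKd.
by rewrite (dual_frame_val _ _ hchi) dot_col_mx.
Qed.

Let FXi x : fibre DA g (Xi x). Proof. exact: (frame_fibre hX). Qed.

Let kill_tgt b e : FA g e -> t~ e = 0O (t g) -> (Xi (b, 0)).2 e = 0.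
Proof.
move=> Fe e0; case: hXi => _ [/(_ b) K _ _].
by have /(dual_ker_srcP cg (FXi _)) := K; apply.
Qed.

(** Decompose [Xi (v, 0)] along the complement of the annihilator of [ker s~]: both
    parts vanish on [chi (v, 0)], so that [v . v = 0]. *)
Lemma undual_src_inj v : s~ (chi (col_mx v 0)) = 0O (s g) -> v = 0.
Proof.
move=> v0; apply: dot_eq0.
case: hXi => _ [_ _ [_ /(_ (Xi (v, 0))) [/(_ (FXi _)) [h [n [[a _ <-] Kn XE]]] _]]].
have Fn : fibre DA g n by case: Kn.
have := undual_val v 0 v 0; rewrite XE /= (undual_val 0 a) !dot0r !dot0l !add0r addr0 => <-.
by move: Kn => /(dual_ker_tgtP cg Fn); apply.
Qed.

Lemma undual_tgt_inj v : t~ (chi (col_mx v 0)) = 0O (t g) -> v = 0.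
Proof.
move=> v0; apply: dot_eq0; have := undual_val v 0 v 0; rewrite dot0l addr0 => <-.
exact: kill_tgt.
Qed.

(** The functionals obtained by composing [t~] with the coordinates of [E_M] annihilate
    [ker t~], hence are of the form [Xi (b, 0)], and so vanish on
    [chi (0, w)]. *)
Lemma undual_tgt_ker w : t~ (chi (col_mx 0 w)) = 0O (t g).
Proof.
have lt := linO ct.
have [th hth] := (vector_bundle_frame (vb_O_bundle hV) ct).2.
set e0 := chi _; have F0 : FA g e0 := Fchi _.
rewrite -[LHS](frame_invK hth (tgt_fib F0)) -(frame0 lt hth); congr th.
apply/colP => i; rewrite [RHS]mxE.
pose la e := frame_inv th (t~ e) i 0.
have FT e : FA g e -> th (frame_inv th (t~ e)) = t~ e.
  by move=> Fe; rewrite (frame_invK hth (tgt_fib Fe)).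
have hz : fibre DA g (functional (vbA V) g la).
  apply: (functional_fibre cg lg) => [e e' Fe Fe'|c e Fe]; rewrite /la.
    rewrite (tgtD Fe Fe') -(FT e Fe) -(FT e' Fe') -(frameD lt hth) !(frameK hth).
    by rewrite mxE.
  by rewrite (tgtZ _ Fe) -(FT e Fe) -(frameZ lt hth) !(frameK hth) mxE.
have [[b a] ba] := frame_surj hX hz.
have kz e : FA g e -> t~ e = 0O (t g) -> (Xi (b, a)).2 e = 0.
  move=> Fe te; rewrite ba functional_in // /la te -(frame0 lt hth) (frameK hth).
  by rewrite mxE.
have [_ XL _ _] := hX.
have Xab e : (Xi (b, a)).2 e = (Xi (0, a)).2 e + (Xi (b, 0)).2 e.
  have := XL 1 (0, a) (b, 0); rewrite scale1r.
  have -> : (0, a) + (b, 0) = (b, a) :> 'cV[R]_k * 'cV[R]_l.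
    by apply: injective_projections; rewrite /= ?add0r ?addr0.
  by move=> ->; rewrite /= mul1r.
(* [Xi (b, 0)] annihilates [ker t~] as well, so [Xi (0, a)] lies in the intersection
   of the two complements. *)
have a0 : a = 0.
  have Ka : @ker_src R W g (Xi (0, a)).
    apply/(dual_ker_srcP cg (FXi _)) => e Fe te.
    by have := kz e Fe te; rewrite Xab (kill_tgt b Fe te) addr0.
  case: hXi => _ [_ [CK _] _].
  have : [set bzero (vbA W) g] (Xi (0, a)) by rewrite -CK; split=> //; exists a.
  move=> Xa0; apply: dot_eq0; have := undual_val 0 a 0 a.
  by rewrite Xa0 /= dot0r add0r => <-.
have laE : (Xi (b, a)).2 e0 = la e0 by rewrite ba functional_in.
rewrite -[LHS]laE a0 /e0 undual_val dot0l dot0r; exact: addr0.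
Qed.

Lemma undual_src_frame : is_frame (vbO V) (s g) (fun v => s~ (chi (col_mx v 0))).
Proof.
have [ls [th hth]] := vector_bundle_frame (vb_O_bundle hV) cs.
apply: (frame_of_injective ls hth) => [v|a v v'|]; last exact: undual_src_inj.
  exact: (src_fib (Fchi _)).
have -> : col_mx (a *: v + v') 0 = a *: col_mx v 0 + col_mx v' 0 :> 'cV[R]_(k + l).
  by rewrite scale_col_mx add_col_mx scaler0 addr0.
rewrite (frameD lg hchi) (frameZ lg hchi).
rewrite (srcD (fib_scale lg a (Fchi _)) (Fchi _)).
by rewrite (srcZ _ (Fchi _)).
Qed.

Lemma undual_shearE w : s~ (chi (col_mx (undual_shear chi *m w) w)) = 0O (s g).
Proof.
have ls := linO cs.
have -> : col_mx (undual_shear chi *m w) w =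
          col_mx 0 w + (- 1) *: col_mx (- undual_shear chi *m w) 0 :> 'cV[R]_(k + l).
  by rewrite scale_col_mx add_col_mx scaler0 addr0 add0r scaleN1r mulNmx opprK.
rewrite (frameD lg hchi) (frameZ lg hchi).
rewrite (srcD (Fchi _) (fib_scale lg _ (Fchi _))) (srcZ _ (Fchi _)).
rewrite /undual_shear opprK.
rewrite (frame_matrixE (f := fun w => s~ (chi (col_mx 0 w))) ls w undual_src_frame).
- exact: (fib_subb ls (src_fib (Fchi _))).
- by move=> v; exact: (src_fib (Fchi _)).
- move=> a v v'.
  have -> : col_mx 0 (a *: v + v') = a *: col_mx 0 v + col_mx 0 v' :> 'cV[R]_(k + l).
    by rewrite scale_col_mx add_col_mx scaler0 addr0.
  rewrite (frameD lg hchi) (frameZ lg hchi).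
  rewrite (srcD (fib_scale lg a (Fchi _)) (Fchi _)).
  by rewrite (srcZ _ (Fchi _)).
Qed.

Lemma undual_sframe : sframe (undual_sbis Xi) g.
Proof.
rewrite /undual_sbis -/chi; set D := undual_shear chi.
have lt := linO ct.
apply: (sframe_intro cg) => [x|a x y|w|w|v|v] /=.
- exact: Fchi.
- rewrite -(frameZ lg hchi) -(frameD lg hchi) scale_col_mx add_col_mx.
  by congr (chi (col_mx _ _)); rewrite /= mulmxDr -scalemxAr scalerDr addrACA.
- by rewrite add0r undual_shearE.
- move=> /(frame_eq0 lg hchi) c0.
  by have /eq_col_mx [] : col_mx (0 + D *m w) w = col_mx 0 0 by rewrite c0 col_mx0.
- by rewrite mulmx0 addr0; exact: undual_src_inj.
- by rewrite mulmx0 addr0; exact: undual_tgt_inj.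
Qed.

Lemma undual_d : sbis_d (undual_sbis Xi) = undual_shear chi.
Proof.
have lt := linO ct.
apply: (sf_d_unique cg undual_sframe) => w.
rewrite /undual_sbis -/chi /= mulmx0 addr0 add0r.
have -> : col_mx (undual_shear chi *m w) w =
    col_mx (undual_shear chi *m w) 0 + col_mx 0 w :> 'cV[R]_(k + l).
  by rewrite add_col_mx addr0 add0r.
rewrite (frameD lg hchi) (tgtD (Fchi _) (Fchi _)) undual_tgt_ker.
exact: (fib_badd0 lt (tgt_fib (Fchi _))).
Qed.

Lemma undual_sbisK : dsbis (undual_sbis Xi) = Xi.
Proof.
apply/funext => -[b a]; apply/esym/(dual_sbis_ext cg undual_sframe) => // w v.
by rewrite undual_d /undual_sbis -/chi undual_val.
Qed.

End Undual.

Lemma smooth_frame_matrix (T B : @sspace R) (E : bundle T B) (hE : smooth_bundle E)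
    r n m (U : set 'rV[R]_m) (th : 'rV[R]_m -> 'cV[R]_n -> T)
    (f : 'rV[R]_m -> 'cV[R]_r -> T) :
  open U -> plot (s := frame_space 'cV[R]_n E) U th ->
  (forall w, plot (s := T) U (fun x => f x w)) ->
  (forall x w, U x -> bpr E (f x w) = frame_base E (th x)) ->
  Cinfty U (fun x => frame_matrix (th x) (f x)).
Proof.
move=> oU pth pf bf; apply/Cinfty_mxP => // i j.
have pj := pf (delta_mx j 0).
have /(Cinfty_mxP oU)/(_ i 0) : Cinfty U (fun x => frame_inv (th x) (f x (delta_mx j 0))).
  by apply: (smooth_frame_coordinates hE pth _ pj) => // x; exact: bf.
by apply: Cinfty_ext => // x _; rewrite mxE.
Qed.

Lemma tocol_plot (T B : @sspace R) (E : bundle T B) a b m (U : set 'rV[R]_m) p :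
  plot (s := frame_space ('cV[R]_a * 'cV[R]_b)%type E) U p ->
  plot (s := frame_space 'cV[R]_(a + b) E) U (fun x => tocol (p x)).
Proof.
move=> [cp pp]; split=> [x Ux|v]; last exact: pp.
by have [y cy hy] := cp x Ux; exists y => //; exact: tocol_frame.
Qed.

Lemma dual_sbis_smooth : smooth (X := sbis_space V l k) (Y := sbis_space W k l)
  (dsbis).
Proof.
have hA := smooth_A; have hO := smooth_O.
have car p : scar (s := sbis_space V l k) p -> scar (s := sbis_space W k l) (dsbis p).
  by move=> /(sbis_sframe) [cg hp]; exact: (dual_sbis_car cg hp).
split=> // m U p [pp sp].
have oU : open U := plot_open (sb_total hA) (pp.2 0).
have cp x : U x -> scar (s := sbis_space V l k) (p x).
  by move=> Ux; split; [exact: pp.1|exact: sp].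
have hp x (Ux : U x) := sbis_sframe (cp x Ux).
split; last by move=> x /cp /car [].
have [sT _ _ _ _] := vb_tgt hV.
(* The anchor matrix is smooth as a matrix of coordinates in the target frames. *)
have Cd : Cinfty U (fun x => sbis_d (p x)).
  apply: (@Cinfty_ext _ _ _ _ (fun x =>
    frame_matrix (fun v => t~ (p x (0, v))) (fun w => t~ (p x (w, 0))))) => //.
    by move=> x Ux; rewrite (sbis_d_frame_matrix (hp x Ux).1 (hp x Ux).2).
  apply: (smooth_frame_matrix hO) => // [|w|x w Ux].
  - split=> [x Ux|v]; last exact: (sT.2 _ _ _ (pp.2 _)).
    have [cg hx] := hp x Ux.
    by exists (t (frame_base (vbA V) (p x))); [exact: (grp_tgt_car gG)|exact: (sf_tgt hx)].
  - exact: (sT.2 _ _ _ (pp.2 _)).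
  - have [cg hx] := hp x Ux; rewrite (frame_base_eq (sf_tgt hx)).
    by case: (tgt_fib (sf_fib hx (w, 0))).
have ps : plot (s := frame_space 'cV[R]_(k + l) (vbA V)) U
    (fun x => shear (sbis_d (p x)) (p x)).
  split=> [x Ux|y].
    have [cg hx] := hp x Ux; exists (frame_base (vbA V) (p x)) => //.
    exact: (shear_frame _ (sf_frame hx)).
  have := smooth_frame_combination hA (tocol_plot pp)
    (a := fun x => col_mx (dsubmx y) (usubmx y + - (sbis_d (p x) *m dsubmx y))).
  move=> H; apply: (plot_ext (sb_total hA) (H _)).
    apply: Cinfty_col_mx => //; first exact: Cinfty_cst.
    apply: CinftyD => //; first exact: Cinfty_cst.
    apply: CinftyN => //; apply: Cinfty_mulmx => //; exact: Cinfty_cst.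
  by move=> x Ux; rewrite /tocol /shear col_mxKu col_mxKd.
have [_ pD] := (smooth_dual_frame hA (k + l)).2 _ _ _ ps.
split=> [x Ux|v]; first by have [] := car _ (cp x Ux).
apply: (dual_plot_ext hA (pD (col_mx v.1 v.2))) => x Ux.
by rewrite /= (dual_sbisE (hp x Ux).2).
Qed.

Lemma undual_sbis_smooth : smooth (X := sbis_space W k l) (Y := sbis_space V l k)
  undual_sbis.
Proof.
have hA := smooth_A; have hO := smooth_O.
have car Xi : scar (s := sbis_space W k l) Xi -> scar (s := sbis_space V l k) (undual_sbis Xi).
  move=> hXi; have [/frame_at_base [cg _] _] := hXi.
  exact: (sframe_sbis cg (undual_sframe hXi)).
split=> // m U p [pp sp].
have cp x : U x -> scar (s := sbis_space W k l) (p x).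
  by move=> Ux; split; [exact: pp.1|exact: sp].
have [_ ppr] := smooth_predual hA (k + l).
have pchi := ppr _ _ _ (tocol_plot pp).
have oU : open U := plot_open (sb_total hA) (pchi.2 0).
pose chi x := predual (E := vbA V) (tocol (p x)).
have [sS _ _ _ _] := vb_src hV.
have pS y : plot (s := vbEO V) U (fun x => s~ (chi x y)).
  exact: (sS.2 _ _ _ (pchi.2 _)).
have hsrc x (Ux : U x) := undual_src_frame (cp x Ux).
have cs x : U x -> scar (s (frame_base (vbA W) (p x))).
  by move=> Ux; have [/frame_at_base [cg _] _] := cp x Ux; exact: (grp_src_car gG).
have CD : Cinfty U (fun x => undual_shear (chi x)).
  apply: CinftyN => //; apply: (smooth_frame_matrix hO) => // [|x w Ux].
  - split=> [x Ux|v]; last exact: pS.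
    by exists (s (frame_base (vbA W) (p x))); [exact: cs|exact: hsrc].
  - rewrite (frame_base_eq (hsrc x Ux)).
    have Fc := frame_fibre (predual_chi (cp x Ux)).1 (col_mx 0 w).
    by case: (src_fib Fc).
split; last by move=> x /cp /car [].
split=> [x Ux|[w v]]; first by have [] := car _ (cp x Ux).
apply: (smooth_frame_combination hA pchi
  (a := fun x => col_mx (v + undual_shear (chi x) *m w) w)).
apply: Cinfty_col_mx => //; last exact: Cinfty_cst.
apply: CinftyD => //; first exact: Cinfty_cst.
by apply: Cinfty_mulmx => //; exact: Cinfty_cst.
Qed.

Lemma dual_sbis_diffeo : diffeo (X := sbis_space V l k) (Y := sbis_space W k l)
  (dsbis).
Proof.
split; first exact: dual_sbis_smooth.
exists undual_sbis; split; first exact: undual_sbis_smooth.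
- by move=> p /(sbis_sframe) [cg hp]; exact: (dual_sbisK cg hp).
- by move=> Xi hXi; exact: undual_sbisK.
Qed.

Lemma dual_objects_diffeo : diffeo (X := sbis_obj V l k) (Y := dual_sbis_obj V l k)
  (@dual_sbis_objects R V l k).
Proof.
have hC := smooth_core; have hO := smooth_O.
have dO := smooth_dual_frame hO k; have dC := smooth_dual_frame hC l.
have pO := smooth_predual hO k; have pC := smooth_predual hC l.
split.
  split=> [f [[f1 f2] bb]|m U p [[p1 p2] bb]].
    by split=> /=; [split; [exact: dO.1|exact: dC.1]|exact/esym].
  split; first by split; [exact: (dO.2 _ _ _ p2)|exact: (dC.2 _ _ _ p1)].
  by move=> x /bb /esym.
pose pre (f : dual_sbis_obj V l k) : sbis_obj V l k :=
  (predual (E := core V) f.2, predual (E := vbO V) f.1).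
have preB r (T B : @sspace R) (E : bundle T B) (hE : smooth_bundle E) f :
    scar (s := frame_space 'cV[R]_r (dual_bundle E)) f ->
    frame_base E (predual f) = frame_base (dual_bundle E) f /\
    dual_frame E (predual f) = f.
  move=> [x cx hf]; have [n [sg [la fm]]] := sb_fibre hE cx.
  rewrite (frame_base_eq (predual_frame cx fm hf)) (frame_base_eq hf).
  by split=> //; exact: (dual_frame_predual cx fm hf).
exists pre; split.
- split=> [f [[f1 f2] bb]|m U p [[p1 p2] bb]].
    split; first by split; [exact: pC.1|exact: pO.1].
    have [E1 _] := preB _ _ _ _ hC _ f2; have [E2 _] := preB _ _ _ _ hO _ f1.
    exact: (etrans E1 (etrans (esym bb) (esym E2))).
  split; first by split; [exact: (pC.2 _ _ _ p2)|exact: (pO.2 _ _ _ p1)].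
  move=> x Ux; have := preB _ _ _ _ hO _ (p1.1 x Ux); have := preB _ _ _ _ hC _ (p2.1 x Ux).
  by move=> [E1 _] [E2 _]; exact: (etrans E1 (etrans (esym (bb x Ux)) (esym E2))).
- move=> f /(sbis_objP) [x [cx h1 h2]]; rewrite /pre /dual_sbis_objects /=.
  rewrite (predual_dual_frame cx (linC cx) h1) (predual_dual_frame cx (linO cx) h2).
  by case: f {h1 h2}.
- move=> f [[f1 f2] bb]; rewrite /pre /dual_sbis_objects /=.
  by rewrite (preB _ _ _ _ hC _ f2).2 (preB _ _ _ _ hO _ f1).2; case: f {f1 f2 bb}.
Qed.

(** * Equivariance *)

Section ActA.
Context phi g (cg : scar g) (hp : sframe phi g) (x : @GL2 R l k).
Hypotheses (hx : scar x) (dx : sbis_d phi = x.1).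
Let fib y : FA g (phi y) := sf_fib hp y.

Let phi' : frame := sbis_actA (V := V) phi x.

Lemma sframe_actA : sframe phi' g /\ sbis_d phi' = gl2_s20 x.
Proof.
have [d [A [J [B [xE uA uB uP uQ]]]]] := GL2_elim hx.
have dE : sbis_d phi = d by rewrite dx xE.
have aE w v : phi' (w, v) = phi (A *m w + J *m B *m v, B *m v).
  by rewrite /phi' /sbis_actA xE /= mul_block_col col_mxKu col_mxKd mul0mx add0r.
have lt := linO (grp_tgt_car gG cg).
have t0 v : t~ (phi' (0, v)) = t~ (phi (0, (1%:M + d *m J) *m B *m v)).
  by rewrite aE (sf_tgtE cg hp) dE mulmx0 add0r !mulmxDl mul1mx !mulmxA.
have s0 v : s~ (phi' (0, v)) = s~ (phi (0, B *m v)).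
  by rewrite aE (sf_srcE cg hp).
have lin a y z : phi' (a *: y + z) = addA (bscale (vbA V) a (phi' y)) (phi' z).
  rewrite /phi' /sbis_actA -(frameZ (linA cg) (sf_frame hp)).
  rewrite -(frameD (linA cg) (sf_frame hp)); congr phi.
  have -> : col_mx (a *: y + z).1 (a *: y + z).2 =
      a *: col_mx y.1 y.2 + col_mx z.1 z.2.
    by rewrite scale_col_mx add_col_mx.
  by apply: injective_projections; rewrite /= mulmxDr -scalemxAr !linearP.
have inj0 n (C : 'M[R]_n) (v : 'cV[R]_n) : C \in unitmx -> C *m v = 0 -> v = 0.
  by move=> uC Cv; rewrite -[v](mulKmx uC) Cv mulmx0.
have h' : sframe phi' g.
  apply: (sframe_intro cg) => [y|//|w|w|v|v].
  - exact: fib.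
  - by rewrite aE !mulmx0 addr0; exact: (sf_ker hp).
  - rewrite aE !mulmx0 addr0 => /(frame_eq0 (linA cg) (sf_frame hp)) [].
    exact: inj0.
  - rewrite s0 => /(frame_eq0 (linO (grp_src_car gG cg)) (sf_src hp)).
    exact: inj0.
  - rewrite t0 => /(frame_eq0 lt (sf_tgt hp)); apply: inj0.
    by rewrite unitmx_mul uP.
split=> //; apply: (sf_d_unique cg h') => w.
rewrite t0 aE !mulmx0 addr0 (sf_d_ker cg hp) dE xE /gl2_s20 !gl2E //.
rewrite -!(mulmxA (invmx _)) (mulmxA _ (invmx _)) mulmxV ?mul1mx ?mulmxA //.
by rewrite unitmx_mul uP.
Qed.

(** The value of a dual frame at [phi o M] involves [shear_mx (- d) *m M]; this is the
    conjugate of [M] times the shear of [phi o M], and the conjugate is moved to the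
    other side of the pairing, where [GLdual2] is its inverse transpose. *)
Lemma dual_sbis_actA : dsbis phi' =
  sbis_actA (V := W) (dsbis phi) (@GLdual2 R l k x).
Proof.
have [h' d'] := sframe_actA.
apply/funext => -[b a]; apply/esym/(dual_sbis_ext cg h').
  exact: (frame_fibre (dual_sbis_frame cg hp)).
move=> w v; rewrite d'.
have [uM _ _] := GL2_shear hx; rewrite (GLdual2E hx).
set K := shear_mx (- x.1) *m x.2 *m shear_mx (gl2_s20 x).
have uK : K \in unitmx by rewrite /K !unitmx_mul !shear_mx_unit uM.
rewrite /sbis_actA [_.2 *m _]/= swap_tr_col col_mxKu col_mxKd.
set c := (invmx K)^T *m col_mx a b; set y := x.2 *m col_mx w v.
rewrite [X in _.2 X]/phi' /sbis_actA -/y (dual_sbis_val hp) dx.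
have shE (D : 'M[R]_(k, l)) (q : 'cV[R]_(l + k)) :
    shear_mx (- D) *m q = col_mx (usubmx q) (dsubmx q + D *m usubmx q).
  rewrite -{1}[q]vsubmxK /shear_mx opprK mul_block_col !mul1mx mul0mx addr0.
  by rewrite [_ + dsubmx q]addrC.
have -> : dot (dsubmx c) (dsubmx y + x.1 *m usubmx y) + dot (usubmx c) (usubmx y) =
          dot c (shear_mx (- x.1) *m y).
  by rewrite shE -{3}[c]vsubmxK dot_col_mx addrC.
rewrite /c -dot_mulmx.
have -> : invmx K *m (shear_mx (- x.1) *m y) =
          shear_mx (- gl2_s20 x) *m col_mx w v.
  apply: (can_inj (mulKmx uK)); rewrite mulKVmx // /K -!mulmxA.
  rewrite (mulmxA (shear_mx (gl2_s20 x))) -{1}[gl2_s20 x]opprK shear_mxN mul1mx.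
  by [].
by rewrite shE col_mxKu col_mxKd dot_col_mx addrC.
Qed.

End ActA.

Lemma dual_frame_mul (T B : @sspace R) (E : bundle T B) y r (phi : 'cV[R]_r -> T)
    (N : 'M[R]_r) a : is_frame E y phi -> N \in unitmx ->
  dual_frame E (fun v => phi (N *m v)) a = dual_frame E phi ((invmx N)^T *m a).
Proof.
move=> hphi uN.
have NB : frame_base E (fun v => phi (N *m v)) = y.
  by rewrite /frame_base mulmx0 -(frame_base_eq hphi).
rewrite {1}/dual_frame NB; apply: (functional_dual_frame hphi) => v.
rewrite -dot_mulmx; congr dot; rewrite /frame_inv; case: xgetP => [w _ wE|/(_ (invmx N *m v))].
  by rewrite -(frame_injective hphi wE) mulKmx.
by rewrite /= mulKVmx.
Qed.

Lemma dual_objects_actO (f : sbis_obj V l k) (x : @GL1 R l k) :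
  scar f -> scar x ->
  @dual_sbis_objects R V l k (sbis_actO f x) =
  pb_actO (p := dual_sbis_pb V l k) (@dual_sbis_objects R V l k f) (@GLdual1 R l k x).
Proof.
move=> /sbis_objP [y [cy h1 h2]] [_ [uA uB]].
rewrite /dual_sbis_objects /sbis_actO; congr pair; apply/funext => a /=.
  rewrite (of_dual_coreK); first exact: (dual_frame_mul _ h2 uB).
  by case: (dual_frame_fibre cy (linO cy) ((invmx x.2)^T *m a) h2).
exact: (dual_frame_mul _ h1 uA).
Qed.

End VBGroupoid.

Theorem corollary5p15 (R : realType) (l k : nat) (V : @vb_groupoid R)
    (hV : is_vb_groupoid l k V) :
  pb_iso (P := sbis_pb V l k) (P' := dual_sbis_pb V l k)
    (@dual_sbis R V l k) (@dual_sbis_objects R V l k)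
    (@GLdual0 R l k) (@GLdual1 R l k) (@GLdual2 R l k).
Proof.
split.
- split.
  + exact: (dual_sbis_diffeo hV).
  + exact: (dual_objects_diffeo hV).
  + by move=> p /(sbis_sframe hV) [cg hp]; exact: (dual_sbis_src hV cg hp).
  + by move=> p /(sbis_sframe hV) [cg hp]; exact: (dual_sbis_tgt hV cg hp).
  + move=> p q /(sbis_sframe hV) [cg hp] /(sbis_sframe hV) [ch hq] pq.
    exact: (dual_sbis_mul hV cg hp ch hq pq).
  + by move=> f /sbis_objP [x [cx h1 h2]]; exact: (dual_sbis_unit hV cx h1 h2).
  + by move=> p /(sbis_sframe hV) [cg hp]; exact: (dual_sbis_inv hV cg hp).
- by [].
- by move=> f [_ fb]; exact: fb.
- exact: GLdual_iso.
- by move=> p /(sbis_sframe hV) [cg hp]; exact: (sbis_d_dual hV cg hp).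
- by move=> f /sbis_objP [x [cx h1 h2]]; exact: (anchor_matrix_dual hV cx h1 h2).
- move=> p x /(sbis_sframe hV) [cg hp] hx dx.
  exact: (dual_sbis_actA hV cg hp hx dx).
- by move=> f x hf hx _; exact: (dual_objects_actO hV hf hx).
Qed.
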